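(* The following conditions for a real function $f$ on $(-1,1)$ are equivalent: (i) $f$ is operator completely monotone on $(-1,1)$; (ii) $-f$ is a non-positive operator monotone function on $(-1,1)$ whose representing measure is supported in $[-1,0]$; (iii) $f$ admits the integral expression $$f(x)=\beta+\int_{[-1,0]}\frac{1-x}{1-\lambda x}\,d\mu(\lambda),\qquad x\in(-1,1),$$ with $\beta\ge0$ and a (unique) finite positive measure $\mu$ on $[-1,0]$.
   Context: $\mathbb{M}_n^{sa}(a,b)$ is the set of $n\times n$ Hermitian matrices with eigenvalues in $(a,b)$; $\mathbb{M}_n^+$ the set of $n\times n$ positive semidefinite matrices. A smooth ($C^\infty$) real function $f$ on $(a,b)$ is operator completely monotone if $$(-1)^k\frac{d^k}{dt^k}f(A+tX)\Big|_{t=0}\ge0,\qquad k=0,1,2,\dots,$$ for every $A\in\mathbb{M}_n^{sa}(a,b)$ and every $X\in\mathbb{M}_n^+$, for any $n\in\mathbb{N}$. A real function $g$ on $(a,b)$ is operator monotone if $A\le B$ implies $g(A)\le g(B)$ for all self-adjoint $A,B$ (equivalently, Hermitian matrices of every size) with spectra in $(a,b)$. The representing measure of an operator monotone function $g$ on $(-1,1)$ is the unique finite positive Borel measure $\mu$ on $[-1,1]$ such that, for every $\alpha\in(-1,1)$, $$g(x)=g(\alpha)+\int_{[-1,1]}\frac{x-\alpha}{(1-\lambda x)(1-\lambda\alpha)}\,d\mu(\lambda),\qquad x\in(-1,1).$$ (The measure $\mu$ in (iii) is not claimed to be this representing measure.) *)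

(* Defs.v *)
From HB Require Import structures.
From mathcomp Require Import all_boot all_order all_algebra.
From mathcomp Require Import sesquilinear spectral complex.
From mathcomp Require Import all_classical all_reals all_analysis.
Set Implicit Arguments.
Unset Strict Implicit.
Unset Printing Implicit Defensive.
Import Order.TTheory GRing.Theory Num.Theory.
Import numFieldNormedType.Exports.
Local Open Scope classical_set_scope.
Local Open Scope ring_scope.
Local Open Scope complex_scope.
Local Open Scope sesquilinear_scope.

(* Real functions on ]a, b[ are represented by total functions R -> R; every
   notion below depends only on their values on ]a, b[. *)

Definition hermitian_in (R : realType) (a b : R) (n : nat) (A : 'M[R[i]]_n) :
    Prop :=
  A \is hermsymmx /\ forall z : R[i], eigenvalue A z -> a%:C < z < b%:C.

Definition psdmx (R : realType) (n : nat) (A : 'M[R[i]]_n) : Prop :=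
  A \is hermsymmx /\ forall u : 'rV[R[i]]_n, 0 <= (u *m A *m u ^t*) 0 0.

Definition loewner_le (R : realType) (n : nat) (A B : 'M[R[i]]_n) : Prop :=
  psdmx (B - A).

(* Functional calculus f(A), for A Hermitian: the library diagonalizes
   A = P^-1 *m diag_mx (spectral_diag A) *m P with P = spectralmx A unitary;
   the entries of spectral_diag A are then real, and the result does not depend
   on the choice of the diagonalization. *)
Definition mxfun (R : realType) (f : R -> R) (n : nat) (A : 'M[R[i]]_n) :
    'M[R[i]]_n :=
  invmx (spectralmx A)
  *m diag_mx (map_mx (fun z : R[i] => (f (complex.Re z))%:C) (spectral_diag A))
  *m spectralmx A.

(* k-th derivative, taken entrywise on real and imaginary parts, of a
   matrix-valued function of a real variable. *)
Definition derivemx (R : realType) (k n : nat) (F : R -> 'M[R[i]]_n) (t : R) :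
    'M[R[i]]_n :=
  \matrix_(i, j) ((derive1n k (fun s => complex.Re (F s i j)) t)
                  +i* (derive1n k (fun s => complex.Im (F s i j)) t)).

Definition smooth_on (R : realType) (a b : R) (f : R -> R) : Prop :=
  forall (k : nat) (x : R), a < x < b -> derivable (derive1n k f) x 1.

(* For smooth f, t |-> f(A + tX) is smooth near 0, so that derivemx below is
   a genuine derivative. *)
Definition operator_completely_monotone (R : realType) (a b : R) (f : R -> R) :
    Prop :=
  smooth_on a b f /\
  forall (n : nat) (A X : 'M[R[i]]_n), hermitian_in a b A -> psdmx X ->
  forall k : nat,
    psdmx ((-1) ^+ k *: derivemx k (fun t : R => mxfun f (A + t%:C *: X)) 0).

Definition operator_monotone (R : realType) (a b : R) (g : R -> R) : Prop :=
  forall (n : nat) (A B : 'M[R[i]]_n), hermitian_in a b A -> hermitian_in a b B ->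
  loewner_le A B -> loewner_le (mxfun g A) (mxfun g B).

Notation finite_borel_measure R :=
  ({finite_measure set (measurableTypeR R) -> \bar R}).

(* A measure on the closed set K is a Borel measure on the line which is null
   outside K; for closed K this also says that its support lies in K. *)
Definition concentrated_on (R : realType) (mu : finite_borel_measure R)
    (K : set R) : Prop :=
  mu (~` K) = 0%E.

(* Only the values on Borel sets are meaningful. *)
Definition same_measure (R : realType) (mu nu : finite_borel_measure R) : Prop :=
  forall A : set (measurableTypeR R), measurable A -> mu A = nu A.

Definition represents (R : realType) (g : R -> R)
    (mu : finite_borel_measure R) : Prop :=
  concentrated_on mu `[-1, 1] /\
  forall alpha x : R, -1 < alpha < 1 -> -1 < x < 1 ->
    g x = g alpha + \int[mu]_(lam in `[-1, 1])
            ((x - alpha) / ((1 - lam * x) * (1 - lam * alpha))).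

Definition representing_measure (R : realType) (g : R -> R)
    (mu : finite_borel_measure R) : Prop :=
  represents g mu /\
  forall nu : finite_borel_measure R, represents g nu -> same_measure nu mu.

Definition integral_expression (R : realType) (f : R -> R) (beta : R)
    (mu : finite_borel_measure R) : Prop :=
  [/\ 0 <= beta, concentrated_on mu `[-1, 0] &
      forall x : R, -1 < x < 1 ->
        f x = beta + \int[mu]_(lam in `[-1, 0]) ((1 - x) / (1 - lam * x))].

(* Main.v *)
Require Import Defs.
From HB Require Import structures.
From mathcomp Require Import all_boot all_order all_algebra.
From mathcomp Require Import sesquilinear spectral complex.
From mathcomp Require Import all_classical all_reals all_analysis.
From mathcomp Require Import measurable_realfun zify ring lra.
Set Implicit Arguments.
Unset Strict Implicit.
Unset Printing Implicit Defensive.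
Import Order.TTheory GRing.Theory Num.Theory.
Import numFieldNormedType.Exports.
Local Open Scope classical_set_scope.
Local Open Scope ring_scope.

(* A function f as in (iii) has the power series coefficients c_0 = beta + mu[-1, 0]
   and c_(k+1) = - \int (1 - l) l^k dmu(l), so for m > 0 the m-th derivative of
   f(A + tX) at 0 is the mu-integral of - m! (1 - l) l^(m-1) Q (X Q)^m, where
   Q = (1 - l A)^-1 >= 0; its sign is (-1)^m because l <= 0.  For m = 1 this makes
   f(A + t(B - A)) decreasing in t when A <= B, so - f is operator monotone.

   Conversely, for 1 x 1 matrices (i) is complete monotonicity, so f is the sum of
   its Taylor series (Bernstein).  With A = eps diag(0, 1, ..., N - 1) and X the
   all-ones matrix, the first and second derivatives of f(A + tX), in the direction
   of a suitable vector and as eps -> 0, give L(p^2) <= 0 and L(x p^2) >= 0 for every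
   polynomial p, where L(x^k) = c_(k+1).  Hence s_k = (-1)^(k+1) c_(k+1) is such that
   k |-> L_s(x^k p^2) is log-convex; it grows subexponentially, so it decreases, and
   L_s(x^k (1 - x)^m) >= 0: s is a Hausdorff moment sequence.  The measure with these
   moments is the image of the Lebesgue measure of [0, 1] under an ultrafilter limit
   of the quantile functions of the Bernstein weights.

   Measures are compared through their moments only.  In particular (1 - l) mu and
   nu / (1 - l) are replaced by measures having the same moments, which exist by
   Hausdorff's theorem; measures on [-1, 1] are determined by their moments
   (Bernstein polynomials); and beta >= 0 follows from x -> 1. *)

(** * Power series *)

(** Matrix statements are tested through the real functionals M -> Re tr(W M): they turn matrix
    power series into scalar series, and for W of rank one they are quadratic forms.

    Squares of polynomials come out of (i) because the all-ones matrix has rank one. The form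
    attached to A^i X A^j splits into a product of two weighted power sums of the nodes, and a
    second factor X only inserts a plain power sum of the nodes, which tends to N at order 0 and to
    0 at higher orders. Weights that blow up like negative powers of eps compensate the shrinking
    nodes, so that the weighted power sums tend to the coefficients of p.

    Exchanges of limits are the recurrent obstacle. In the matrix part they rest on geometric bounds
    for A already diagonalized, where row sums see the spectral radius. *)

Section PowerSeries.
Variable R : realType.
Implicit Types (c : R^nat) (F : R -> R).

Lemma is_cvg_seriesS (u : R^nat) : cvgn (series u) -> cvgn (series (fun n => u n.+1)).
Proof.
move=> cu.
have -> : series (fun n => u n.+1) = (fun n => series u n.+1 - u 0%N).
  apply/funext => n; rewrite /series/= big_nat_recl//=.
  by rewrite addrC addrA addNr add0r.
apply: is_cvgB; last exact: is_cvg_cst.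
by move/cvg_ex : cu => [l ul]; apply/cvg_ex; exists l; rewrite cvg_shiftS.
Qed.

(** The factor [n.+1] is paid for by a larger radius: for |x| < y < r one has (y - |x|) (n+1) |x|^n
    <= y^(n+1) - |x|^(n+1), so the differentiated series is dominated by the original one at y. *)
Lemma cvg_pseries_diffs c (r : R) : (forall x : R, `|x| < r -> cvgn (pseries c x)) ->
  forall x : R, `|x| < r -> cvgn (pseries (pseries_diffs c) x).
Proof.
move=> hc x xr; pose y := (`|x| + r) / 2; pose z := (y + r) / 2.
have x0 := normr_ge0 x.
have xy : `|x| < y by rewrite /y; lra.
have yz : y < z by rewrite /z /y; lra.
have zr : z < r by rewrite /z /y; lra.
have y0 : 0 < y by lra.
have cz : cvgn (pseries c z) by apply: hc; rewrite ger0_norm //; lra.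
have : cvgn (pseries (fun i => `|c i|) y).
  by apply: is_cvg_pseries_inside_norm cz _; rewrite !ger0_norm //; lra.
move=> cy; apply: normed_cvg.
apply: (@series_le_cvg _ _ (fun i => (y - `|x|)^-1 * (`|c i.+1| * y ^+ i.+1))).
- by move=> n; exact: normr_ge0.
- by move=> n; rewrite mulr_ge0 ?invr_ge0 ?subr_ge0 ?(ltW xy)// mulr_ge0// exprn_ge0 ?ltW.
- move=> n /=; rewrite /pseries_diffs !normrM normrX.
  rewrite ler_pdivlMl ?subr_gt0// (ger0_norm (ler0n _ _)).
  have -> : (y - `|x|) * (n.+1%:R * `|c n.+1| * `|x| ^+ n) =
      `|c n.+1| * ((y - `|x|) * (n.+1%:R * `|x| ^+ n)) by ring.
  rewrite ler_wpM2l//.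
  have : (y - `|x|) * (n.+1%:R * `|x| ^+ n) <= y ^+ n.+1 - `|x| ^+ n.+1.
    rewrite subrXX ler_pM2l ?subr_gt0// mulr_natl -[X in _ *+ X]card_ord -sumr_const.
    apply: ler_sum => i _.
    have -> : `|x| ^+ n = `|x| ^+ (n.+1.-1 - i) * `|x| ^+ i.
      by rewrite -exprD subnK// -ltnS ltn_ord.
    apply: ler_pM; rewrite ?exprn_ge0//.
    by apply: lerXn2r; rewrite ?nnegrE// ltW.
  have := exprn_ge0 n.+1 x0; lra.
- apply: (@is_cvg_seriesZ _ (fun i => `|c i.+1| * y ^+ i.+1)).
  exact: (is_cvg_seriesS cy).
Qed.

Lemma pseries_is_derive c (r : R) F :
  (forall x : R, `|x| < r -> pseries c x @ \oo --> F x) ->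
  forall x : R, `|x| < r -> is_derive x (1 : R) F (limn (pseries (pseries_diffs c) x)).
Proof.
move=> hF x xr; pose y := (`|x| + r) / 2.
have x0 := normr_ge0 x.
have xy : `|x| < y by rewrite /y; lra.
have yr : `|y| < r by rewrite ger0_norm /y; lra.
have cc z : `|z| < r -> cvgn (pseries c z) by move=> zr; apply/cvg_ex; exists (F z); exact: hF.
have cd := cvg_pseries_diffs cc.
have cdd := cvg_pseries_diffs cd.
have := @pseries_snd_diffs R c y x (cc _ yr) (cd _ yr) (cdd _ yr).
rewrite [`|y|]ger0_norm; last by rewrite /y; lra.
move=> /(_ xy).
(* The derivative obtained is that of the pointwise limit of the series, which agrees with [F]
   inside the disc, hence near [x]. *)
apply: near_eq_is_derive.
near=> z.
apply: cvg_lim => //; apply: hF.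
near: z.
apply: cvgr_lt xr; apply: cvg_norm; exact: cvg_id.
Unshelve. all: by end_near. Qed.

Lemma pseries_derive1n c (r : R) F :
  (forall x : R, `|x| < r -> pseries c x @ \oo --> F x) ->
  forall k (x : R), `|x| < r ->
    pseries (iter k (@pseries_diffs R) c) x @ \oo --> derive1n k F x /\
    derivable (derive1n k F) x 1.
Proof.
move=> hF; elim=> [|k IH] x xr.
  split; first exact: hF.
  by apply: ex_derive; exact: (pseries_is_derive hF xr).
have cc z : `|z| < r -> cvgn (pseries (iter k (@pseries_diffs R) c) z).
  by move=> zr; apply/cvg_ex; exists (derive1n k F z); exact: (IH z zr).1.
have Hk z : `|z| < r -> pseries (iter k.+1 (@pseries_diffs R) c) z @ \oo --> derive1n k.+1 F z.
  move=> zr; rewrite derive1nS derive1E.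
  have [h1 h2] := pseries_is_derive (fun y yr => (IH y yr).1) zr.
  by rewrite h2; exact: (cvg_pseries_diffs cc zr).
split; first exact: Hk.
by apply: ex_derive; exact: (pseries_is_derive Hk xr).
Qed.

Lemma iter_pseries_diffs c k n :
  iter k (@pseries_diffs R) c n = ((n + k) ^_ k)%:R * c (n + k)%N.
Proof.
elim: k n => [|k IH] n; first by rewrite addn0 ffactn0 mul1r.
rewrite iterS {1}/pseries_diffs IH addSnnS mulrA -natrM; congr (_%:R * _).
rewrite (addnS n k) ffactSS.
have -> : (n + k).+1 = (n.+1 + k)%N by rewrite addSn.
by rewrite mulnC addSn -ffactSS ffactnSr -addSn addnK.
Qed.

Lemma pseries0 c : pseries c 0 @ \oo --> c 0%N.
Proof.
apply/cvgrPdist_lt => e e0; near=> n.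
have n0 : (0 < n)%N by near: n; exists 1%N.
rewrite /pseries/= /series/= -(prednK n0) big_nat_recl//= expr0 mulr1.
rewrite big1 ?addr0 ?subrr ?normr0// => i _.
by rewrite exprS mul0r mulr0.
Unshelve. all: by end_near. Qed.

Lemma pseries_derive1n0 c (r : R) F : 0 < r ->
  (forall x : R, `|x| < r -> pseries c x @ \oo --> F x) ->
  forall k, derive1n k F 0 = k`!%:R * c k.
Proof.
move=> r0 hF k.
have z0 : `|0 : R| < r by rewrite normr0.
have [h _] := pseries_derive1n hF k z0.
have := @pseries0 (iter k (@pseries_diffs R) c).
rewrite iter_pseries_diffs add0n ffactnn => h'.
exact: (cvg_unique _ h h').
Qed.

Lemma cvgn_sum (I : Type) (s : seq I) (u : I -> R^nat) (l : I -> R) :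
  (forall i, u i @ \oo --> l i) ->
  (fun n => \sum_(i <- s) u i n) @ \oo --> \sum_(i <- s) l i.
Proof.
move=> ul; elim: s => [|i s IH].
  rewrite big_nil; under eq_fun do rewrite big_nil; exact: cvg_cst.
rewrite big_cons; under eq_fun do rewrite big_cons.
by apply: cvgD => //; exact: ul.
Qed.

Section DoubleSeries.
Variables (c : R^nat) (p : nat -> nat -> R) (tau theta K : R).
Hypothesis tau0 : 0 < tau.
Hypothesis p0 : forall k m, (k < m)%N -> p k m = 0.
Hypothesis hp : forall k, \sum_(m < k.+1) `|p k m| * tau ^+ m <= K * theta ^+ k.
Hypothesis hc : cvgn (series (fun k => `|c k| * theta ^+ k)).

Lemma triangular_cvg m : cvgn (series (fun k => c k * p k m)).
Proof.
apply: normed_cvg.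
apply: (@series_le_cvg _ _ (fun k => (K * (tau ^+ m)^-1) * (`|c k| * theta ^+ k))).
- by move=> n; exact: normr_ge0.
- move=> n; have K0 : 0 <= K * theta ^+ n.
    by apply: le_trans (hp n); apply: sumr_ge0 => i _; rewrite mulr_ge0// exprn_ge0// ltW.
  have -> : K / tau ^+ m * (`|c n| * theta ^+ n) = (tau ^+ m)^-1 * (`|c n| * (K * theta ^+ n)) by ring.
  apply: mulr_ge0; first by rewrite invr_ge0 exprn_ge0// ltW.
  exact: mulr_ge0.
- move=> n /=; rewrite normrM.
  have -> : K / tau ^+ m * (`|c n| * theta ^+ n) = `|c n| * (K * theta ^+ n / tau ^+ m) by ring.
  rewrite ler_wpM2l// ler_pdivlMr ?exprn_gt0//.
  apply: le_trans (hp n).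
  have [mn|mn] := ltnP n m.
    by rewrite p0// normr0 mul0r; apply: sumr_ge0 => i _; rewrite mulr_ge0// exprn_ge0// ltW.
  have mn' : (m < n.+1)%N by [].
  rewrite (bigD1 (Ordinal mn'))//= lerDl.
  by apply: sumr_ge0 => i _; rewrite mulr_ge0// exprn_ge0// ltW.
- exact: is_cvg_seriesZ.
Qed.

(** The error after N columns is at most the tail from N of the dominating series [b], because a row
    k < N has no entry in column N or beyond. *)
Lemma triangular_swap t (l : R) : `|t| <= tau ->
  series (fun k => c k * \sum_(m < k.+1) p k m * t ^+ m) @ \oo --> l ->
  pseries (fun m => limn (series (fun k => c k * p k m))) t @ \oo --> l.
Proof.
move=> ttau hl.
pose b k := `|c k| * (K * theta ^+ k).
have pt0 k (I : Type) (s : seq I) (P : pred I) (m : I -> nat) : 0 <= \sum_(i <- s | P i) `|p k (m i)| * tau ^+ (m i).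
  by apply: sumr_ge0 => i _; rewrite mulr_ge0// exprn_ge0// ltW.
have b0 k : 0 <= b k by rewrite mulr_ge0//; apply: le_trans (hp k).
have cb : cvgn (series b).
  have -> : b = K *: (fun k => `|c k| * theta ^+ k) by apply/funext => k; exact: mulrCA.
  exact: is_cvg_seriesZ.
pose T := limn (series b).
have bT : series b @ \oo --> T by exact: cb.
suff H N : `|l - pseries (fun m => limn (series (fun k => c k * p k m))) t N| <= T - series b N.
  apply/cvgrPdist_le => e e0; near=> N.
  apply: le_trans (H N) _.
  have : `|T - series b N| <= e by near: N; move/cvgrPdist_le : bT; exact.
  by apply: le_trans; exact: ler_norm.
(* [q n] keeps n rows and N columns; as n grows it tends to the N-th partial sum of the power series
   in t. *)
pose q n := series (fun k => c k * \sum_(m < N) p k m * t ^+ m) n.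
have hq : q @ \oo --> pseries (fun m => limn (series (fun k => c k * p k m))) t N.
  have -> : q = (fun n => \sum_(m < N) series (fun k => c k * p k m) n * t ^+ m).
    apply/funext => n; rewrite /q /series/=.
    under eq_bigr do rewrite mulr_sumr.
    rewrite exchange_big/=; apply: eq_bigr => i _.
    by rewrite mulr_suml; apply: eq_bigr => j _; rewrite mulrA.
  rewrite /pseries/= /series/= big_mkord.
  apply: cvgn_sum => i; apply: cvgM; last exact: cvg_cst.
  exact: triangular_cvg.
have hd : (fun n => `|series (fun k => c k * \sum_(m < k.+1) p k m * t ^+ m) n - q n|) @ \oo -->
   `|l - pseries (fun m => limn (series (fun k => c k * p k m))) t N|.
  by apply: cvg_norm; apply: cvgB.
have hT : (fun n => series b n - series b N) @ \oo --> T - series b N.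
  by apply: cvgB => //; exact: cvg_cst.
apply: (ler_cvg_to hd hT); near=> n.
have Nn : (N <= n)%N by near: n; exists N.
rewrite /q /series/= -sumrB.
rewrite (big_cat_nat _ Nn)//= [X in _ <= X - _](big_cat_nat _ Nn)//= addrAC subrr add0r.
rewrite big1_seq ?add0r.
  rewrite (le_trans (ler_norm_sum _ _ _))//; apply: ler_sum_nat => k /andP[Nk _].
  rewrite -mulrBr normrM /b ler_wpM2l//.
  rewrite -!(big_mkord xpredT (fun m => p k m * t ^+ m)).
  rewrite (big_cat_nat (n := N))//= ?(leqW Nk)// addrAC subrr add0r.
  apply: le_trans (hp k).
  rewrite (le_trans (ler_norm_sum _ _ _))//.
  rewrite -(big_mkord xpredT (fun m => `|p k m| * tau ^+ m)).
  rewrite [leRHS](big_cat_nat (n := N))//= ?(leqW Nk)//.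
  rewrite -[leLHS]add0r; apply: lerD; first exact: pt0.
  apply: ler_sum => m _; rewrite normrM normrX ler_wpM2l//.
  by apply: lerXn2r; rewrite ?nnegrE// ltW.
move=> k /andP[_]; rewrite mem_index_iota => /andP[_ kN].
rewrite -mulrBr -!(big_mkord xpredT (fun m => p k m * t ^+ m)).
rewrite [X in _ - X](big_cat_nat (n := k.+1))//= opprD addrA subrr add0r.
rewrite big1_seq ?oppr0 ?mulr0// => m /andP[_].
by rewrite mem_index_iota => /andP[km _]; rewrite p0// mul0r.
Unshelve. all: by end_near. Qed.

(** Meant for p k m the coefficient of t^m in a functional of (A + tX)^k: differentiating f(A + tX)
    at 0 becomes reading off coefficients. *)
Lemma double_series_derive1n (F : R -> R) :
  (forall t, `|t| < tau ->
    series (fun k => c k * \sum_(m < k.+1) p k m * t ^+ m) @ \oo --> F t) ->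
  derivable F 0 1 /\
  forall m, series (fun k => c k * p k m) @ \oo --> derive1n m F 0 / m`!%:R.
Proof.
move=> hF.
have hps x : `|x| < tau ->
    pseries (fun m => limn (series (fun k => c k * p k m))) x @ \oo --> F x.
  by move=> xt; apply: triangular_swap (ltW xt) _; exact: hF.
split.
  by have := (pseries_derive1n hps 0%N (_ : `|0 : R| < tau)).2; apply; rewrite normr0.
move=> m; rewrite (pseries_derive1n0 tau0 hps) mulrAC mulfV ?mul1r; first exact: triangular_cvg.
by rewrite pnatr_eq0 -lt0n fact_gt0.
Qed.

End DoubleSeries.

End PowerSeries.

(** * Matrix pencils *)

(* [a%:C] typed in [R[i]]: the carrier of [R] then appears in the form expected
   by the lemmas on scaling of matrices. *)
Definition creal (R : realType) (a : R) : R[i] := a%:C%C.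

Section ComplexAux.
Variable R : realType.
Local Notation C := (R[i]).
Local Notation Re := complex.Re.
Local Notation Im := complex.Im.
Local Notation nrm := (@Normc.normc R).
Local Open Scope complex_scope.
Local Open Scope sesquilinear_scope.

Lemma complexReD (x y : C) : Re (x + y) = Re x + Re y. Proof. by case: x y => [a b] [c d]. Qed.
Lemma complexReB (x y : C) : Re (x - y) = Re x - Re y. Proof. by case: x y => [a b] [c d]. Qed.
Lemma complexReM (x y : C) : Re (x * y) = Re x * Re y - Im x * Im y.
Proof. by case: x y => [a b] [c d]. Qed.
Lemma complexReZ (a : R) (x : C) : Re (creal a * x) = a * Re x.
Proof. by rewrite complexReM /= mul0r subr0. Qed.
Lemma crealX (a : R) k : creal (a ^+ k) = creal a ^+ k.
Proof. by rewrite /creal rmorphXn. Qed.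
Lemma crealM (a b : R) : creal (a * b) = creal a * creal b.
Proof. by rewrite /creal rmorphM. Qed.
Lemma complexRe_conj (x : C) : Re (x^*)%R = Re x. Proof. by case: x. Qed.
Lemma complexIm_conj (x : C) : Im (x^*)%R = - Im x. Proof. by case: x. Qed.
Lemma conjC_real (a : R) : ((creal a)^*)%R = creal a.
Proof. by apply/eqP; rewrite eq_complex/= oppr0 !eqxx. Qed.
Lemma complexRe_sum I (s : seq I) (P : pred I) (F : I -> C) :
  Re (\sum_(i <- s | P i) F i) = \sum_(i <- s | P i) Re (F i).
Proof. by elim/big_rec2: _ => // i y x _ <-; rewrite complexReD. Qed.

Lemma nrmE (x : C) : `|x| = (nrm x)%:C. Proof. by []. Qed.
Lemma nrm_ge0 (x : C) : 0 <= nrm x.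
Proof. by have := normr_ge0 x; rewrite nrmE lecR. Qed.
Lemma nrmM (x y : C) : nrm (x * y) = nrm x * nrm y.
Proof. by have := normrM x y; rewrite !nrmE -rmorphM/= => /complexI. Qed.
Lemma nrm_triangle (x y : C) : nrm (x + y) <= nrm x + nrm y.
Proof. by have := ler_normD x y; rewrite !nrmE -rmorphD/= lecR. Qed.
Lemma nrm0 : nrm 0 = 0.
Proof. by have := normr0 C; rewrite nrmE => /complexI. Qed.
Lemma nrm_sum I (s : seq I) (P : pred I) (F : I -> C) :
  nrm (\sum_(i <- s | P i) F i) <= \sum_(i <- s | P i) nrm (F i).
Proof.
elim/big_rec2: _ => [|i y x Pi le]; first by rewrite nrm0.
by apply: le_trans (nrm_triangle _ _) _; rewrite lerD2l.
Qed.
Lemma nrm_Re (x : C) : `|Re x| <= nrm x.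
Proof. by have := normc_ge_Re x; rewrite nrmE lecR. Qed.
Lemma nrm_real (a : R) : nrm (creal a) = `|a|.
Proof. by rewrite /= expr0n/= addr0 sqrtr_sqr. Qed.
Lemma nrm_gt0 (x : C) : x != 0 -> 0 < nrm x.
Proof. by rewrite -normr_gt0 nrmE ltcR. Qed.

End ComplexAux.

Section MatrixPowers.
Variable R : realType.
Local Notation C := (R[i]).
Local Notation Re := complex.Re.
Local Notation Im := complex.Im.
Local Notation nrm := (@Normc.normc R).
Local Open Scope complex_scope.
Local Open Scope sesquilinear_scope.

Section Coefficients.
Variables (n : nat) (A X : 'M[C]_n).

(* The coefficient of [t ^+ m] in [(A + t *: X) ^+ k]. *)
Fixpoint pencil_coef (k m : nat) : 'M[C]_n :=
  match k, m with
  | 0%N, 0%N => 1%:M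
  | 0%N, _.+1 => 0
  | k'.+1, 0%N => pencil_coef k' 0 *m A
  | k'.+1, m'.+1 => pencil_coef k' m'.+1 *m A + pencil_coef k' m' *m X
  end.

Lemma pencil_coef_gt k m : (k < m)%N -> pencil_coef k m = 0.
Proof.
elim: k m => [|k IH] [|m]//= km.
by rewrite !IH ?mul0mx ?addr0// ltnW.
Qed.

Lemma pencil_expE (t : C) k :
  (A + t *: X) ^+ k = \sum_(m < k.+1) t ^+ m *: pencil_coef k m.
Proof.
elim: k => [|k IH]; first by rewrite big_ord1 expr0 expr0 scale1r.
rewrite exprSr IH [RHS]big_ord_recl/= expr0 scale1r.
under [X in _ = _ + X]eq_bigr do rewrite /bump/= add1n scalerDr.
rewrite big_split/= addrA mulrDr; congr (_ + _).
  transitivity (\sum_(m < k.+2) t ^+ m *: (pencil_coef k m *m A)).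
    rewrite mulr_suml [RHS]big_ord_recr/= (@pencil_coef_gt k k.+1)// mul0mx scaler0 addr0.
    by apply: eq_bigr => i _; rewrite scalemxAl.
  by rewrite big_ord_recl/= expr0 scale1r.
rewrite big_distrl/=; apply: eq_bigr => i _.
by rewrite -[LHS]/((_ *: _) *m (_ *: _)) -scalemxAl -scalemxAr scalerA exprSr.
Qed.

End Coefficients.

Lemma pencil_coef_conj n (A X U V : 'M[C]_n) k m : U *m V = 1%:M ->
  pencil_coef (V *m A *m U) (V *m X *m U) k m = V *m pencil_coef A X k m *m U.
Proof.
move=> UV; have VU : V *m U = 1%:M by exact: mulmx1C.
have e (M N : 'M[C]_n) : V *m M *m U *m (V *m N *m U) = V *m (M *m N) *m U.
  by rewrite !mulmxA -(mulmxA _ U V) UV mulmx1.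
elim: k m => [|k IH] [|m] /=.
- by rewrite mulmx1.
- by rewrite mulmx0 mul0mx.
- by rewrite IH e.
- by rewrite !IH !e mulmxDr mulmxDl.
Qed.

(** Row sums of a diagonal matrix are the moduli of its entries, so [rho] can be the spectral
    radius. With the weights [tau ^+ m], one step of the recursion multiplies the total by at most
    [rho + tau * xi]. *)
Lemma pencil_coef_bound n (d : 'rV[C]_n) (X : 'M[C]_n) (rho xi tau : R) :
  0 <= tau ->
  (forall i, nrm (d 0 i) <= rho) -> (forall i, \sum_j nrm (X i j) <= xi) ->
  forall k i, \sum_(m < k.+1) (\sum_j nrm (pencil_coef (diag_mx d) X k m i j)) * tau ^+ m
    <= (rho + tau * xi) ^+ k.
Proof.
move=> tau0 hd hX k i.
pose r k m := \sum_j nrm (pencil_coef (diag_mx d) X k m i j).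
have r0 k' m : 0 <= r k' m by apply: sumr_ge0 => j _; exact: nrm_ge0.
have rD (M : 'M[C]_n) : \sum_j nrm ((M *m diag_mx d) i j) <= rho * \sum_j nrm (M i j).
  rewrite mulr_sumr; apply: ler_sum => j _.
  by rewrite mul_mx_diag mxE nrmM mulrC ler_wpM2r// nrm_ge0.
have rX (M : 'M[C]_n) : \sum_j nrm ((M *m X) i j) <= xi * \sum_j nrm (M i j).
  apply: (@le_trans _ _ (\sum_j \sum_l nrm (M i l) * nrm (X l j))).
    apply: ler_sum => j _; rewrite mxE (le_trans (nrm_sum _ _ _))//.
    by apply: ler_sum => l _; rewrite nrmM.
  rewrite exchange_big/= mulr_sumr; apply: ler_sum => l _.
  by rewrite -mulr_sumr mulrC ler_wpM2r// nrm_ge0.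
have rS k' m : r k'.+1 m.+1 <= rho * r k' m.+1 + xi * r k' m.
  apply: le_trans (lerD (rD _) (rX _)).
  by rewrite -big_split/=; apply: ler_sum => j _; rewrite mxE nrm_triangle.
have r00 k' : r k'.+1 0%N <= rho * r k' 0%N by exact: rD.
rewrite -/(r k _); have := hd i; elim: k => [|k IH] rho0.
  rewrite big_ord1/= !expr0 mulr1.
  rewrite (bigD1 i)//= big1 ?addr0; last first.
    by move=> j ji; rewrite mxE eq_sym (negbTE ji) nrm0.
  by rewrite mxE eqxx (nrm_real 1) normr1.
have T0 : 0 <= rho by apply: le_trans rho0; exact: nrm_ge0.
have X0 : 0 <= xi by apply: le_trans (hX i); apply: sumr_ge0 => *; exact: nrm_ge0.
have := ler_wpM2l (addr_ge0 T0 (mulr_ge0 tau0 X0)) (IH rho0).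
rewrite -exprS; apply: le_trans.
rewrite mulrDl big_ord_recl/=.
apply: (@le_trans _ _ (rho * r k 0%N * tau ^+ 0 +
   \sum_(m < k.+1) (rho * r k m.+1 * tau ^+ m.+1 + xi * r k m * tau ^+ m.+1))).
  apply: lerD; first by rewrite expr0 !mulr1.
  apply: ler_sum => m _; rewrite -mulrDl add0n.
  by apply: ler_wpM2r; [exact: exprn_ge0|exact: rS].
rewrite big_split/= addrA; apply: lerD.
  have rk : r k k.+1 = 0 by rewrite /r big1// => j _; rewrite pencil_coef_gt// mxE nrm0.
  rewrite [X in _ + X]big_ord_recr/= rk mulr0 mul0r addr0 big_ord_recl/= mulrDr mulrA lerD2l mulr_sumr.
  by apply: ler_sum => m _; rewrite mulrA.
rewrite mulr_sumr; apply: ler_sum => m _.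
rewrite -/(r k m) exprS; move: (r k m) (tau ^+ m) => y z.
by rewrite (_ : xi * y * (tau * z) = tau * xi * (y * z))//; ring.
Qed.

Lemma hermsymP n (A : 'M[C]_n) : A \is hermsymmx <-> A^t* = A.
Proof.
split=> [/is_hermitianmxP h|h]; last apply/is_hermitianmxP.
  by rewrite [in RHS]h expr0 scale1r.
by rewrite h expr0 scale1r.
Qed.

Lemma hermsym_entryP n (A : 'M[C]_n) :
  A \is hermsymmx <-> forall i j, A i j = ((A j i)^*)%R.
Proof.
rewrite hermsymP; split=> [h i j|h]; first by rewrite -[in LHS]h !mxE.
by apply/matrixP => i j; rewrite !mxE -h.
Qed.

Lemma hermsymD n (A B : 'M[C]_n) :
  A \is hermsymmx -> B \is hermsymmx -> A + B \is hermsymmx.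
Proof.
move=> /hermsym_entryP hA /hermsym_entryP hB; apply/hermsym_entryP => i j.
by rewrite !mxE hA hB rmorphD.
Qed.

Lemma hermsymZ n (a : R) (A : 'M[C]_n) :
  A \is hermsymmx -> creal a *: A \is hermsymmx.
Proof.
move=> /hermsym_entryP hA; apply/hermsym_entryP => i j.
by rewrite !mxE hA rmorphM /= [in RHS]conjC_real.
Qed.

Lemma spectral_diag_eigen n (A : 'M[C]_n) : A \is hermsymmx ->
  forall z, eigenvalue A z <-> exists l, z = spectral_diag A 0 l.
Proof.
move=> hA z.
have U := spectral_unit A.
have := hermitian_normalmx hA => /orthomx_spectralP.
move: U; set P := spectralmx A; set sd := spectral_diag A => U AE.
split.
  move=> /eigenvalueP[v vA v0].
  pose w := v *m invmx P.
  have wD : w *m diag_mx sd = z *: w.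
    by rewrite /w scalemxAl -vA AE !mulmxA -[RHS]mulmxA mulmxV// mulmx1.
  have w0 : w != 0.
    apply: contra_neq v0 => w0; have := congr1 (mulmx^~ P) w0.
    by rewrite /= /w -mulmxA mulVmx// mulmx1 mul0mx.
  clearbody w; have /rV0Pn[l wl] := w0.
  exists l; move/rowP : wD => /(_ l); rewrite mul_mx_diag !mxE mulrC.
  by move/mulIf => ->.
move=> [l ->]; apply/eigenvalueP; exists (row l P).
  rewrite AE !mulmxA -row_mul mulmxV// row1.
  rewrite -rowE.
  by apply/rowP => j; rewrite row_diag_mx -scalemxAl -rowE !mxE.
apply/negP => /eqP r0; have := congr1 (row l) (mulmxV U).
rewrite row_mul r0 mul0mx => /rowP/(_ l); rewrite !mxE eqxx => /eqP.
by rewrite eq_sym oner_eq0.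
Qed.

Lemma spectral_diag_real n (A : 'M[C]_n) : A \is hermsymmx ->
  forall l, spectral_diag A 0 l = creal (Re (spectral_diag A 0 l)).
Proof.
move=> /hermitian_spectral_diag_real /mxOverP h l.
have /RIm_real/complexI := h 0 l.
by rewrite /creal; case: (spectral_diag A 0 l) => [a b]/= ->.
Qed.

Lemma spectral_diag_itv (a b : R) n (A : 'M[C]_n) : hermitian_in a b A ->
  forall l, a < Re (spectral_diag A 0 l) < b.
Proof.
move=> [hA h] l; have := h (spectral_diag A 0 l).
move=> /(_ (proj2 (spectral_diag_eigen hA _) (ex_intro _ l erefl))).
by rewrite (spectral_diag_real hA) !ltcR.
Qed.

Lemma spectral_expE n (A : 'M[C]_n) k : A \is hermsymmx ->
  A ^+ k = invmx (spectralmx A) *m diag_mx (map_mx (fun z => z ^+ k) (spectral_diag A))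
     *m spectralmx A.
Proof.
move=> hA; have U := spectral_unit A.
have := hermitian_normalmx hA => /orthomx_spectralP.
move: U; set P := spectralmx A; set sd := spectral_diag A => U AE.
elim: k => [|k IH].
  rewrite expr0; suff -> : map_mx (fun z => z ^+ 0) sd = const_mx 1.
    by rewrite diag_const_mx mulmx1 mulVmx.
  by apply/rowP => j; rewrite !mxE expr0.
rewrite exprSr IH -mulmxE [in LHS]AE !mulmxA; congr (_ *m _).
rewrite -(mulmxA _ P) mulmxV// mulmx1 -mulmxA mulmx_diag.
congr (_ *m diag_mx _).
by apply/rowP => j; rewrite !mxE exprSr.
Qed.

Lemma mulmx_conj_cancel n (v : 'rV[C]_n) (U V M : 'M[C]_n) : U *m V = 1%:M ->
  v *m (V *m M *m U) *m V = v *m V *m M.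
Proof. by move=> UV; rewrite !mulmxA -(mulmxA (v *m V *m M)) UV mulmx1. Qed.

(** Summing |(v M)_j| over j for a row eigenvector v and exchanging the sums. It keeps the spectrum
    of a small perturbation of a diagonal matrix under control. *)
Lemma rowsum_eigen_le n (M : 'M[C]_n) (theta : R) z :
  (forall i, \sum_j nrm (M i j) <= theta) -> eigenvalue M z -> nrm z <= theta.
Proof.
move=> hM /eigenvalueP[v vM v0].
have s0 : 0 < \sum_j nrm (v 0 j).
  have /rV0Pn[l vl] := v0.
  rewrite (bigD1 l)//= ltr_wpDr ?nrm_gt0//; apply: sumr_ge0 => *; exact: nrm_ge0.
rewrite -(ler_pM2r s0) mulr_sumr.
apply: (@le_trans _ _ (\sum_j \sum_l nrm (v 0 l) * nrm (M l j))).
  apply: ler_sum => j _; rewrite -nrmM.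
  move/rowP : vM => /(_ j); rewrite !mxE => <-.
  by rewrite (le_trans (nrm_sum _ _ _))//; apply: ler_sum => l _; rewrite nrmM.
rewrite exchange_big/= mulr_sumr; apply: ler_sum => l _.
by rewrite -mulr_sumr mulrC ler_wpM2r// nrm_ge0.
Qed.

Lemma Re_trace_diag n (W U V : 'M[C]_n) (d : 'rV[C]_n) (h : 'I_n -> R) :
  (forall l, d 0 l = creal (h l)) ->
  Re (\tr (W *m (V *m diag_mx d *m U))) = \sum_l h l * Re ((U *m W *m V) l l).
Proof.
move=> hd; rewrite !mulmxA mxtrace_mulC !mulmxA /mxtrace complexRe_sum.
by apply: eq_bigr => l _; rewrite mul_mx_diag mxE hd mulrC complexReZ.
Qed.

Lemma Re_traceM n (W M : 'M[C]_n) :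
  Re (\tr (W *m M)) = \sum_i \sum_j (Re (W i j) * Re (M j i) - Im (W i j) * Im (M j i)).
Proof.
rewrite /mxtrace complexRe_sum; apply: eq_bigr => i _.
by rewrite mxE complexRe_sum; apply: eq_bigr => j _; rewrite complexReM.
Qed.

Lemma abs_Re_traceM_le n (W M : 'M[C]_n) :
  `|Re (\tr (W *m M))| <= \sum_i \sum_j nrm (W i j) * nrm (M j i).
Proof.
apply: le_trans (nrm_Re _) _; rewrite /mxtrace.
apply: le_trans (nrm_sum _ _ _) _; apply: ler_sum => i _; rewrite mxE.
by apply: le_trans (nrm_sum _ _ _) _; apply: ler_sum => j _; rewrite nrmM.
Qed.

Lemma mxtrace_mulZ n (a : C) (W M : 'M[C]_n) :
  \tr (W *m (a *: M)) = a * \tr (W *m M).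
Proof. by rewrite -scalemxAr mxtraceZ. Qed.

Lemma mxtrace_mulB n (W M N : 'M[C]_n) :
  \tr (W *m (M - N)) = \tr (W *m M) - \tr (W *m N).
Proof. by rewrite mulmxBr -scaleN1r mxtraceD mxtraceZ mulN1r. Qed.

Lemma mxtrace_cycle n (M W N : 'M[C]_n) : \tr (M *m W *m N) = \tr (W *m (N *m M)).
Proof. by rewrite -mulmxA mxtrace_mulC mulmxA. Qed.

Lemma Re_trace_sum n (W : 'M[C]_n) (I : finType) (a : I -> R) (M : I -> 'M[C]_n) :
  Re (\tr (W *m \sum_i creal (a i) *: M i)) = \sum_i a i * Re (\tr (W *m M i)).
Proof.
elim/big_rec2: _ => [|i y x _ <-]; first by rewrite mulmx0 mxtrace0.
by rewrite mulmxDr mxtraceD complexReD mxtrace_mulZ complexReZ.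
Qed.

Section PowerSeriesCalculus.
Variables (f : R -> R) (c : R^nat).
Hypothesis hf : forall x : R, -1 < x < 1 -> pseries c x @ \oo --> f x.

Lemma mxfun_trace_cvg n (A W : 'M[C]_n) : hermitian_in (-1) 1 A ->
  series (fun k => c k * Re (\tr (W *m A ^+ k))) @ \oo --> Re (\tr (W *m mxfun f A)).
Proof.
move=> hA; have hsd := spectral_diag_real hA.1.
set U := spectralmx A; set V := invmx U.
pose B := U *m W *m V; pose x l := Re (spectral_diag A 0 l).
rewrite /mxfun (@Re_trace_diag _ _ _ _ _ (fun l => f (x l))); last first.
  by move=> l; rewrite mxE.
rewrite -/U -/V -/B.
have -> : series (fun k => c k * Re (\tr (W *m A ^+ k))) =
    (fun N => \sum_l pseries c (x l) N * Re (B l l)).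
  apply/funext => N; rewrite /pseries/= /series/=.
  under [RHS]eq_bigr do rewrite mulr_suml.
  rewrite exchange_big/=; apply: eq_bigr => k _.
  rewrite (spectral_expE k hA.1) (@Re_trace_diag _ _ _ _ _ (fun l => x l ^+ k)).
    by rewrite mulr_sumr; apply: eq_bigr => l _; rewrite mulrA.
  by move=> l; rewrite mxE {1}hsd /creal rmorphXn.
apply: cvgn_sum => l; apply: cvgM; last exact: cvg_cst.
by apply: hf; exact: spectral_diag_itv.
Qed.

Section Pencil.
Variables (n : nat) (A X : 'M[C]_n).
Hypotheses (hA : hermitian_in (-1) 1 A) (hX : X \is hermsymmx).

(** The pencil is conjugated so that A becomes diagonal; for a general A the row sums could exceed
    1. Inside the trace the conjugation moves to W, where it only changes K. *)
Lemma pencil_small : exists tau theta : R, [/\ 0 < tau, 0 <= theta < 1,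
  (forall t : R, `|t| <= tau -> hermitian_in (-1) 1 (A + creal t *: X)) &
  forall W : 'M[C]_n, exists K : R, forall k,
   \sum_(m < k.+1) `|Re (\tr (W *m pencil_coef A X k m))| * tau ^+ m <= K * theta ^+ k].
Proof.
have [U [V [d [AE VU UV sdr sdi]]]] : exists (U V : 'M[C]_n) (d : 'rV[C]_n),
    [/\ A = V *m diag_mx d *m U, V *m U = 1%:M, U *m V = 1%:M,
        forall l, d 0 l = creal (Re (d 0 l)) & forall l, -1 < Re (d 0 l) < 1].
  exists (spectralmx A), (invmx (spectralmx A)), (spectral_diag A); split.
  - by apply/orthomx_spectralP; exact: hermitian_normalmx hA.1.
  - by apply: mulVmx; exact: spectral_unit.
  - by apply: mulmxV; exact: spectral_unit.
  - exact: spectral_diag_real hA.1.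
  - exact: spectral_diag_itv hA.
pose X' := U *m X *m V.
have XE : X = V *m X' *m U.
  by rewrite /X' !mulmxA VU mul1mx -mulmxA VU mulmx1.
clearbody X'.
pose rho := \big[Num.max/0]_l nrm (d 0 l).
have rho0 : 0 <= rho by exact: bigmax_ge_id.
have rho1 : rho < 1.
  apply/bigmax_ltP; split=> // l _.
  by rewrite sdr nrm_real ltr_norml sdi.
have hrho l : nrm (d 0 l) <= rho by exact: le_bigmax.
pose xi := \sum_i \sum_j nrm (X' i j).
have hxi i : \sum_j nrm (X' i j) <= xi.
  rewrite /xi [leRHS](bigD1 i)//= lerDl; apply: sumr_ge0 => k _.
  by apply: sumr_ge0 => *; exact: nrm_ge0.
have xi0 : 0 <= xi by apply: sumr_ge0 => k _; apply: sumr_ge0 => *; exact: nrm_ge0.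
(* Small enough for [tau * xi < 1 - rho]; the added 1 covers [xi = 0]. *)
pose tau := (1 - rho) / (2 * (xi + 1)).
have tau0 : 0 < tau by rewrite divr_gt0 ?subr_gt0// mulr_gt0// ltr_wpDl.
have tauxi : tau * xi < 1 - rho.
  have -> : tau * xi = (1 - rho) * (xi / (2 * (xi + 1))) by rewrite /tau; ring.
  rewrite gtr_pMr ?subr_gt0// ltr_pdivrMr ?mul1r; lra.
clearbody tau rho xi.
exists tau, (rho + tau * xi); split; first exact: tau0.
- by have := mulr_ge0 (ltW tau0) xi0; lra.
- move=> t ht.
  have hAt : A + creal t *: X \is hermsymmx.
    by apply: hermsymD; [exact: hA.1|exact: hermsymZ].
  split=> // z hz.
  have hz' : eigenvalue (diag_mx d + creal t *: X') z.
    case/eigenvalueP : hz => v vA v0; apply/eigenvalueP; exists (v *m V); last first.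
      apply: contra_neq v0 => w0; have := congr1 (mulmx^~ U) w0.
      by rewrite /= -mulmxA VU mulmx1 mul0mx.
    transitivity ((z *: v) *m V); last by rewrite scalemxAl.
    rewrite -vA AE XE mulmxDr [in RHS]mulmxDr [in RHS]mulmxDl.
    rewrite -!scalemxAr -!scalemxAl.
    by rewrite !mulmx_conj_cancel.
  have : nrm z <= rho + tau * xi.
    apply: rowsum_eigen_le hz' => i.
    apply: (@le_trans _ _ (\sum_j (nrm (diag_mx d i j) + `|t| * nrm (X' i j)))).
      apply: ler_sum => j _; rewrite !mxE (le_trans (nrm_triangle _ _))// lerD2l.
      by rewrite nrmM nrm_real.
    rewrite big_split/=; apply: lerD.
      rewrite (bigD1 i)//= big1 ?addr0 ?mxE ?eqxx ?mulr1n//.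
      by move=> j ji; rewrite mxE eq_sym (negbTE ji) mulr0n nrm0.
    rewrite -mulr_sumr; apply: ler_pM => //; apply: sumr_ge0 => *; exact: nrm_ge0.
  have [l zl] := (spectral_diag_eigen hAt z).1 hz.
  rewrite zl (spectral_diag_real hAt) nrm_real !ltcR -ltr_norml => h.
  by apply: le_lt_trans h _; lra.
- move=> W; pose W' := U *m W *m V; exists (\sum_i \sum_j nrm (W' i j)) => k.
  have e m : \tr (W *m pencil_coef A X k m) = \tr (W' *m pencil_coef (diag_mx d) X' k m).
    rewrite AE XE (pencil_coef_conj _ _ _ _ UV) /W'.
    by rewrite !mulmxA mxtrace_mulC !mulmxA.
  apply: (@le_trans _ _ (\sum_(m < k.+1) \sum_i \sum_j
      nrm (W' i j) * (nrm (pencil_coef (diag_mx d) X' k m j i) * tau ^+ m))).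
    apply: ler_sum => m _; rewrite e.
    apply: (le_trans (ler_wpM2r (exprn_ge0 _ (ltW tau0)) (abs_Re_traceM_le _ _))).
    rewrite mulr_suml; apply: ler_sum => i _.
    by rewrite mulr_suml; apply: ler_sum => j _; rewrite mulrA.
  rewrite exchange_big mulr_suml/=; apply: ler_sum => i _.
  rewrite exchange_big mulr_suml/=; apply: ler_sum => j _.
  rewrite -mulr_sumr ler_wpM2l ?nrm_ge0//.
  apply: le_trans (pencil_coef_bound (ltW tau0) hrho hxi k j).
  apply: ler_sum => m _; apply: ler_wpM2r; first by rewrite exprn_ge0// ltW.
  by rewrite (bigD1 i)//= lerDl; apply: sumr_ge0 => *; exact: nrm_ge0.
Qed.

Lemma trace_mxfun_pencil (W : 'M[C]_n) (F := fun t => Re (\tr (W *m mxfun f (A + creal t *: X)))) :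
  derivable F 0 1 /\
  forall m, series (fun k => c k * Re (\tr (W *m pencil_coef A X k m))) @ \oo -->
    derive1n m F 0 / m`!%:R.
Proof.
have [tau [theta [tau0 /andP[theta0 theta1] hAt hW]]] := pencil_small.
have [K hK] := hW W.
have := @double_series_derive1n _ c (fun k m => Re (\tr (W *m pencil_coef A X k m)))
  tau theta K tau0 _ hK _ F.
apply.
- by move=> k m km; rewrite pencil_coef_gt// mulmx0 mxtrace0.
- pose y := (theta + 1) / 2.
  have cy : cvgn (pseries c y).
    by apply/cvg_ex; exists (f y); apply: hf; rewrite /y; lra.
  have /= := @is_cvg_pseries_inside_norm _ c y theta cy.
  by apply; rewrite !ger0_norm /y//; lra.
- move=> t /ltW /hAt /mxfun_trace_cvg => /(_ W); apply: cvg_trans.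
  apply: near_eq_cvg; near=> N; rewrite /series/=; apply: eq_bigr => k _.
  rewrite pencil_expE; congr (_ * _).
  under [in LHS]eq_bigr do rewrite -crealX.
  by rewrite Re_trace_sum; apply: eq_bigr => m _; rewrite mulrC.
Unshelve. all: by end_near.
Qed.

(** [derivemx] acts on the real and imaginary parts of the entries. These are the functionals of
    matrix units, and linearity then gives every W. *)
Lemma mxfun_pencil :
  (forall W : 'M[C]_n, derivable (fun t => Re (\tr (W *m mxfun f (A + creal t *: X)))) 0 1) /\
  forall (W : 'M[C]_n) m,
    series (fun k => c k * Re (\tr (W *m pencil_coef A X k m))) @ \oo -->
    Re (\tr (W *m derivemx m (fun t => mxfun f (A + creal t *: X)) 0)) / m`!%:R.
Proof.
pose F (W : 'M[C]_n) (t : R) := Re (\tr (W *m mxfun f (A + creal t *: X))).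
have key := trace_mxfun_pencil.
split=> [W|W m]; first exact: (key W).1.
pose E i j : 'M[C]_n := delta_mx j i.
have trE i j (M : 'M[C]_n) (z : C) : \tr ((z *: E i j) *m M) = z * M i j.
  rewrite -scalemxAl mxtraceZ; congr (_ * _).
  rewrite /mxtrace (bigD1 j)//= big1 ?addr0.
    rewrite mxE (bigD1 i)//= big1 ?addr0; first by rewrite mxE !eqxx mul1r.
    by move=> l li; rewrite mxE (negbTE li) andbF mul0r.
  move=> l lj; rewrite mxE big1// => l' _.
  by rewrite mxE (negbTE lj) mul0r.
have FRe i j : F (1 *: E i j) = (fun t => Re (mxfun f (A + creal t *: X) i j)).
  by apply/funext => t; rewrite /F trE mul1r.
(* Re (- i z) = Im z. *)
have FIm i j : F ((- 'i%C) *: E i j) = (fun t => Im (mxfun f (A + creal t *: X) i j)).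
  apply/funext => t; rewrite /F trE complexReM/= oppr0 mul0r sub0r mulN1r opprK //.
pose w1 i j := (key (1 *: E i j)).2 m; pose w2 i j := (key ((- 'i%C) *: E i j)).2 m.
have -> : (fun k => c k * Re (\tr (W *m pencil_coef A X k m))) = (fun k =>
   \sum_i \sum_j (Re (W i j) * (c k * Re (\tr ((1 *: E j i) *m pencil_coef A X k m)))
    - Im (W i j) * (c k * Re (\tr (((- 'i%C) *: E j i) *m pencil_coef A X k m))))).
  apply/funext => k; rewrite Re_traceM mulr_sumr; apply: eq_bigr => i _.
  rewrite mulr_sumr; apply: eq_bigr => j _.
  rewrite !trE mul1r [Re (- _ * _)]complexReM/= oppr0 mul0r sub0r mulN1r opprK.
  by rewrite mulrBr; congr (_ - _); rewrite mulrCA.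
have -> : series (fun k => \sum_i \sum_j (Re (W i j) * (c k * Re (\tr ((1 *: E j i) *m pencil_coef A X k m)))
    - Im (W i j) * (c k * Re (\tr (((- 'i%C) *: E j i) *m pencil_coef A X k m))))) =
  (fun N => \sum_i \sum_j
     (Re (W i j) * series (fun k => c k * Re (\tr ((1 *: E j i) *m pencil_coef A X k m))) N
    - Im (W i j) * series (fun k => c k * Re (\tr (((- 'i%C) *: E j i) *m pencil_coef A X k m))) N)).
  apply/funext => N; rewrite /series/= exchange_big/=; apply: eq_bigr => i _.
  rewrite exchange_big/=; apply: eq_bigr => j _.
  by rewrite sumrB !mulr_sumr.
rewrite Re_traceM mulr_suml; apply: cvgn_sum => i.
rewrite mulr_suml; apply: cvgn_sum => j.
rewrite mulrBl -!mulrA !mxE/= -FRe -FIm.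
by apply: cvgB; (apply: cvgM; first exact: cvg_cst); [exact: w1|exact: w2].
Unshelve. all: by end_near. Qed.

End Pencil.
End PowerSeriesCalculus.

End MatrixPowers.

(** * Positive semidefinite matrices and resolvents *)

Section PositiveMatrices.
Variable R : realType.
Local Notation C := (R[i]).
Local Notation Re := complex.Re.
Local Notation Im := complex.Im.
Local Open Scope complex_scope.
Local Open Scope sesquilinear_scope.

Lemma adj_mxE m n (A : 'M[C]_(m, n)) i j : (A^t*) i j = (A j i)^*%R.
Proof. by rewrite mxE mxE. Qed.

Lemma adj_mxM m n p (A : 'M[C]_(m, n)) (B : 'M[C]_(n, p)) : (A *m B)^t* = B^t* *m A^t*.
Proof. by rewrite trmx_mul map_mxM. Qed.

Lemma adj_mxK m n (A : 'M[C]_(m, n)) : (A^t*)^t* = A.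
Proof. by apply/matrixP => i j; rewrite !mxE conjCK. Qed.

Lemma Re_trace_adj n (W M : 'M[C]_n) : Re (\tr (W^t* *m M^t*)) = Re (\tr (W *m M)).
Proof.
rewrite mxtrace_mulC -adj_mxM /mxtrace !complexRe_sum; apply: eq_bigr => i _.
by rewrite adj_mxE complexRe_conj.
Qed.

(** A form of Hermitian symmetry that passes to limits of scalar series; it serves to show that the
    derivatives are Hermitian. *)
Lemma hermsym_traceP n (M : 'M[C]_n) :
  M \is hermsymmx <-> forall W : 'M[C]_n, Re (\tr (W *m M)) = Re (\tr (W^t* *m M)).
Proof.
split=> [/hermsymP hM W|h]; first by rewrite -Re_trace_adj hM.
apply/hermsym_entryP => i j.
have trE (z : C) a b (N : 'M[C]_n) : \tr ((z *: delta_mx b a) *m N) = z * N a b.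
  rewrite -scalemxAl mxtraceZ; congr (_ * _).
  rewrite /mxtrace (bigD1 b)//= big1 ?addr0.
    rewrite mxE (bigD1 a)//= big1 ?addr0; first by rewrite mxE !eqxx mul1r.
    by move=> l la; rewrite mxE (negbTE la) andbF mul0r.
  move=> l lb; rewrite mxE big1// => l' _.
  by rewrite mxE (negbTE lb) mul0r.
have adj1 : (1 *: delta_mx j i : 'M[C]_n)^t* = 1 *: delta_mx i j.
  by apply/matrixP => k l; rewrite adj_mxE !mxE !mul1r conjC_nat andbC.
have adj2 : ('i%C *: delta_mx j i : 'M[C]_n)^t* = (- 'i%C) *: delta_mx i j.
  apply/matrixP => k l; rewrite adj_mxE !mxE andbC.
  by case: (_ && _); rewrite ?mulr0 ?conjC0 ?mulr1 //; apply/eqP; rewrite eq_complex/= oppr0 !eqxx.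
have := h (1 *: delta_mx j i); rewrite adj1 !trE !mul1r => h1.
have := h ('i%C *: delta_mx j i); rewrite adj2 !trE !complexReM /= oppr0 !mul0r !sub0r !mul1r mulN1r opprK => h2.
case: (M i j) (M j i) h1 h2 => [a b] [a' b'] /= -> h2.
by apply/eqP; rewrite eq_complex /= eqxx -h2 opprK eqxx.
Qed.

Lemma quad_traceE n (u : 'rV[C]_n) (M : 'M[C]_n) :
  (u *m M *m u^t*) 0 0 = \tr ((u^t* *m u) *m M).
Proof. by rewrite -[u^t* *m u *m M]mulmxA [RHS]mxtrace_mulC /mxtrace big_ord1. Qed.

(** Being nonnegative in C includes having no imaginary part, which is automatic for a Hermitian
    form; only the real part remains to be tested. *)
Lemma psdmxP n (M : 'M[C]_n) : psdmx M <->
  M \is hermsymmx /\ forall u : 'rV[C]_n, 0 <= Re (\tr ((u^t* *m u) *m M)).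
Proof.
split=> [[hM h]|[hM h]]; split=> // u.
  by have := h u; rewrite quad_traceE lecE => /andP[].
rewrite quad_traceE lecE h andbT /=.
set z := \tr _; suff : z^*%R = z.
  by case: z => a b /eqP; rewrite eq_complex/= => /andP[_ ]; rewrite -subr_eq0 -opprD oppr_eq0 -mulr2n mulrn_eq0.
rewrite /z -quad_traceE.
by rewrite -adj_mxE !adj_mxM adj_mxK ((hermsymP M).1 hM) mulmxA.
Qed.

Lemma psdmx_congr n (Y M : 'M[C]_n) : psdmx M -> psdmx (Y *m M *m Y^t*).
Proof.
move=> [/hermsymP hM h]; split; first by apply/hermsymP; rewrite !adj_mxM adj_mxK hM mulmxA.
move=> u; have := h (u *m Y).
by rewrite adj_mxM !mulmxA.
Qed.

Lemma psdmx_diag n (h : 'I_n -> R) : (forall i, 0 <= h i) ->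
  psdmx (diag_mx (\row_i creal (h i))).
Proof.
move=> h0; apply/psdmxP; split.
  apply/hermsym_entryP => i j; rewrite !mxE.
  have [->|ij] := eqVneq i j; first by rewrite !mulr1n conjC_real.
  by rewrite !mulr0n conjC0.
move=> u; rewrite /mxtrace complexRe_sum; apply: sumr_ge0 => i _.
rewrite mul_mx_diag !mxE big_ord1 !mxE mulrC complexReZ mulr_ge0//.
by rewrite complexReM complexRe_conj complexIm_conj mulNr opprK addr_ge0// -expr2 sqr_ge0.
Qed.

Lemma spectral_decomp (a b : R) n (A : 'M[C]_n) : hermitian_in a b A ->
  exists (U : 'M[C]_n) (x : 'I_n -> R),
    [/\ U *m U^t* = 1%:M, U^t* *m U = 1%:M, forall i, a < x i < b,
       A = U^t* *m diag_mx (\row_i creal (x i)) *m U &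
       forall f : R -> R, mxfun f A = U^t* *m diag_mx (\row_i creal (f (x i))) *m U].
Proof.
move=> hA; exists (spectralmx A), (fun i => Re (spectral_diag A 0 i)).
have Uu : spectralmx A *m (spectralmx A)^t* = 1%:M.
  by apply/unitarymxP; exact: spectral_unitarymx.
have Vi : invmx (spectralmx A) = (spectralmx A)^t*.
  by apply: invmx_unitary; exact: spectral_unitarymx.
have E : A = invmx (spectralmx A) *m diag_mx (spectral_diag A) *m spectralmx A.
  by apply/orthomx_spectralP; exact: hermitian_normalmx hA.1.
split.
- exact: Uu.
- exact: mulmx1C Uu.
- exact: spectral_diag_itv hA.
- rewrite -Vi; have -> : \row_i creal (Re (spectral_diag A 0 i)) = spectral_diag A.
    by apply/rowP => i; rewrite mxE -spectral_diag_real//; exact: hA.1.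
  exact: E.
- move=> f; rewrite -Vi.
  have -> : \row_i creal (f (Re (spectral_diag A 0 i))) =
      map_mx (fun z : C => (f (Re z))%:C) (spectral_diag A).
    by apply/rowP => i; rewrite !mxE.
  by [].
Qed.

Lemma psdmx_mxfun (a b : R) n (A : 'M[C]_n) (f : R -> R) : hermitian_in a b A ->
  (forall x, a < x < b -> 0 <= f x) -> psdmx (mxfun f A).
Proof.
move=> /spectral_decomp[U [x [_ _ hx _ ->]]] f0.
rewrite -[X in _ *m X]adj_mxK; apply: psdmx_congr.
by apply: psdmx_diag => i; exact: f0.
Qed.

(** Positivity comes from 1 - l x > 0 for l in [-1, 0] and every eigenvalue x of A. *)
Lemma resolvent n (A : 'M[C]_n) (l : R) : hermitian_in (-1) 1 A -> -1 <= l <= 0 ->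
  exists Q : 'M[C]_n, psdmx Q /\ (1%:M - creal l *: A) *m Q = 1%:M.
Proof.
move=> /spectral_decomp[U [x [UV VU hx -> _]]] l10.
exists (U^t* *m diag_mx (\row_i creal (1 - l * x i)^-1) *m U).
have p i : 0 < 1 - l * x i by have := hx i; nra.
split.
  rewrite -[X in _ *m X]adj_mxK; apply: psdmx_congr.
  by apply: psdmx_diag => i; rewrite invr_ge0 ltW.
have -> : 1%:M - creal l *: (U^t* *m diag_mx (\row_i creal (x i)) *m U) =
    U^t* *m diag_mx (\row_i creal (1 - l * x i)) *m U.
  rewrite -[in LHS]VU scalemxAl scalemxAr.
  rewrite -[X in X *m U - _]mulmx1 -mulmxBl -mulmxBr; congr (_ *m _ *m _).
  apply/matrixP => i j; rewrite !mxE.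
  have [->|ij] := eqVneq i j; last by rewrite !mulr0n mulr0 subr0.
  by rewrite !mulr1n /creal rmorphB rmorphM rmorph1.
rewrite !mulmxA -(mulmxA (_ *m diag_mx _)) UV mulmx1 -(mulmxA (U^t*)) mulmx_diag.
suff -> : \row_j ((\row_i creal (1 - l * x i)) 0 j * (\row_i creal (1 - l * x i)^-1) 0 j)
    = const_mx 1 by rewrite diag_const_mx mulmx1.
apply/rowP => i; rewrite !mxE /creal -rmorphM mulfV ?rmorph1//.
by rewrite gt_eqF.
Qed.

(** Congruence by Q X raises the exponent by two, hence the induction over two consecutive
    exponents, starting from Q and Q X Q. *)
Lemma psdmx_alternating n (X Q : 'M[C]_n) : psdmx X -> psdmx Q ->
  forall m, psdmx (Q *m (X *m Q) ^+ m).
Proof.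
move=> hX hQ m.
have qh : Q^t* = Q by apply/hermsymP; exact: hQ.1.
have xh : X^t* = X by apply/hermsymP; exact: hX.1.
suff [] : psdmx (Q *m (X *m Q) ^+ m) /\ psdmx (Q *m (X *m Q) ^+ m.+1) by [].
elim: m => [|m [IH1 IH2]].
  rewrite expr0 expr1 mulmx1; split => //.
  by rewrite -[X in _ *m (_ *m X)]qh mulmxA; exact: psdmx_congr.
split; first exact: IH2.
have -> : Q *m (X *m Q) ^+ m.+2 = (Q *m X) *m (Q *m (X *m Q) ^+ m) *m (Q *m X)^t*.
  by rewrite exprS exprSr adj_mxM qh xh -!mulmxE !mulmxA.
exact: psdmx_congr.
Qed.

End PositiveMatrices.

(** * Generating series of the pencil coefficients and their sign *)

Section PencilSign.
Variable R : realType.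
Local Notation C := (R[i]).
Local Notation Re := complex.Re.
Local Open Scope complex_scope.
Local Open Scope sesquilinear_scope.

Lemma geometric_vanish (K tau theta : R) (a : R^nat) : 0 < tau -> 0 <= theta < 1 ->
  (forall k, `|a k| * tau <= K * theta ^+ k) ->
  a @ \oo --> 0 /\ cvgn (series (fun k => `|a k|)).
Proof.
move=> tau0 /andP[t0 t1] ha.
have cs : cvgn (series (fun k => `|a k|)).
  apply: (@series_le_cvg _ _ (geometric (K / tau) theta)) => //.
  - move=> k /=; rewrite mulrAC mulr_ge0 ?invr_ge0 ?(ltW tau0)//.
    by apply: le_trans (ha k); rewrite mulr_ge0// ltW.
  - by move=> k /=; rewrite mulrAC ler_pdivlMr.
  - by apply: is_cvg_geometric_series; rewrite ger0_norm.
split => //; apply: norm_cvg0; exact: cvg_series_cvg_0 cs.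
Qed.

Variables (n : nat) (A X : 'M[C]_n).
Hypotheses (hA : hermitian_in (-1) 1 A) (hX : X \is hermsymmx).

Lemma pencil_vanish (W : 'M[C]_n) m :
  (fun k => Re (\tr (W *m pencil_coef A X k m))) @ \oo --> 0 /\
  cvgn (series (fun k => `|Re (\tr (W *m pencil_coef A X k m))|)).
Proof.
have [tau [theta [tau0 ht _ /(_ W)[K hK]]]] := pencil_small hA hX.
apply: (@geometric_vanish K (tau ^+ m) theta) => //; first exact: exprn_gt0.
move=> k; apply: le_trans (hK k).
have p0 i : 0 <= `|Re (\tr (W *m pencil_coef A X k i))| * tau ^+ i.
  by rewrite mulr_ge0// exprn_ge0// ltW.
have [km|mk] := ltnP k m.
  by rewrite pencil_coef_gt// mulmx0 mxtrace0 normr0 mul0r sumr_ge0.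
have mk' : (m < k.+1)%N by [].
by rewrite (bigD1 (Ordinal mk'))//= lerDl sumr_ge0.
Qed.

Section Resolvent.
Variables (l : R) (Q : 'M[C]_n).
Hypotheses (l10 : -1 <= l <= 0) (hQ : (1%:M - creal l *: A) *m Q = 1%:M).

(** Partial sums of the coefficient of t^m in the Neumann series of (1 - l (A + tX))^-1. This
    inverse is also Q (1 - l t X Q)^-1, whose expansion in t gives the limit [P m]. *)
Let G N m : 'M[C]_n := \sum_(k < N) creal (l ^+ k) *: pencil_coef A X k m.
Let P m : 'M[C]_n := creal (l ^+ m) *: (Q *m (X *m Q) ^+ m).

Let GR N m : G N.+1 m = G N m + creal (l ^+ N) *: pencil_coef A X N m.
Proof. by rewrite /G big_ord_recr. Qed.

Let GS0 N : G N.+1 0 = 1%:M + creal l *: (G N 0 *m A).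
Proof.
rewrite /G big_ord_recl expr0 scale1r; congr (_ + _).
rewrite mulmx_suml scaler_sumr; apply: eq_bigr => i _.
by rewrite -scalemxAl scalerA lift0 exprS crealM.
Qed.

Let GS N m : G N.+1 m.+1 = creal l *: (G N m.+1 *m A + G N m *m X).
Proof.
rewrite /G big_ord_recl/= scaler0 add0r.
rewrite !mulmx_suml -big_split/= scaler_sumr; apply: eq_bigr => i _.
by rewrite -!scalemxAl -scalerDr scalerA add0n /bump/= add1n exprS crealM.
Qed.

(** Multiplying the recursion by the resolvent solves it up to the last term of the sum, which
    vanishes in the limit. *)
Let GE0 N : G N 0 = Q - (creal (l ^+ N) *: pencil_coef A X N 0) *m Q.
Proof.
have : G N 0 *m (1%:M - creal l *: A) = 1%:M - creal (l ^+ N) *: pencil_coef A X N 0.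
  rewrite mulmxBr mulmx1 -scalemxAr; apply/eqP; rewrite subr_eq addrAC -GS0.
  by rewrite GR addrK.
by move/(congr1 (mulmx^~ Q)); rewrite /= -mulmxA hQ mulmx1 mulmxBl mul1mx.
Qed.

Let GE N m : G N m.+1 = creal l *: (G N m *m X *m Q) - (creal (l ^+ N) *: pencil_coef A X N m.+1) *m Q.
Proof.
have : G N m.+1 *m (1%:M - creal l *: A) = creal l *: (G N m *m X) - creal (l ^+ N) *: pencil_coef A X N m.+1.
  rewrite mulmxBr mulmx1 -scalemxAr; apply/eqP.
  rewrite subr_eq addrAC -scalerDr [X in creal l *: X]addrC -GS.
  by rewrite GR addrK.
move=> h; rewrite -[LHS]mulmx1 -hQ mulmxA h mulmxBl; congr (_ - _).
by rewrite -[LHS]scalemxAl.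
Qed.

Let rest (W : 'M[C]_n) m :
  (fun N => Re (\tr (W *m ((creal (l ^+ N) *: pencil_coef A X N m) *m Q)))) @ \oo --> 0.
Proof.
apply: norm_cvg0.
apply: (@squeeze_cvgr _ _ _ _ (fun=> 0) (fun N => `|Re (\tr ((Q *m W) *m pencil_coef A X N m))|)).
- near=> N; rewrite normr_ge0/=.
  rewrite -scalemxAl mxtrace_mulZ complexReZ normrM mulmxA mxtrace_mulC mulmxA.
  rewrite ler_piMl// normrX exprn_ile1// ler_norml.
  by case/andP: l10 => ? ?; apply/andP; split; lra.
- exact: cvg_cst.
- by rewrite -(normr0 R); apply: cvg_norm; exact: (pencil_vanish _ _).1.
Unshelve. all: by end_near. Qed.

Lemma pencil_geometric m (W : 'M[C]_n) :
  (fun N => Re (\tr (W *m \sum_(k < N) creal (l ^+ k) *: pencil_coef A X k m))) @ \oo -->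
    Re (\tr (W *m (creal (l ^+ m) *: (Q *m (X *m Q) ^+ m)))).
Proof.
rewrite -/(P m); under eq_fun do rewrite -/(G _ m).
elim: m W => [|m IH] W.
  have -> : Re (\tr (W *m P 0)) = Re (\tr (W *m Q)) - 0.
    by rewrite /P !expr0 scale1r mulmx1 subr0.
  under eq_fun do rewrite GE0 mxtrace_mulB complexReB.
  by apply: cvgB; [exact: cvg_cst|exact: rest].
have -> : Re (\tr (W *m P m.+1)) = l * Re (\tr ((X *m Q *m W) *m P m)) - 0.
  rewrite /P subr0 !mxtrace_mulZ !complexReZ exprS mulrA; congr (_ * _).
  by rewrite mxtrace_cycle exprSr -mulmxE !mulmxA.
under eq_fun do rewrite GE mxtrace_mulB complexReB mxtrace_mulZ complexReZ.
apply: cvgB; last exact: rest.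
apply: cvgM; first exact: cvg_cst.
have -> : (fun N => Re (\tr (W *m (G N m *m X *m Q)))) = (fun N => Re (\tr (X *m Q *m W *m G N m))).
  by apply/funext => N; rewrite [in RHS]mxtrace_cycle !mulmxA.
exact: IH.
Qed.

(** Dividing the previous limit by l would exclude l = 0. The recursion of [pencil_coef] lowers the
    index instead, and Q = 1 + l Q A collapses the two resulting limits into one. *)
Lemma pencil_geometric_shift m (W : 'M[C]_n) :
  (fun N => \sum_(k < N) l ^+ k * Re (\tr (W *m pencil_coef A X k.+1 m.+1))) @ \oo -->
    l ^+ m * Re (\tr (W *m (Q *m (X *m Q) ^+ m.+1))).
Proof.
have Q1 : Q *m (1%:M - creal l *: A) = 1%:M by exact: mulmx1C.
have -> : l ^+ m * Re (\tr (W *m (Q *m (X *m Q) ^+ m.+1))) =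
    Re (\tr ((A *m W) *m P m.+1)) + Re (\tr ((X *m W) *m P m)).
  rewrite -complexReD -complexReZ -mxtrace_mulZ.
  rewrite !mxtrace_cycle -mxtraceD -mulmxDr; congr (Re (\tr (_ *m _))).
  have -> : P m.+1 = creal l *: (P m *m X *m Q).
    rewrite /P exprS exprSr -mulmxE -!scalemxAl scalerA !mulmxA; congr (_ *: _).
    by rewrite crealM.
  rewrite -scalemxAl.
  have -> : creal l *: (P m *m X *m Q *m A) + P m *m X = P m *m X *m Q.
    move: (P m *m X) => Y.
    have YE : Y = Y *m Q - creal l *: (Y *m Q *m A).
      by rewrite -[LHS]mulmx1 -Q1 mulmxA mulmxBr mulmx1 -scalemxAr.
    by rewrite [X in _ + X]YE addrC subrK.
  by rewrite /P exprSr -mulmxE -!scalemxAl !mulmxA.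
have -> : (fun N => \sum_(k < N) l ^+ k * Re (\tr (W *m pencil_coef A X k.+1 m.+1))) =
    (fun N => Re (\tr ((A *m W) *m G N m.+1)) + Re (\tr ((X *m W) *m G N m))).
  apply/funext => N; rewrite /G !Re_trace_sum -big_split/=; apply: eq_bigr => k _.
  rewrite -mulrDr -complexReD; congr (_ * Re _).
  by rewrite !mxtrace_cycle -mxtraceD -mulmxDr.
by apply: cvgD; exact: pencil_geometric.
Qed.

End Resolvent.

(** The error [e N] does not depend on l, so the inequality can be integrated in l before N tends to
    infinity. It is the tail of an absolutely convergent series, which bounds the remainder for all
    |l| <= 1 at once. *)
Lemma pencil_sign m (u : 'rV[C]_n) : psdmx X ->
  exists e : R^nat, e @ \oo --> 0 /\
  forall l N, -1 <= l <= 0 ->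
    - e N <= (-1) ^+ m * \sum_(k < N) l ^+ k * Re (\tr ((u^t* *m u) *m pencil_coef A X k.+1 m.+1)).
Proof.
move=> pX; set W := u^t* *m u.
pose p k := Re (\tr (W *m pencil_coef A X k m.+1)).
have cp : cvgn (series (fun k => `|p k.+1|)).
  exact: (is_cvg_seriesS (pencil_vanish W m.+1).2).
pose T := limn (series (fun k => `|p k.+1|)).
exists (fun N => T - series (fun k => `|p k.+1|) N); split.
  by rewrite -(subrr T); apply: cvgB; [exact: cvg_cst|exact: cp].
move=> l N l10.
have [Q [pQ hQ]] := resolvent hA l10.
have := @pencil_geometric_shift l Q l10 hQ m W.
set v := _ * Re _ => hv.
have v0 : 0 <= (-1) ^+ m * v.
  rewrite /v mulrA -exprMn mulN1r mulr_ge0//.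
    by rewrite exprn_ge0// oppr_ge0; case/andP: l10.
  by have /psdmxP[_ /(_ u)] := psdmx_alternating pX pQ m.+1.
pose s N' := \sum_(k < N') l ^+ k * p k.+1.
have h1 : (fun M => (-1) ^+ m * s M - (-1) ^+ m * s N) @ \oo --> (-1) ^+ m * v - (-1) ^+ m * s N.
  apply: cvgB; last exact: cvg_cst.
  by apply: cvgM; [exact: cvg_cst|exact: hv].
have h2 : (fun M => series (fun k => `|p k.+1|) M - series (fun k => `|p k.+1|) N) @ \oo --> T - series (fun k => `|p k.+1|) N.
  by apply: cvgB; [exact: cp|exact: cvg_cst].
have : (-1) ^+ m * v - (-1) ^+ m * s N <= T - series (fun k => `|p k.+1|) N.
  apply: (ler_cvg_to h1 h2); near=> M.
  have NM : (N <= M)%N by near: M; exists N.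
  rewrite -mulrBr /series/= /s -!(big_mkord xpredT (fun k => l ^+ k * p k.+1)).
  rewrite (big_cat_nat (n := N))//= addrAC subrr add0r.
  rewrite [X in _ <= X - _](big_cat_nat (n := N))//= addrAC subrr add0r.
  apply: le_trans (ler_norm _) _; rewrite normrM normrX normrN1 expr1n mul1r.
  apply: le_trans (ler_norm_sum _ _ _) _; apply: ler_sum => k _.
  rewrite normrM ler_piMl// normrX exprn_ile1// ler_norml.
  by case/andP: l10 => ? ?; apply/andP; split; lra.
rewrite -/(s N); lra.
Unshelve. all: by end_near. Qed.

End PencilSign.

(** * Integrals over a segment *)

Lemma cvgn_unique (R : realType) (u : R^nat) (l l' : R) :
  u @ \oo --> l -> u @ \oo --> l' -> l = l'.
Proof. by move=> h h'; exact: (cvg_unique _ h h'). Qed.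

(** Two-sided continuity at each point, stronger than continuity on the segment as a subspace: the
    pointwise rules apply directly, and integrability still follows. *)
Definition continuous_on_segment (R : realType) (a b : R) (f : R -> R) : Prop :=
  forall l : R, a <= l <= b -> {for l, continuous f}.

Section SegmentIntegral.
Variables (R : realType) (mu : finite_borel_measure R) (a b : R).
Implicit Types (f g w : R -> R).
Local Notation D := `[a, b]%classic.
Local Notation I f := (Rintegral mu D f).
Local Notation cont f := (continuous_on_segment a b f).

Lemma segment_integrable f : cont f -> mu.-integrable D (EFin \o f).
Proof.
move=> cf.
have wf : {within D, continuous f}.
  by apply: continuous_in_subspaceT => l; rewrite inE /= in_itv/=; exact: cf.
apply: measurable_bounded_integrable => //.
- by rewrite -ge0_fin_numE// fin_num_measure.
- exact: subspace_continuous_measurable_fun.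
- have := compact_bounded (continuous_compact wf (@segment_compact _ a b)).
  move=> [M [Mr hM]]; exists M; split=> // x Mx l Dl.
  by apply: (hM _ Mx); exists l.
Qed.

Lemma segment_mass : \int[mu]_(l in D) 1 = fine (mu D).
Proof. by rewrite Rintegral_cst ?mul1r. Qed.

Lemma segment_le f g : cont f -> cont g -> (forall l, a <= l <= b -> f l <= g l) ->
  I f <= I g.
Proof.
move=> cf cg fg; apply: le_Rintegral; [by []|exact: segment_integrable..|].
by move=> l; rewrite /= in_itv/=; exact: fg.
Qed.

Lemma segment_ge0 f : (forall l, a <= l <= b -> 0 <= f l) -> 0 <= I f.
Proof. by move=> f0; apply: Rintegral_ge0 => l; rewrite /= in_itv/=; exact: f0. Qed.

Lemma segmentZ f r : cont f -> I (fun l => r * f l) = r * I f.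
Proof. by move=> cf; rewrite RintegralZl//; exact: segment_integrable. Qed.

Lemma segmentD f g : cont f -> cont g -> I (fun l => f l + g l) = I f + I g.
Proof. by move=> cf cg; rewrite RintegralD//; exact: segment_integrable. Qed.

Lemma segmentB f g : cont f -> cont g -> I (fun l => f l - g l) = I f - I g.
Proof. by move=> cf cg; rewrite RintegralB//; exact: segment_integrable. Qed.

Lemma segment_eq f g : (forall l, a <= l <= b -> f l = g l) -> I f = I g.
Proof.
by move=> fg; apply: eq_Rintegral => l; rewrite inE/= in_itv/=; exact: fg.
Qed.

Lemma segment_abs_le f (M : R) : cont f -> (forall l, a <= l <= b -> `|f l| <= M) ->
  `|I f| <= M * fine (mu D).
Proof.
move=> cf fM.
rewrite ler_norml -mulNr -!Rintegral_cst//; apply/andP; split.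
  apply: segment_le => // l hl; first exact: cvg_cst.
  by have := fM l hl; rewrite ler_norml => /andP[].
apply: segment_le => // l hl; first exact: cvg_cst.
by have := fM l hl; rewrite ler_norml => /andP[].
Qed.

Lemma cont_cst (r : R) : cont (fun=> r : R). Proof. by move=> l _; exact: cvg_cst. Qed.

Lemma cont_id : cont (fun l : R => l). Proof. by move=> l _; exact: cvg_id. Qed.

Lemma contD f g : cont f -> cont g -> cont (fun l => f l + g l).
Proof. by move=> cf cg l hl; apply: continuousD; [exact: cf|exact: cg]. Qed.

Lemma contN f : cont f -> cont (fun l => - f l).
Proof. by move=> cf l hl; apply: continuousN; exact: cf. Qed.

Lemma contM f g : cont f -> cont g -> cont (fun l => f l * g l).
Proof. by move=> cf cg l hl; apply: continuousM; [exact: cf|exact: cg]. Qed.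

Lemma contX f k : cont f -> cont (fun l => f l ^+ k).
Proof.
move=> cf l hl; elim: k => [|k IH]; first exact: cvg_cst.
have -> : (fun l : R => f l ^+ k.+1) = (fun l => f l * f l ^+ k).
  by apply/funext => x; rewrite exprS.
by apply: continuousM => //; exact: cf.
Qed.

Lemma contV f : cont f -> (forall l, a <= l <= b -> f l != 0) -> cont (fun l => (f l)^-1).
Proof. by move=> cf f0 l hl; apply: continuousV; [exact: f0|exact: cf]. Qed.

Lemma cont_sum n (F : nat -> R -> R) : (forall k, cont (F k)) ->
  cont (fun l => \sum_(k < n) F k l).
Proof.
move=> cF l hl; elim: n => [|n IH].
  have -> : (fun l : R => \sum_(k < 0) F k l) = (fun=> 0 : R).
    by apply/funext => x; rewrite big_ord0.
  exact: cvg_cst.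
have -> : (fun l : R => \sum_(k < n.+1) F k l) = (fun l : R => \sum_(k < n) F k l + F n l).
  by apply/funext => x; rewrite big_ord_recr.
by apply: continuousD => //; exact: cF.
Qed.

Lemma segment_sum n (F : nat -> R -> R) : (forall k, cont (F k)) ->
  I (fun l => \sum_(k < n) F k l) = \sum_(k < n) I (F k).
Proof.
move=> cF; elim: n => [|n IH].
  rewrite big_ord0 (@segment_eq _ (fun=> 0)) ?Rintegral_cst ?mul0r//.
  by move=> l _; rewrite big_ord0.
rewrite (@segment_eq _ (fun l => \sum_(k < n) F k l + F n l)); last first.
  by move=> l _; rewrite big_ord_recr.
rewrite big_ord_recr/= -IH -segmentD//; exact: cont_sum.
Qed.

(** The remainder after N terms is w(l) (l x)^N / (1 - l x), which is at most a constant times |x|^N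
    uniformly in l. *)
Lemma segment_geometric w (x : R) : -1 <= a -> b <= 1 -> cont w -> -1 < x < 1 ->
  pseries (fun k => I (fun l => w l * l ^+ k)) x @ \oo --> I (fun l => w l / (1 - l * x)).
Proof.
move=> a1 b1 cw x1.
have den0 l : a <= l <= b -> 0 < 1 - `|x| /\ 1 - `|x| <= 1 - l * x.
  move=> hl; have : `|x| < 1 by rewrite ltr_norml.
  have : `|l * x| <= `|x|.
    by rewrite normrM ler_piMl// ler_norml; case/andP: hl => ? ?; apply/andP; split; lra.
  by move/(le_trans (ler_norm _)) => ? ?; split; lra.
have cden : cont (fun l => (1 - l * x)^-1).
  apply: contV; first by apply: contD; [exact: cont_cst|apply: contN; apply: contM; [exact: cont_id|exact: cont_cst]].
  by move=> l /den0[h1 h2]; rewrite gt_eqF//; exact: lt_le_trans h2.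
have cF k : cont (fun l => w l * l ^+ k).
  by apply: contM => //; apply: contX; exact: cont_id.
have cq : cont (fun l => w l / (1 - l * x)) by apply: contM.
have [wM hwM] : exists M, forall l, a <= l <= b -> `|w l| <= M.
  have wf : {within D, continuous w}.
    by apply: continuous_in_subspaceT => l; rewrite inE /= in_itv/=; exact: cw.
  have [M [Mr hM]] := compact_bounded (continuous_compact wf (@segment_compact _ a b)).
  exists (M + 1) => l hl; apply: (hM (M + 1)); first by rewrite ltrDl.
  by exists l => //=; rewrite in_itv.
apply/cvgrPdist_le => e e0.
have hgeo : (fun N => `|wM| * (1 - `|x|)^-1 * fine (mu D) * `|x| ^+ N) @ \oo --> `|wM| * (1 - `|x|)^-1 * fine (mu D) * 0.
  by apply: cvgM; [exact: cvg_cst|apply: cvg_expr; rewrite normr_id ltr_norml].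
rewrite mulr0 in hgeo; move/cvgrPdist_le : hgeo => /(_ e e0) hgeo.
near=> N.
have -> : pseries (fun k => I (fun l => w l * l ^+ k)) x N = I (fun l => \sum_(k < N) x ^+ k * (w l * l ^+ k)).
  rewrite (@segment_sum N (fun k l => x ^+ k * (w l * l ^+ k))); last by move=> k; apply: contM => //; exact: cont_cst.
  rewrite /pseries/= /series/= big_mkord; apply: eq_bigr => k _.
  by rewrite segmentZ// mulrC.
have cS : cont (fun l : R => \sum_(k < N) x ^+ k * (w l * l ^+ k)).
  apply: (@cont_sum N (fun k l => x ^+ k * (w l * l ^+ k))) => k.
  by apply: contM => //; exact: cont_cst.
rewrite -segmentB//.
have hN : `| `|wM| * (1 - `|x|)^-1 * fine (mu D) * `|x| ^+ N| <= e.
  have h : `|0 - `|wM| * (1 - `|x|)^-1 * fine (mu D) * `|x| ^+ N| <= e by near: N.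
  by move: h; rewrite sub0r normrN.
apply: le_trans (le_trans (ler_norm _) hN).
rewrite mulrAC; apply: segment_abs_le.
  by apply: contD => //; exact: contN.
move=> l hl; have [d0 dl] := den0 l hl.
have d1 : 0 < 1 - l * x by exact: lt_le_trans dl.
have -> : w l / (1 - l * x) - \sum_(k < N) x ^+ k * (w l * l ^+ k) = w l * ((1 - l * x)^-1 * (l * x) ^+ N).
  have -> : \sum_(k < N) x ^+ k * (w l * l ^+ k) = w l * \sum_(k < N) (l * x) ^+ k.
    by rewrite mulr_sumr; apply: eq_bigr => k _; rewrite exprMn; ring.
  rewrite -mulrBr; congr (_ * _).
  have h := subrX1 (l * x) N.
  have -> : \sum_(k < N) (l * x) ^+ k = (1 - (l * x) ^+ N) / (1 - l * x).
    apply: (mulIf (lt0r_neq0 d1)); rewrite divfK ?lt0r_neq0//.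
    have -> : (\sum_(k < N) (l * x) ^+ k) * (1 - l * x) = - ((l * x - 1) * \sum_(i < N) (l * x) ^+ i) by ring.
    by rewrite -h; ring.
  by field; rewrite lt0r_neq0.
rewrite !normrM -[leRHS]mulrA; apply: ler_pM => //; first exact: le_trans (hwM l hl) (ler_norm _).
apply: ler_pM => //.
  by rewrite normfV gtr0_norm// lef_pV2 ?posrE.
rewrite normrX; apply: lerXn2r; rewrite ?nnegrE//.
by rewrite normrM ler_piMl// ler_norml; case/andP: hl => ? ?; apply/andP; split; lra.
Unshelve. all: by end_near. Qed.

End SegmentIntegral.

Lemma pseries_shift (R : realType) (c : R^nat) (x L : R) :
  pseries (fun k => c k.+1) x @ \oo --> L -> pseries c x @ \oo --> c 0%N + x * L.
Proof.
move=> h; rewrite -cvg_shiftS.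
have -> : (fun n => pseries c x n.+1) = (fun n => c 0%N + x * pseries (fun k => c k.+1) x n).
  apply/funext => n; rewrite /pseries/= /series/= big_nat_recl//= expr0 mulr1; congr (_ + _).
  by rewrite mulr_sumr; apply: eq_bigr => k _; rewrite exprS; ring.
by apply: cvgD; [exact: cvg_cst|apply: cvgM => //; exact: cvg_cst].
Qed.

(** * From the integral expression to operator complete monotonicity *)

Section IntegralToMonotone.
Variable R : realType.
Local Notation C := (R[i]).
Local Notation Re := complex.Re.
Local Open Scope complex_scope.
Local Open Scope sesquilinear_scope.

(** The defining recursion splits off the last factor, this one the first. Adjoints reverse
    products, so both are needed to see that the coefficients are Hermitian. *)
Lemma pencil_coefSl n (A X : 'M[C]_n) k m :
  pencil_coef A X k.+1 m =
  A *m pencil_coef A X k m + (if m is m'.+1 then X *m pencil_coef A X k m' else 0).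
Proof.
have S0 j : pencil_coef A X j.+1 0 = pencil_coef A X j 0 *m A by [].
have SS j i : pencil_coef A X j.+1 i.+1 =
    pencil_coef A X j i.+1 *m A + pencil_coef A X j i *m X by [].
elim: k m => [|k IH] m.
  by case: m => [|[|m]] /=; rewrite ?mul0mx ?mulmx0 ?mul1mx ?mulmx1 ?addr0 ?add0r.
case: m => [|m]; first by rewrite addr0 S0 [in LHS]IH addr0 -mulmxA -S0.
rewrite SS [in LHS]IH [X in _ + X](congr1 (mulmx^~ X) (IH m)) /=.
rewrite [in RHS]mulmxDr mulmxDl !mulmxA -!addrA; congr (_ + _).
case: m => [|m]; first by rewrite addr0 addrC mulmxA.
by rewrite mulmxDr mulmxDl !mulmxA addrCA.
Qed.

Lemma pencil_coef_adj n (A X : 'M[C]_n) k m : A \is hermsymmx -> X \is hermsymmx ->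
  (pencil_coef A X k m)^t* = pencil_coef A X k m.
Proof.
move=> /hermsymP hA /hermsymP hX; elim: k m => [|k IH] m.
  case: m => [|m] /=; first by rewrite trmx1 map_mx1.
  by rewrite trmx0 map_mx0.
rewrite [in RHS]pencil_coefSl; case: m => [|m].
  by rewrite addr0 [pencil_coef _ _ _.+1 _]/= adj_mxM hA IH.
have addE (M N : 'M[C]_n) : (M + N)^t* = M^t* + N^t*.
  by apply/matrixP => i j; rewrite !mxE rmorphD.
by rewrite [pencil_coef _ _ _.+1 _]/= addE !adj_mxM hA hX !IH.
Qed.

Lemma derivemx0 n (F : R -> 'M[C]_n) t : derivemx 0 F t = F t.
Proof. by apply/matrixP => i j; rewrite mxE !derive1n0; case: (F t i j). Qed.

Lemma derivemx_hermsym (f : R -> R) (c : R^nat) n (A X : 'M[C]_n) m :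
  (forall x : R, -1 < x < 1 -> pseries c x @ \oo --> f x) ->
  hermitian_in (-1) 1 A -> X \is hermsymmx ->
  derivemx m (fun t => mxfun f (A + creal t *: X)) 0 \is hermsymmx.
Proof.
move=> hf hA hX; apply/hermsym_traceP => W.
have [_ h] := mxfun_pencil hf hA hX.
have h1 := h W m; have h2 := h (W^t*) m.
have e : (fun k => c k * Re (\tr (W *m pencil_coef A X k m))) =
         (fun k => c k * Re (\tr (W^t* *m pencil_coef A X k m))).
  apply/funext => k; congr (_ * _).
  by rewrite -Re_trace_adj pencil_coef_adj//; exact: hA.1.
rewrite -e in h2; have /mulIf := cvgn_unique h1 h2; apply.
by rewrite invr_eq0 pnatr_eq0 -lt0n fact_gt0.
Qed.

Lemma signC m : (-1) ^+ m = creal ((-1) ^+ m) :> C.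
Proof. by rewrite crealX; congr (_ ^+ _); rewrite /creal rmorphN rmorph1. Qed.

(** The constant term separates through (1 - x) / (1 - l x) = 1 - x (1 - l) / (1 - l x). *)
Lemma integral_expression_pseries (f : R -> R) beta mu : integral_expression f beta mu ->
  forall x : R, -1 < x < 1 ->
    pseries (fun k => if k is k'.+1 then - \int[mu]_(l in `[-1, 0]) ((1 - l) * l ^+ k')
                      else beta + fine (mu `[-1, 0]%classic)) x @ \oo --> f x.
Proof.
move=> [b0 _ hf] x x1; rewrite (hf x x1).
have c1 : continuous_on_segment (-1) 0 (fun l : R => 1 - l).
  by apply: contD; [exact: cont_cst|apply: contN; exact: cont_id].
have den0 l : -1 <= l <= 0 -> 0 < 1 - l * x.
  by move=> /andP[l1 l0]; case/andP: x1 => ? ?; nra.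
have c2 : continuous_on_segment (-1) 0 (fun l : R => (1 - l) / (1 - l * x)).
  apply: contM => //; apply: contV.
    by apply: contD; [exact: cont_cst|apply: contN; apply: contM; [exact: cont_id|exact: cont_cst]].
  by move=> l /den0 h; rewrite gt_eqF.
have m1 : -1 <= -1 :> R by [].
have l01 : 0 <= 1 :> R by [].
have h := @segment_geometric R mu (-1) 0 _ x m1 l01 c1 x1.
 have -> : beta + \int[mu]_(lam in `[-1, 0]) ((1 - x) / (1 - lam * x)) =
  beta + fine (mu `[-1, 0]%classic) + x * - \int[mu]_(l in `[-1, 0]) ((1 - l) / (1 - l * x)).
  rewrite mulrN -segmentZ// -segment_mass -addrA -segmentB//; last 2 first.
  - exact: cont_cst.
  - by apply: contM => //; exact: cont_cst.
  congr (_ + _); apply: segment_eq => l /den0 h'.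
  by field; rewrite gt_eqF.
apply: pseries_shift.
have -> : (fun k => - \int[mu]_(l in `[-1, 0]) ((1 - l) * l ^+ k)) =
   - (fun k => \int[mu]_(l in `[-1, 0]) ((1 - l) * l ^+ k)) by [].
rewrite (_ : pseries _ x = - pseries (fun k => \int[mu]_(l in `[-1, 0]) ((1 - l) * l ^+ k)) x).
  exact: cvgN.
apply/funext => N; rewrite /pseries /series/= !fctE -sumrN.
by apply: eq_bigr => k _; rewrite mulNr.
Qed.

Lemma integral_expression_ge0 (f : R -> R) beta mu : integral_expression f beta mu ->
  forall x : R, -1 < x < 1 -> 0 <= f x.
Proof.
move=> [b0 _ hf] x x1; rewrite hf// addr_ge0//; apply: segment_ge0 => l /andP[l1 l0].
by case/andP: x1 => ? ?; rewrite divr_ge0//; nra.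
Qed.

Theorem integral_expression_ocm (f : R -> R) beta mu : integral_expression f beta mu ->
  operator_completely_monotone (-1) 1 f.
Proof.
move=> hf; have hps := integral_expression_pseries hf.
set c := (fun k => _) in hps; split.
  move=> k x x1; apply: (@pseries_derive1n _ c 1 f _ k x _).2; last by rewrite ltr_norml.
  by move=> y; rewrite ltr_norml => /hps.
move=> n A X hA pX k.
set M := derivemx _ _ _.
have hM : M \is hermsymmx by exact: derivemx_hermsym hps hA pX.1.
rewrite signC; case: k @M hM => [|m] M hM.
  have -> : creal ((-1) ^+ 0) = 1 :> C by rewrite expr0 /creal rmorph1.
  rewrite scale1r /M derivemx0 (_ : (0 : R)%:C = 0 :> C)// scale0r addr0.
  exact: psdmx_mxfun hA (integral_expression_ge0 hf).
apply/psdmxP; split; first exact: hermsymZ.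
move=> u; rewrite mxtrace_mulZ complexReZ; set W := u^t* *m u.
have [_ /(_ W m.+1)] := mxfun_pencil hps hA pX.1; rewrite -/M => hL.
have [e [e0 he]] := pencil_sign hA pX.1 m u pX.
pose p k := Re (\tr (W *m pencil_coef A X k m.+1)).
pose I1 := \int[mu]_(l in `[-1, 0]) (1 - l).
have c1 : continuous_on_segment (-1) 0 (fun l : R => 1 - l).
  by apply: contD; [exact: cont_cst|apply: contN; exact: cont_id].
have cp k : continuous_on_segment (-1) 0 (fun l : R => p k.+1 * ((1 - l) * l ^+ k)).
  apply: contM; first exact: cont_cst.
  by apply: contM => //; apply: contX; exact: cont_id.
(* [pencil_sign] integrated against (1 - l) mu. The index shift is harmless because a coefficient of
   order [m.+1] vanishes at k = 0. *)
have hN N : - e N * I1 <= (-1) ^+ m.+1 * series (fun k => c k * p k) N.+1.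
  have p0 : p 0%N = 0 by rewrite /p /= mulmx0 mxtrace0.
  rewrite /series/= big_nat_recl//= p0 mulr0 add0r.
  have -> : \sum_(0 <= i < N) c i.+1 * p i.+1 =
      - \int[mu]_(l in `[-1, 0]) (\sum_(k < N) p k.+1 * ((1 - l) * l ^+ k)).
    rewrite (@segment_sum _ _ _ _ N (fun k l => p k.+1 * ((1 - l) * l ^+ k)))//.
    rewrite big_mkord -sumrN; apply: eq_bigr => k _.
    rewrite segmentZ; first by rewrite /c; ring.
    by apply: contM => //; apply: contX; exact: cont_id.
  rewrite exprS mulN1r mulrNN /I1 -!segmentZ//; last first.
    exact: (@cont_sum _ _ _ N (fun k l => p k.+1 * ((1 - l) * l ^+ k))).
  apply: segment_le.
  - by apply: contM => //; exact: cont_cst.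
  - apply: contM; first exact: cont_cst.
    exact: (@cont_sum _ _ _ N (fun k l => p k.+1 * ((1 - l) * l ^+ k))).
  - move=> l l10; have -> : \sum_(k < N) p k.+1 * ((1 - l) * l ^+ k) =
        (1 - l) * \sum_(k < N) l ^+ k * p k.+1.
      by rewrite mulr_sumr; apply: eq_bigr => k _; ring.
    have := he l N l10; rewrite -/W => h.
    rewrite mulrCA mulrC ler_wpM2l//.
    by case/andP: l10 => ? ?; lra.
have hl1 : (fun N => - e N * I1) @ \oo --> 0.
  rewrite -(mul0r I1) -oppr0; apply: cvgM; last exact: cvg_cst.
  exact: cvgN.
have hl2 : (fun N => (-1) ^+ m.+1 * series (fun k => c k * p k) N.+1) @ \oo -->
    (-1) ^+ m.+1 * (Re (\tr (W *m M)) / m.+1`!%:R).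
  by apply: cvgM; [exact: cvg_cst|rewrite (cvg_shiftS (series _)); exact: hL].
have : 0 <= (-1) ^+ m.+1 * (Re (\tr (W *m M)) / m.+1`!%:R).
  by apply: (ler_cvg_to hl1 hl2); near=> N; exact: hN.
by rewrite mulrA pmulr_lge0// invr_gt0 ltr0n fact_gt0.
Unshelve. all: by end_near. Qed.

End IntegralToMonotone.

(** * Completely monotone functions *)

Section Taylor.
Variable R : realType.
Implicit Types (f g h : R -> R).

Definition taylor_rest (n : nat) (h : R -> R) (y : R) : R :=
  h y - \sum_(k < n) derive1n k h 0 / k`!%:R * y ^+ k.

Lemma taylor_rest0 n h : taylor_rest n.+1 h 0 = 0.
Proof.
rewrite /taylor_rest big_ord_recl expr0 mulr1 fact0 divr1 derive1n0.
by rewrite big1 ?addr0 ?subrr// => i _; rewrite lift0 exprS mul0r mulr0.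
Qed.

Lemma taylor_restS n h y :
  taylor_rest n.+1 h y = taylor_rest n h y - derive1n n h 0 / n`!%:R * y ^+ n.
Proof. by rewrite /taylor_rest big_ord_recr/= opprD addrA. Qed.

Lemma is_derive_taylor_rest n h (y : R) : derivable h y 1 ->
  is_derive y (1 : R) (taylor_rest n.+1 h) (taylor_rest n (derive1 h) y).
Proof.
move=> dh.
pose p := \poly_(k < n.+1) (derive1n k h 0 / k`!%:R).
have -> : taylor_rest n.+1 h = h - (fun y => p.[y]).
  by apply/funext => z; rewrite /taylor_rest/= !fctE /p horner_poly.
have -> : taylor_rest n (derive1 h) y = derive1 h y - p^`().[y].
  rewrite /taylor_rest; congr (_ - _).
  have -> : p^`() = \poly_(k < n) (derive1n k (derive1 h) 0 / k`!%:R).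
    apply/polyP => i; rewrite coef_deriv !coef_poly ltnS.
    case: ifP => [i_n|]; last by rewrite mul0rn.
    rewrite -derive1Sn factS natrM -[LHS]mulr_natr; field.
    by rewrite nat1r !pnatr_eq0 -lt0n fact_gt0.
  by rewrite horner_poly.
rewrite derive1E; apply: is_deriveB.
  exact: derivableP.
exact: is_derive_poly.
Qed.

Lemma nondecreasing_from0 (phi phi' : R -> R) (r : R) :
  (forall y : R, 0 <= y < r -> is_derive y (1 : R) phi (phi' y)) ->
  (forall y : R, 0 <= y < r -> 0 <= phi' y) ->
  forall x y, 0 <= x -> x <= y -> y < r -> phi x <= phi y.
Proof.
move=> dphi phi0 x y x0 xy yr.
apply: (@ger0_derive1_ndecr _ phi 0 y) => //; last first.
  apply: derivable_within_continuous => z; rewrite in_itv/= => /andP[z0 zy].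
  by apply: ex_derive; apply: dphi; rewrite z0 (le_lt_trans zy).
  move=> z; rewrite in_itv/= => /andP[z0 zy].
  have z1 : 0 <= z < r by rewrite (ltW z0) (lt_trans zy).
  by rewrite derive1E; have [_ ->] := dphi z z1; exact: phi0.
move=> z; rewrite in_itv/= => /andP[z0 zy].
by apply: ex_derive; apply: dphi; rewrite (ltW z0) (lt_trans zy).
Qed.

Section Sign.
Variable r : R.
Definition smooth_nneg (h : R -> R) := forall k y, 0 <= y < r -> derivable (derive1n k h) y 1.

Lemma smooth_nneg_derive1 h : smooth_nneg h -> smooth_nneg (derive1 h).
Proof. by move=> sh k y yr; rewrite -derive1Sn; exact: sh. Qed.

(** The derivative of a remainder is the remainder of the derivative, one order lower; the induction
    moves one factor s into e. The case s = 1 serves the reflected function, s = -1 the original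
    one. *)
Lemma taylor_rest_sign (s : R) n h (e : R) : smooth_nneg h ->
  (forall k y, 0 <= y < r -> 0 <= e * s ^+ k * derive1n k h y) ->
  forall y, 0 <= y < r -> 0 <= e * s ^+ n * taylor_rest n h y.
Proof.
elim: n h e => [|n IH] h e sh he y /andP[y0 yr].
  by rewrite /taylor_rest big_ord0 subr0; apply: (he 0%N); rewrite y0.
have -> : 0 = e * s ^+ n.+1 * taylor_rest n.+1 h 0 by rewrite taylor_rest0 mulr0.
apply: (@nondecreasing_from0 (fun y => e * s ^+ n.+1 * taylor_rest n.+1 h y)
  (fun y => e * s ^+ n.+1 * taylor_rest n (derive1 h) y) r) => //.
- move=> z hz; apply: (@is_deriveZ _ _ _ (taylor_rest n.+1 h) (e * s ^+ n.+1)).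
  by apply: is_derive_taylor_rest; exact: (sh 0%N).
- move=> z hz; rewrite exprS mulrA; apply: IH => //; first exact: smooth_nneg_derive1.
  by move=> k w hw; rewrite -derive1Sn -mulrA -mulrA (mulrA s) -exprS mulrA; exact: he.
Qed.

(** Equivalently, the remainder divided by y^n is nondecreasing. In the induction step both sides
    vanish at 0, and the derivative of their difference is the same difference for h' at the
    previous order. *)
Lemma taylor_rest_growth n h : smooth_nneg h ->
  (forall k y, 0 <= y < r -> 0 <= derive1n k h y) ->
  forall y, 0 <= y < r -> n%:R * taylor_rest n h y <= y * derive1 (taylor_rest n h) y.
Proof.
elim: n h => [|n IH] h sh h0 y /andP[y0 yr].
  rewrite mul0r mulr_ge0//.
  have -> : taylor_rest 0 h = h by apply/funext => z; rewrite /taylor_rest big_ord0 subr0.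
  by apply: (h0 1%N); rewrite y0.
have sh' := smooth_nneg_derive1 sh.
have dT z : 0 <= z < r -> is_derive z (1 : R) (taylor_rest n (derive1 h)) (derive1 (taylor_rest n (derive1 h)) z).
  move=> hz; rewrite derive1E; apply: derivableP.
  case: n {IH} => [|n].
    have -> : taylor_rest 0 (derive1 h) = derive1 h by apply/funext => w; rewrite /taylor_rest big_ord0 subr0.
    exact: (sh 1%N).
  by apply: ex_derive; apply: is_derive_taylor_rest; exact: (sh 1%N).
have -> : derive1 (taylor_rest n.+1 h) y = taylor_rest n (derive1 h) y.
  have yr' : 0 <= y < r by rewrite y0.
  by rewrite derive1E; have [_ ->] := is_derive_taylor_rest n (sh 0%N y yr').
rewrite -subr_ge0.
have -> : 0 = 0 * taylor_rest n (derive1 h) 0 - n.+1%:R * taylor_rest n.+1 h 0.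
  by rewrite taylor_rest0 mul0r mulr0 subr0.
apply: (@nondecreasing_from0 (fun y => y * taylor_rest n (derive1 h) y - n.+1%:R * taylor_rest n.+1 h y)
  (fun y => y * derive1 (taylor_rest n (derive1 h)) y - n%:R * taylor_rest n (derive1 h) y) r) => //.
- move=> z hz.
  have d1 := is_derive_taylor_rest n (sh 0%N z hz).
  have d2 := dT z hz.
  have d3 := @is_deriveB _ _ _ _ _ _ _ _ _ (@is_deriveM _ _ id _ _ _ _ _ (is_derive_id z (1 : R)) d2)
    (@is_deriveZ _ _ _ (taylor_rest n.+1 h) (n.+1%:R) _ _ _ d1).
  apply: is_derive_eq d3 _.
  rewrite /GRing.scale/= mulr1 -natr1 mulrDl mul1r; ring.
- move=> z hz; rewrite subr_ge0; apply: IH => //.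
  by move=> k w hw; rewrite -derive1Sn; exact: h0.
Qed.

Lemma taylor_rest_ratio n h : smooth_nneg h ->
  (forall k y, 0 <= y < r -> 0 <= derive1n k h y) ->
  forall y b, 0 < y -> y <= b -> b < r ->
    taylor_rest n h y <= (y / b) ^+ n * taylor_rest n h b.
Proof.
move=> sh h0 y b y0 yb br; have b0 : 0 < b by exact: lt_le_trans yb.
have dT z : 0 <= z < r -> is_derive z (1 : R) (taylor_rest n h) (derive1 (taylor_rest n h) z).
  move=> hz; rewrite derive1E; apply: derivableP.
  case: n => [|n].
    have -> : taylor_rest 0 h = h by apply/funext => w; rewrite /taylor_rest big_ord0 subr0.
    exact: (sh 0%N).
  by apply: ex_derive; apply: is_derive_taylor_rest; exact: (sh 0%N).
have dphi z : 0 < z -> z < r -> is_derive z (1 : R) (fun z => taylor_rest n h z * (z^-1) ^+ n)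
    ((z * derive1 (taylor_rest n h) z - n%:R * taylor_rest n h z) * (z^-1) ^+ n.+1).
  move=> z0 zr; have hz : 0 <= z < r by rewrite (ltW z0).
  have d1 := dT z hz.
  have zn0 : z != 0 by rewrite gt_eqF.
  have d2 := @is_deriveX _ _ _ n _ _ _ (@is_deriveV _ _ _ _ _ zn0 (is_derive_id z (1 : R))).
  have d3 := @is_deriveM _ _ _ _ _ _ _ _ d1 d2.
  have -> : (fun z => taylor_rest n h z * z^-1 ^+ n) = (taylor_rest n h * (fun z => z^-1) ^+ n).
    by apply/funext => w; rewrite fctE exprfctE.
  apply: is_derive_eq d3 _.
  rewrite exprfctE.
  rewrite /GRing.scale/=.
  clear d1 d2 dT sh; case: n => [|n] /=.
    by rewrite !expr0 !mul0r subr0 mulr0 add0r mul1r expr1; field.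
  rewrite !exprS; set zi := z^-1 ^+ n; field.
  by [].
have : taylor_rest n h y * (y^-1) ^+ n <= taylor_rest n h b * (b^-1) ^+ n.
  apply: (@ger0_derive1_ndecr _ (fun z => taylor_rest n h z * (z^-1) ^+ n) y b) => //.
  - move=> z; rewrite in_itv/= => /andP[yz zb].
    by apply: ex_derive; apply: dphi; [exact: lt_trans yz|exact: lt_trans br].
  - move=> z; rewrite in_itv/= => /andP[yz zb].
    have z0 : 0 < z by exact: lt_trans yz.
    have zr : z < r by exact: lt_trans br.
    rewrite derive1E; have [_ ->] := dphi z z0 zr.
    rewrite mulr_ge0 ?exprn_ge0 ?invr_ge0 ?(ltW z0)// subr_ge0.
    by apply: taylor_rest_growth => //; rewrite (ltW z0).
  - apply: derivable_within_continuous => z; rewrite in_itv/= => /andP[yz zb].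
    by apply: ex_derive; apply: dphi; [exact: lt_le_trans yz|exact: le_lt_trans br].
rewrite exprVn ler_pdivrMr ?exprn_gt0// => h1; apply: le_trans h1 _.
rewrite [leRHS](_ : _ = taylor_rest n h b * b^-1 ^+ n * y ^+ n)//.
by rewrite exprMn; ring.
Qed.

End Sign.

Lemma derive1n_local (f g : R -> R) (a b : R) :
  (forall x, a < x < b -> f x = g x) ->
  forall k x, a < x < b -> derive1n k f x = derive1n k g x.
Proof.
move=> fg; elim=> [|k IH] x xab; first exact: fg.
rewrite !derive1nS !derive1E; apply: near_eq_derive.
near=> y; apply: IH; near: y.
have : x \in `]a, b[ by rewrite in_itv.
by move=> /near_in_itvoo; apply: filterS => y; rewrite in_itv.
Unshelve. all: by end_near. Qed.

Lemma derive1n_opp (f : R -> R) (a b : R) :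
  (forall k x, a < x < b -> derivable (derive1n k f) x 1) ->
  forall k x, - b < x < - a ->
    derive1n k (fun y => f (- y)) x = (-1) ^+ k * derive1n k f (- x) /\
    derivable (derive1n k (fun y => f (- y))) x 1.
Proof.
move=> sf.
have base k (x : R) : - b < x < - a ->
    is_derive x (1 : R) (fun y => (-1) ^+ k * derive1n k f (- y)) ((-1) ^+ k.+1 * derive1n k.+1 f (- x)).
  move=> xab; have xab' : a < - x < b by case/andP: xab => ? ?; apply/andP; split; lra.
  have d1 : is_derive (- x) (1 : R) (derive1n k f) (derive1n k.+1 f (- x)).
    by rewrite derive1nS derive1E; apply: derivableP; exact: sf.
  have d2 := is_deriveN (is_derive_id x (1 : R)).
  have d3 := @is_derive1_comp _ (derive1n k f) (fun y => - y) _ _ _ d1 d2.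
  apply: is_derive_eq (is_deriveZ ((-1) ^+ k) d3) _.
  by rewrite /GRing.scale/= exprS; ring.
have H k : forall x, - b < x < - a ->
    derive1n k (fun y => f (- y)) x = (-1) ^+ k * derive1n k f (- x).
  elim: k => [|k IH] x xab; first by rewrite expr0 mul1r.
  have e := derive1n_local IH 1%N xab.
  rewrite derive1nS -derive1n1 e derive1n1 derive1E.
  by have [_ ->] := base k x xab.
move=> k x xab; split; first exact: H.
have [d _] := base k x xab.
suff : is_derive x (1 : R) (derive1n k (fun y => f (- y))) ('D_1 (fun y => (-1) ^+ k * derive1n k f (- y)) x).
  by move=> ?; apply: ex_derive.
apply: near_eq_is_derive; last exact: derivableP.
near=> y; apply/esym; apply: H; near: y.
have : x \in `]- b, - a[ by rewrite in_itv.
by move=> /near_in_itvoo; apply: filterS => y; rewrite in_itv.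
Unshelve. all: by end_near. Qed.

(* Bernstein's theorem on completely monotone functions: on the left of [0] the
   Taylor remainder divided by [x ^+ n] is monotone, on the right it is bounded
   by its first term. *)
Theorem completely_monotone_pseries (f : R -> R) : smooth_on (-1) 1 f ->
  (forall k (x : R), -1 < x < 1 -> 0 <= (-1) ^+ k * derive1n k f x) ->
  forall x : R, -1 < x < 1 ->
    pseries (fun k => derive1n k f 0 / k`!%:R) x @ \oo --> f x.
Proof.
move=> sf cm; pose g y := f (- y).
have itv (y : R) : 0 <= y < 1 -> -1 < y < - -1 by move=> /andP[? ?]; apply/andP; split; lra.
have gE k (y : R) : 0 <= y < 1 -> derive1n k g y = (-1) ^+ k * derive1n k f (- y).
  by move=> /itv hy; have [] := derive1n_opp sf k hy.
have sg : smooth_nneg 1 g.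
  by move=> k y /itv hy; have [] := derive1n_opp sf k hy.
have g0 k (y : R) : 0 <= y < 1 -> 0 <= derive1n k g y.
  by move=> hy; rewrite gE//; apply: cm; case/andP: hy => ? ?; apply/andP; split; lra.
have z01 : (0 <= (0 : R)) && ((0 : R) < 1) by rewrite lexx ltr01.
have left y : 0 <= y < 1 -> pseries (fun k => derive1n k g 0 / k`!%:R) y @ \oo --> g y.
  move=> /andP[y0 y1].
  have [->|yn0] := eqVneq y 0.
    have := @pseries0 R (fun k => derive1n k g 0 / k`!%:R).
    by rewrite fact0 divr1 derive1n0.
  have {}y0 : 0 < y by rewrite lt_neqAle eq_sym yn0.
  (* Any point strictly between y and 1: the remainder at y is at most (y / b)^n times the remainder
     at b, itself at most g b. *)
  pose b := (y + 1) / 2.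
  have yb : y < b by rewrite /b; lra.
  have b1 : b < 1 by rewrite /b; lra.
  have b0 : 0 < b by lra.
  apply/cvgrPdist_le => e e0.
  have hgeo : (fun n => (y / b) ^+ n * g b) @ \oo --> 0 * g b.
    apply: cvgM; last exact: cvg_cst.
    have q0 : 0 <= y / b by apply: divr_ge0; exact: ltW.
    by apply: cvg_expr; rewrite (ger0_norm q0) ltr_pdivrMr// mul1r.
  rewrite mul0r in hgeo; move/cvgrPdist_le : hgeo => /(_ e e0) hgeo.
  near=> n.
  have -> : g y - pseries (fun k => derive1n k g 0 / k`!%:R) y n = taylor_rest n g y.
    by rewrite /taylor_rest /pseries/= /series/= big_mkord.
  have hs := @taylor_rest_sign 1 1 n g 1 sg.
  have hs' (z : R) : 0 <= z < 1 -> 0 <= taylor_rest n g z.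
    move=> hz; have := hs _ z hz; rewrite expr1n !mul1r; apply.
    by move=> k w hw; rewrite expr1n !mul1r; exact: g0.
  rewrite ger0_norm; last by apply: hs'; rewrite (ltW y0).
  apply: le_trans (taylor_rest_ratio n sg g0 y0 (ltW yb) b1) _.
  have : `|0 - (y / b) ^+ n * g b| <= e by near: n.
  rewrite sub0r normrN; apply: le_trans; apply: le_trans (ler_norm _).
  apply: ler_wpM2l; first by rewrite exprn_ge0// divr_ge0// ltW.
  rewrite /taylor_rest lerBlDr lerDl; apply: sumr_ge0 => k _.
  by rewrite mulr_ge0 ?exprn_ge0 ?(ltW b0)// divr_ge0// g0.
have gf (y : R) N : pseries (fun k => derive1n k g 0 / k`!%:R) y N = pseries (fun k => derive1n k f 0 / k`!%:R) (- y) N.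
  rewrite /pseries/= /series/=; apply: eq_bigr => k _.
  rewrite [(- y) ^+ k]exprNn gE// oppr0.
  by move: (derive1n k f 0) (_^-1) ((-1) ^+ k) (y ^+ k) => p q s t; ring.
move=> x /andP[x1 x1'].
have [x0|x0] := lerP x 0.
  have := left (- x) _; rewrite (_ : pseries _ (- x) = pseries (fun k => derive1n k f 0 / k`!%:R) x).
    by rewrite /g opprK; apply; apply/andP; split; lra.
  by apply/funext => N; rewrite gf opprK.
(* [left] gives convergence of the series of g at x, and its terms are those of f at x up to
   sign. *)
have hterm : (fun n => derive1n n g 0 / n`!%:R * x ^+ n) @ \oo --> 0.
  apply: cvg_series_cvg_0; apply/cvg_ex; exists (g x); apply: left.
  by rewrite (ltW x0).
apply/cvgrPdist_le => e e0; move/cvgrPdist_le : hterm => /(_ e e0) hterm.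
near=> n.
have -> : f x - pseries (fun k => derive1n k f 0 / k`!%:R) x n = taylor_rest n f x.
  by rewrite /taylor_rest /pseries/= /series/= big_mkord.
have hx : 0 <= x < 1 by rewrite (ltW x0).
have hs m : 0 <= (-1) ^+ m * taylor_rest m f x.
  have := @taylor_rest_sign 1 (-1) m f 1 _ _ x hx; rewrite mul1r; apply.
    by move=> k y /andP[? ?]; apply: sf; apply/andP; split; lra.
  by move=> k y /andP[? ?]; rewrite mul1r; apply: cm; apply/andP; split; lra.
have -> : `|taylor_rest n f x| = (-1) ^+ n * taylor_rest n f x.
  by rewrite -[RHS]ger0_norm// normrM normrX normrN1 expr1n mul1r.
have h1 : `|0 - derive1n n g 0 / n`!%:R * x ^+ n| <= e by near: n.
rewrite sub0r normrN in h1; apply: le_trans (le_trans (ler_norm _) h1).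
(* Consecutive remainders have opposite signs and differ by the n-th term, which therefore bounds
   the n-th remainder in absolute value. *)
have := hs n.+1; rewrite taylor_restS exprS mulN1r mulNr oppr_ge0 mulrBr subr_le0.
by rewrite gE// oppr0 !mulrA.
Unshelve. all: by end_near. Qed.

End Taylor.

(** * Moments of operator completely monotone functions *)

Section ScalarMatrices.
Variable R : realType.
Local Notation C := (R[i]).
Local Notation Re := complex.Re.
Local Open Scope complex_scope.
Local Open Scope sesquilinear_scope.

Lemma hermitian_in_diag (a b : R) n (x : 'I_n -> R) : (forall i, a < x i < b) ->
  hermitian_in a b (diag_mx (\row_i creal (x i))).
Proof.
move=> hx; split.
  apply/hermsym_entryP => i j; rewrite !mxE.
  have [->|ij] := eqVneq i j; first by rewrite !mulr1n conjC_real.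
  by rewrite !mulr0n conjC0.
move=> z /eigenvalueP[v vA /rV0Pn[i vi]].
have := congr1 (fun w : 'rV[C]_n => w 0 i) vA; rewrite /= mul_mx_diag !mxE mulrC => /mulIf <-//.
by rewrite /creal !ltcR.
Qed.

(** The diagonalization in [mxfun] is a chosen one, so even this value has to be recovered through
    an unknown unitary. Any interval around y serves. *)
Lemma mxfun_scalar1 (f : R -> R) (y : R) :
  mxfun f (diag_mx (\row_(i < 1) creal y)) 0 0 = creal (f y).
Proof.
have hy : hermitian_in (y - 1) (y + 1) (diag_mx (\row_(i < 1) creal y)).
  by apply: (@hermitian_in_diag _ _ _ (fun=> y)) => i; apply/andP; split; lra.
have [U [x [UV VU _ E ->]]] := spectral_decomp hy.
have cD (z : C) : diag_mx (\row_(i < 1) z) = z%:M by apply/matrixP => i j; rewrite !mxE ord1.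
have xE : \row_i creal (x i) = \row_(i < 1) creal (x 0) by apply/rowP => i; rewrite !mxE ord1.
have fE : \row_i creal (f (x i)) = \row_(i < 1) creal (f (x 0)) by apply/rowP => i; rewrite !mxE ord1.
move: E; rewrite xE fE !cD !mul_mx_scalar -!scalemxAl VU.
move/matrixP => /(_ 0 0); rewrite !mxE !eqxx !mulr1n !mulr1 /creal => /complexI <-.
by [].
Qed.

Lemma derive1n_shift (f : R -> R) (a : R) k (t : R) :
  derive1n k (fun t => f (a + t)) t = derive1n k f (a + t).
Proof.
elim: k t => [|k IH] t //.
rewrite !derive1nS (_ : derive1n k _ = (fun t => derive1n k f (a + t))); last exact/funext.
rewrite !derive1E /derive.
apply: (congr1 (fun F : R -> R => lim (F @ 0^'))); apply/funext => h /=.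
by rewrite addrCA.
Qed.

Lemma ocm_completely_monotone (f : R -> R) : operator_completely_monotone (-1) 1 f ->
  forall k (a : R), -1 < a < 1 -> 0 <= (-1) ^+ k * derive1n k f a.
Proof.
move=> [_ hf] k a ha.
pose A : 'M[C]_1 := diag_mx (\row_(i < 1) creal a).
pose X : 'M[C]_1 := diag_mx (\row_(i < 1) creal 1).
have hA : hermitian_in (-1) 1 A by apply: (@hermitian_in_diag _ _ _ (fun=> a)).
have pX : psdmx X by apply: (@psdmx_diag _ _ (fun=> 1)).
have [_ /(_ (const_mx 1))] := hf 1%N A X hA pX k.
rewrite mxE big_ord1 !mxE big_ord1 !mxE conjC1 mul1r mulr1.
have -> : (fun s : R => Re (mxfun f (A + s%:C *: X) 0 0)) = (fun s => f (a + s)).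
  apply/funext => s; suff -> : A + s%:C *: X = diag_mx (\row_(i < 1) creal (a + s)).
    by rewrite mxfun_scalar1.
  apply/matrixP => i j; rewrite !mxE !ord1 !mulr1n /creal rmorphD.
  by rewrite rmorph1 mulr1.
have -> : (fun s : R => complex.Im (mxfun f (A + s%:C *: X) 0 0)) = (fun=> 0).
  apply/funext => s; suff -> : A + s%:C *: X = diag_mx (\row_(i < 1) creal (a + s)).
    by rewrite mxfun_scalar1.
  apply/matrixP => i j; rewrite !mxE !ord1 !mulr1n /creal rmorphD.
  by rewrite rmorph1 mulr1.
rewrite derive1n_shift addr0 signC lecE => /andP[_].
by rewrite complexReZ.
Qed.

(** The coefficient of z^k in z a(z) b(z): of the k factors of the pencil, one is X and the others
    are shared between the two sides. *)
Definition convolve (a b : nat -> R) (k : nat) : R := \sum_(j < k) a j * b (k.-1 - j)%N.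

Lemma convolveS (a : nat -> R) (x : R) k :
  convolve a (fun j => x ^+ j) k.+1 = x * convolve a (fun j => x ^+ j) k + a k.
Proof.
rewrite /convolve big_ord_recr/= subnn expr0 mulr1; congr (_ + _).
rewrite mulr_sumr; apply: eq_bigr => j _.
rewrite mulrCA -exprS; congr (_ * _ ^+ _).
by case: k j => [[]//|k] j /=; rewrite subSn// -ltnS.
Qed.

Section RankOne.
Variables (n : nat) (x s : 'I_n -> R).
Let A : 'M[C]_n := diag_mx (\row_i creal (x i)).
Let X : 'M[C]_n := const_mx 1.
Let u : 'rV[C]_n := \row_i creal (s i).
Let al k := \sum_i s i * x i ^+ k.
Let ga k := \sum_i x i ^+ k.

Let r0 k i : (u *m pencil_coef A X k 0) 0 i = creal (s i * x i ^+ k).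
Proof.
elim: k => [|k IH].
  by rewrite /= mulmx1 mxE expr0 mulr1.
by rewrite /= mulmxA mul_mx_diag mxE IH mxE -crealM exprSr mulrA.
Qed.

Let creal_sum (F : 'I_n -> R) : \sum_i creal (F i) = creal (\sum_i F i).
Proof. by rewrite /creal rmorph_sum. Qed.

Let rX (v : 'rV[C]_n) i : (v *m X) 0 i = \sum_j v 0 j.
Proof. by rewrite mxE; apply: eq_bigr => j _; rewrite mxE mulr1. Qed.

Let crealD (a b : R) : creal (a + b) = creal a + creal b.
Proof. by rewrite /creal rmorphD. Qed.

Let rSS k m i : (u *m pencil_coef A X k.+1 m.+1) 0 i =
  creal (x i) * (u *m pencil_coef A X k m.+1) 0 i + \sum_j (u *m pencil_coef A X k m) 0 j.
Proof.
rewrite [pencil_coef _ _ k.+1 _]/= mulmxDr !mulmxA mxE rX.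
by rewrite mul_mx_diag mxE [(\row__ _) _ _]mxE mulrC.
Qed.

Let r1 k i : (u *m pencil_coef A X k 1) 0 i = creal (convolve al (fun j => x i ^+ j) k).
Proof.
elim: k => [|k IH]; first by rewrite /= mulmx0 mxE /convolve big_ord0.
rewrite rSS IH convolveS crealD crealM; congr (_ + _).
by under eq_bigr do rewrite r0; rewrite creal_sum.
Qed.

Let r2 k i : (u *m pencil_coef A X k 2) 0 i = creal (convolve (convolve al ga) (fun j => x i ^+ j) k).
Proof.
elim: k => [|k IH]; first by rewrite /= mulmx0 mxE /convolve big_ord0.
rewrite rSS IH convolveS crealD crealM; congr (_ + _).
under eq_bigr do rewrite r1; rewrite creal_sum; congr creal.
rewrite /convolve exchange_big/=; apply: eq_bigr => j _.
by rewrite /ga mulr_sumr.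
Qed.

Let quad (M : 'M[C]_n) (F : 'I_n -> R) : (forall i, (u *m M) 0 i = creal (F i)) ->
  Re (\tr ((u^t* *m u) *m M)) = \sum_i s i * F i.
Proof.
move=> hF; rewrite -quad_traceE mxE complexRe_sum; apply: eq_bigr => i _.
by rewrite hF adj_mxE mxE conjC_real mulrC -crealM.
Qed.

(** X is the product of a column of ones and a row of ones, so the form of A^i X A^j in the
    direction u splits as [al i * al j]. *)
Lemma rank_one_quad1 k : Re (\tr ((u^t* *m u) *m pencil_coef A X k 1)) = convolve al al k.
Proof.
rewrite (quad (r1 k)) /convolve; under eq_bigr do rewrite mulr_sumr.
rewrite exchange_big/=; apply: eq_bigr => j _.
by rewrite /al [in RHS]mulr_sumr; apply: eq_bigr => i _; rewrite mulrCA.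
Qed.

(** A power of A enclosed between two factors X contributes the sum of its entries, the unweighted
    power sum [ga]. *)
Lemma rank_one_quad2 k : Re (\tr ((u^t* *m u) *m pencil_coef A X k 2)) = convolve (convolve al ga) al k.
Proof.
rewrite (quad (r2 k)) {1}/convolve; under eq_bigr do rewrite mulr_sumr.
rewrite exchange_big/= [RHS]/convolve; apply: eq_bigr => j _.
by rewrite [in RHS]mulr_sumr; apply: eq_bigr => i _; rewrite mulrCA.
Qed.

Lemma psdmx_const1 : psdmx X.
Proof.
apply/psdmxP; split; first by apply/hermsym_entryP => i j; rewrite !mxE conjC1.
move=> v; rewrite -quad_traceE mxE.
under eq_bigr do rewrite rX adj_mxE; rewrite -mulr_sumr.
have -> : \sum_(i < n) ((v 0 i)^*)%R = ((\sum_i v 0 i)^*)%R by rewrite rmorph_sum.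
rewrite complexReM complexRe_conj complexIm_conj mulrN opprK addr_ge0// -expr2 sqr_ge0//.
Qed.

Lemma ocm_rank_one (f : R -> R) (c : R^nat) : operator_completely_monotone (-1) 1 f ->
  (forall y : R, -1 < y < 1 -> pseries c y @ \oo --> f y) ->
  (forall i, -1 < x i < 1) ->
  (exists2 L : R, L <= 0 & series (fun k => c k * convolve al al k) @ \oo --> L) /\
  (exists2 L : R, 0 <= L & series (fun k => c k * convolve (convolve al ga) al k) @ \oo --> L).
Proof.
move=> [_ hf] hc hx; have hA : hermitian_in (-1) 1 A by exact: hermitian_in_diag.
have [_ h] := mxfun_pencil hc hA psdmx_const1.1.
have p k := hf n A X hA psdmx_const1 k.
split.
- exists (Re (\tr ((u^t* *m u) *m derivemx 1 (fun t => mxfun f (A + creal t *: X)) 0)) / 1`!%:R).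
    have /psdmxP[_ /(_ u)] := p 1%N.
    have f1 : 1`!%:R = 1 :> R by [].
    by rewrite signC mxtrace_mulZ complexReZ expr1 mulN1r oppr_ge0 f1 divr1.
  have := h (u^t* *m u) 1%N.
  by under [X in series X]eq_fun do rewrite rank_one_quad1.
- exists (Re (\tr ((u^t* *m u) *m derivemx 2 (fun t => mxfun f (A + creal t *: X)) 0)) / 2`!%:R).
    have /psdmxP[_ /(_ u)] := p 2%N.
    by rewrite signC mxtrace_mulZ complexReZ sqrrN expr1n mul1r => ?; rewrite divr_ge0.
  have := h (u^t* *m u) 2%N.
  by under [X in series X]eq_fun do rewrite rank_one_quad2.
Qed.

End RankOne.
End ScalarMatrices.

Section ConvolutionBounds.
Variable R : realType.
Implicit Types (a b c : R^nat).

(** There are k terms of size A B th^(k-1); the bound k <= 2^k turns their number into a geometric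
    factor. *)
Lemma convolve_bound a b (A B th : R) : 0 < th ->
  (forall j, `|a j| <= A * th ^+ j) -> (forall j, `|b j| <= B * th ^+ j) ->
  forall k, `|convolve a b k| <= (A * B / th) * (2 * th) ^+ k.
Proof.
move=> th0 ha hb k.
have A0 : 0 <= A by have := le_trans (normr_ge0 _) (ha 0%N); rewrite expr0 mulr1.
have B0 : 0 <= B by have := le_trans (normr_ge0 _) (hb 0%N); rewrite expr0 mulr1.
case: k => [|k].
  by rewrite /convolve big_ord0 normr0 expr0 mulr1 divr_ge0 ?mulr_ge0// ltW.
apply: (@le_trans _ _ (\sum_(j < k.+1) A * B * th ^+ k)).
  rewrite /convolve; apply: le_trans (ler_norm_sum _ _ _) _; apply: ler_sum => j _.
  rewrite normrM; apply: le_trans (ler_pM (normr_ge0 _) (normr_ge0 _) (ha _) (hb _)) _.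
  by rewrite mulrACA -exprD /= subnKC// -ltnS.
rewrite sumr_const card_ord -[leLHS]mulr_natr exprMn [X in _ <= _ / _ * (_ * X)]exprS.
have -> : A * B / th * (2 ^+ k.+1 * (th * th ^+ k)) = A * B * th ^+ k * 2 ^+ k.+1.
  by field; rewrite gt_eqF.
rewrite ler_wpM2l//; first by rewrite !mulr_ge0// exprn_ge0// ltW.
by rewrite -natrX ler_nat ltnW// ltn_expl.
Qed.

Lemma convolve_diff_bound a a' b b' (A B th e : R) : 0 < th ->
  (forall j, `|a j| <= A * th ^+ j) -> (forall j, `|a j - a' j| <= e * A * th ^+ j) ->
  (forall j, `|b' j| <= B * th ^+ j) -> (forall j, `|b j - b' j| <= e * B * th ^+ j) ->
  forall k, `|convolve a b k - convolve a' b' k| <= e * (2 * (A * B / th)) * (2 * th) ^+ k.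
Proof.
move=> th0 ha haa hb hbb k.
have -> : convolve a b k - convolve a' b' k =
    convolve a (fun j => b j - b' j) k + convolve (fun j => a j - a' j) b' k.
  rewrite /convolve -sumrB -big_split/=; apply: eq_bigr => j _; ring.
apply: le_trans (ler_normD _ _) _.
apply: le_trans (lerD (convolve_bound th0 ha hbb k) (convolve_bound th0 haa hb k)) _.
rewrite -mulrDl ler_wpM2r ?exprn_ge0 ?mulr_ge0 ?(ltW th0)//.
by rewrite (_ : _ + _ = e * (2 * (A * B / th)))//; ring.
Qed.

Lemma series_bound c d (M K : R) : (forall k, `|c k| <= M * 2 ^+ k) ->
  (forall k, `|d k| <= K * (1 / 4) ^+ k) -> forall n, `|series (fun k => c k * d k) n| <= 2 * (M * K).
Proof.
move=> hc hd n.
have M0 : 0 <= M by have := le_trans (normr_ge0 _) (hc 0%N); rewrite expr0 mulr1.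
have K0 : 0 <= K by have := le_trans (normr_ge0 _) (hd 0%N); rewrite expr0 mulr1.
have : `|series (fun k => c k * d k) n| <= M * K * (2 - 2 * (1 / 2) ^+ n).
  elim: n => [|n IH].
    by rewrite /series/= big_geq// normr0 expr0 mulr1 subrr mulr0.
  rewrite seriesSr; apply: le_trans (ler_normD _ _) _.
  have h : `|c n * d n| <= M * K * (1 / 2) ^+ n.
    rewrite normrM; apply: le_trans (ler_pM (normr_ge0 _) (normr_ge0 _) (hc _) (hd _)) _.
    rewrite mulrACA -exprMn (_ : 2 * (1 / 4) = 1 / 2 :> R)//; by field.
  apply: le_trans (lerD IH h) _.
  rewrite exprS -mulrDr ler_wpM2l ?mulr_ge0//; lra.
move/le_trans; apply.
have : 0 <= (1 / 2 : R) ^+ n by rewrite exprn_ge0.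
have := mulr_ge0 M0 K0; nra.
Qed.

Lemma pseries_coef_bound c (x l : R) : 0 < x -> pseries c x @ \oo --> l ->
  exists M, forall k, `|c k| <= M * (x^-1) ^+ k.
Proof.
move=> x0 cx; have cv : cvgn (pseries c x) by apply/cvg_ex; exists l.
have [K [Kr hK]] := cvg_series_bounded cv.
exists (K + 1) => k; rewrite exprVn ler_pdivlMr ?exprn_gt0//.
have /= := hK (K + 1) _ k I; rewrite normrM (ger0_norm (exprn_ge0 k (ltW x0))); apply.
by rewrite ltrDl.
Qed.

End ConvolutionBounds.

Section Nodes.
Variable R : realType.

Lemma vandermonde_inverse N : exists W : 'I_N -> 'I_N -> R,
  forall k m : 'I_N, \sum_(i < N) (i%:R : R) ^+ k * W i m = (k == m)%:R.
Proof.
pose V : 'M[R]_N := Vandermonde N (\row_i i%:R).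
have Vu : V \in unitmx.
  rewrite unitmxE /V det_Vandermonde unitfE; apply/prodf_neq0 => i _; apply/prodf_neq0 => j ij.
  by rewrite !mxE subr_eq0 eqr_nat gt_eqF.
exists (fun i m => invmx V i m) => k m.
have /matrixP/(_ k m) := mulmxV Vu; rewrite !mxE => <-.
by apply: eq_bigr => i _; rewrite !mxE.
Qed.

(** Weights on the nodes e i whose power sums are the coefficients of p up to an error of order e.
    The decay th^k, with the same th for all e, makes the error summable against the Taylor
    coefficients of f. *)
Lemma node_weights (p : {poly R}) N (th : R) : (size p <= N)%N -> 0 < th <= 1 ->
  exists A e0 : R, [/\ 0 <= A, 0 < e0 <= 1, forall k, `|p`_k| <= A * th ^+ k &
    forall e, 0 < e <= e0 -> e * N%:R <= th /\ exists s : 'I_N -> R,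
      forall k, `|\sum_i s i * (e * i%:R) ^+ k - p`_k| <= e * A * th ^+ k].
Proof.
move=> pN /andP[th0 th1].
have [W hW] := vandermonde_inverse N.
pose K := \sum_(m < N) `|p`_m| * \sum_(i < N) `|W i m|.
have K0 : 0 <= K by apply: sumr_ge0 => m _; rewrite mulr_ge0// sumr_ge0.
pose S := \sum_(m < N) `|p`_m|.
have S0 : 0 <= S by apply: sumr_ge0.
have N1 : 0 < N.+1%:R :> R by rewrite ltr0n.
have thN : 0 < th ^+ N by rewrite exprn_gt0.
pose e0 := th / N.+1%:R.
have e00 : 0 < e0 by rewrite divr_gt0.
have e01 : e0 <= 1.
  rewrite ler_pdivrMr// mul1r; apply: le_trans th1 _.
  by rewrite -[1](mulr1n) ler_nat.
have AA0 : 0 <= K * N.+1%:R ^+ N / th ^+ N + S / th ^+ N.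
  by rewrite addr_ge0// divr_ge0 ?mulr_ge0 ?exprn_ge0// ltW.
(* The first summand pays for the orders k >= N, the second for the coefficients of p. *)
exists (K * N.+1%:R ^+ N / th ^+ N + S / th ^+ N), e0; split => //.
- by rewrite e00.
- move=> k; rewrite mulrDl; apply: ler_wpDl.
    by rewrite mulr_ge0 ?exprn_ge0 ?divr_ge0 ?mulr_ge0 ?exprn_ge0// ltW.
  have [kN|Nk] := ltnP k N; last first.
    by rewrite nth_default ?(leq_trans pN)// normr0 mulr_ge0 ?divr_ge0 ?exprn_ge0// ltW.
  rewrite mulrAC ler_pdivlMr//; apply: ler_pM => //; first exact: ltW.
    by rewrite /S (bigD1 (Ordinal kN))//= lerDl sumr_ge0.
  by apply: ler_wiXn2l; rewrite ?(ltW th0)//; exact: ltnW.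
move=> e /andP[e_gt0 ee0]; split.
  apply: (@le_trans _ _ (e0 * N.+1%:R)); last by rewrite /e0 divfK// gt_eqF.
  by apply: ler_pM => //; [exact: ltW|rewrite ler_nat].
(* Inverse Vandermonde weights for the nodes i, rescaled by e^(-m) for the coefficient of order m.
   For k < N the powers of e cancel and the sum is exactly p_k; for k >= N a positive power of e
   remains. *)
exists (fun i => \sum_(m < N) W i m * p`_m * (e^-1) ^+ m) => k.
have -> : \sum_(i < N) (\sum_(m < N) W i m * p`_m * e^-1 ^+ m) * (e * i%:R) ^+ k =
    \sum_(m < N) p`_m * (e^-1 ^+ m * e ^+ k) * \sum_(i < N) i%:R ^+ k * W i m.
  under eq_bigr do rewrite mulr_suml.
  rewrite exchange_big/=; apply: eq_bigr => m _.
  by rewrite mulr_sumr; apply: eq_bigr => i _; rewrite exprMn; ring.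
have A0 : 0 <= e * (K * N.+1%:R ^+ N / th ^+ N + S / th ^+ N) * th ^+ k.
  apply: mulr_ge0; last by rewrite exprn_ge0// ltW.
  by apply: mulr_ge0 => //; exact: ltW.
have [kN|Nk] := ltnP k N.
  have -> : \sum_(m < N) p`_m * (e^-1 ^+ m * e ^+ k) * \sum_(i < N) i%:R ^+ k * W i m = p`_k.
    under eq_bigr => m _ do rewrite (hW (Ordinal kN) m).
    rewrite (bigD1 (Ordinal kN))//= big1 ?addr0.
      by rewrite eqxx mulr1 -exprMn mulVf ?expr1n ?mulr1// gt_eqF.
    by move=> m mk; rewrite eq_sym (negbTE mk) mulr0.
  by rewrite subrr normr0.
rewrite [p`_k]nth_default ?(leq_trans pN)// subr0.
apply: (@le_trans _ _ (K * (e * e0 ^+ (k - N)) * N.+1%:R ^+ k)).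
  rewrite /K !mulr_suml; apply: le_trans (ler_norm_sum _ _ _) _; apply: ler_sum => m _.
  rewrite !normrM -!mulrA ler_wpM2l//.
  rewrite mulrA mulrC; apply: (@le_trans _ _ ((\sum_(i < N) `|W i m| * N.+1%:R ^+ k) * (e * e0 ^+ (k - N)))); last first.
    by rewrite -mulr_suml mulrAC -!mulrA.
  apply: ler_pM => //.
    apply: le_trans (ler_norm_sum _ _ _) _; apply: ler_sum => i _.
    rewrite normrM mulrC ler_wpM2l// normrX ger0_norm//.
    apply: lerXn2r; rewrite ?nnegrE//.
    by rewrite ler_nat ltnW// ltnW// ltnS ltn_ord.
  rewrite -normrM exprVn.
  have -> : (e ^+ m)^-1 * e ^+ k = e ^+ (k - m).
    rewrite -[in LHS](subnK (_ : (m <= k)%N)); last by rewrite ltnW// (leq_trans (ltn_ord m)).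
    by rewrite exprD mulrC mulfK// expf_neq0// gt_eqF.
  rewrite ger0_norm ?exprn_ge0 ?(ltW e_gt0)//.
  apply: (@le_trans _ _ (e ^+ (k - N).+1)).
    apply: ler_wiXn2l; rewrite ?(ltW e_gt0)//; first exact: le_trans e01.
    exact: (ltn_sub2l (leq_trans (ltn_ord m) Nk) (ltn_ord m)).
  rewrite exprS ler_wpM2l ?(ltW e_gt0)//.
  by apply: lerXn2r; rewrite ?nnegrE ?(ltW e_gt0) ?(ltW e00).
rewrite mulrDr mulrDl; apply: ler_wpDr.
  by rewrite !mulr_ge0 ?exprn_ge0 ?invr_ge0 ?exprn_ge0 ?(ltW e_gt0) ?(ltW th0).
have [d ->] : exists d, k = (d + N)%N by exists (k - N)%N; rewrite subnK.
rewrite addnK !exprD /e0 exprMn exprVn.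
move: (N.+1%:R ^+ d) (expf_neq0 d (lt0r_neq0 N1)) => y y0.
rewrite (_ : _ * (y * _) = e * (K * N.+1%:R ^+ N / th ^+ N) * (th ^+ d * th ^+ N))//.
by field; rewrite y0 gt_eqF.
Qed.

End Nodes.

(** * Positivity of the moment functional on squares *)

Section HankelPositivity.
Variable R : realType.
Implicit Types (p q : {poly R}) (s c : R^nat).

Definition moment_functional (s : R^nat) (p : {poly R}) : R := \sum_(i < size p) p`_i * s i.

Lemma moment_functional_widen s p n : (size p <= n)%N ->
  moment_functional s p = \sum_(i < n) p`_i * s i.
Proof.
move=> pn; rewrite /moment_functional (big_ord_widen n (fun i => p`_i * s i))// big_mkcond/=.
apply: eq_bigr => i _; case: ltnP => // pi.
by rewrite nth_default// mul0r.
Qed.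

Lemma moment_functionalD s p q :
  moment_functional s (p + q) = moment_functional s p + moment_functional s q.
Proof.
pose n := maxn (size p) (size q).
rewrite !(@moment_functional_widen _ _ n) ?leq_maxl ?leq_maxr ?size_polyD//.
by rewrite -big_split/=; apply: eq_bigr => i _; rewrite coefD mulrDl.
Qed.

Lemma moment_functionalZ s (a : R) p :
  moment_functional s (a *: p) = a * moment_functional s p.
Proof.
rewrite !(@moment_functional_widen _ _ (size p)) ?size_scale_leq//.
by rewrite mulr_sumr; apply: eq_bigr => i _; rewrite coefZ mulrA.
Qed.

Lemma moment_functionalN s p : moment_functional s (- p) = - moment_functional s p.
Proof. by rewrite -scaleN1r moment_functionalZ mulN1r. Qed.

Lemma moment_functionalB s p q :
  moment_functional s (p - q) = moment_functional s p - moment_functional s q.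
Proof. by rewrite moment_functionalD moment_functionalN. Qed.

Lemma moment_functional_sum s (I : finType) (F : I -> {poly R}) :
  moment_functional s (\sum_i F i) = \sum_i moment_functional s (F i).
Proof.
apply: (big_morph _ (moment_functionalD s)).
by rewrite /moment_functional size_poly0 big_ord0.
Qed.

Lemma moment_functionalXM s p :
  moment_functional s ('X * p) = moment_functional (fun i => s i.+1) p.
Proof.
rewrite (@moment_functional_widen s _ (size p).+1); last first.
  by rewrite (leq_trans (size_polyMleq _ _))// size_polyX.
rewrite big_ord_recl coefXM eqxx mul0r add0r; apply: eq_bigr => i _.
by rewrite lift0 coefXM.
Qed.

Lemma moment_functionalXn s k : moment_functional s 'X^k = s k.
Proof.
rewrite (@moment_functional_widen _ _ k.+1) ?size_polyXn//.
rewrite (bigD1 ord_max)//= coefXn eqxx mul1r big1 ?addr0// => i ik.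
by rewrite coefXn (_ : (_ == _) = false) ?mul0r//; exact: negbTE ik.
Qed.

Lemma convolve_coef p q k : convolve (fun i => p`_i) (fun i => q`_i) k.+1 = (p * q)`_k.
Proof. by rewrite coefM. Qed.

(** For coefficients of polynomials the terms vanish from some index on, and the partial sums are
    eventually constant. *)
Lemma cvg_convolve_coef c p q :
  series (fun k => c k * convolve (fun i => p`_i) (fun i => q`_i) k) @ \oo -->
  moment_functional (fun k => c k.+1) (p * q).
Proof.
apply: cvg_near_cst; near=> n.
have [m -> mn] : exists2 m, n = m.+1 & (size (p * q)%R <= m)%N.
  have n1 : (size (p * q)%R < n)%N by near: n; exists (size (p * q)%R).+1.
  by exists n.-1; [rewrite (ltn_predK n1)|rewrite -ltnS (ltn_predK n1)].
rewrite /series/= big_nat_recl// {1}/convolve big_ord0 mulr0 add0r.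
rewrite (moment_functional_widen _ mn) big_mkord; apply: eq_bigr => i _.
by rewrite convolve_coef mulrC.
Unshelve. all: by end_near. Qed.

Lemma le0_of_perturb (K e0 l : R) : 0 < e0 ->
  (forall e, 0 < e <= e0 -> exists2 L, L <= 0 & `|L - l| <= e * K) -> l <= 0.
Proof.
move=> e00 h; rewrite leNgt; apply/negP => l0.
have K0 : 0 <= K.
  have [|L _ hL] := h e0; first by rewrite e00 lexx.
  by rewrite -(pmulr_rge0 _ e00); exact: le_trans hL.
pose e := Num.min e0 (l / (2 * (K + 1))).
have e1 : 0 < e <= e0.
  by rewrite /e ge_min lexx lt_min e00/= divr_gt0// mulr_gt0// ltr_wpDl.
have [L L0 hL] := h e e1.
have : l - L <= e * K by apply: le_trans hL; rewrite distrC ler_norm.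
have : e * K <= l / (2 * (K + 1)) * K by rewrite ler_wpM2r// /e ge_min lexx orbT.
have : l / (2 * (K + 1)) * K < l.
  rewrite mulrAC ltr_pdivrMr ?mulr_gt0 ?ltr_wpDl//; nra.
lra.
Qed.

Theorem ocm_hankel (f : R -> R) (c : R^nat) : operator_completely_monotone (-1) 1 f ->
  (forall y : R, -1 < y < 1 -> pseries c y @ \oo --> f y) ->
  forall p, moment_functional (fun k => c k.+1) (p * p) <= 0 /\
    0 <= moment_functional (fun k => c k.+1) ('X * (p * p)).
Proof.
move=> hf hc p.
have [M hM] : exists M, forall k, `|c k| <= M * 2 ^+ k.
  have h2 : 0 < (2^-1 : R) by rewrite invr_gt0.
  have h3 : -1 < (2^-1 : R) < 1 by apply/andP; split; lra.
  have [M hM] := pseries_coef_bound h2 (hc _ h3).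
  by exists M => k; have := hM k; rewrite invrK.
(* Two successive convolutions turn the rate th into 4 th = 1 / 4; against |c k| <= M 2^k this
   leaves a series of ratio 1 / 2. *)
pose th : R := 1 / 16.
have th0 : 0 < th by rewrite /th; lra.
have th1 : 0 < th <= 1 by apply/andP; split; rewrite /th; lra.
pose N := (size p).+1.
have [A [e0 [A0 /andP[e00 e01] hp hA]]] := @node_weights R p N th (leqnSn _) th1.
pose a' := fun k => p`_k.
(* The limit of the power sums of the nodes e i, where order 0 counts every node: the coefficients
   of the constant polynomial N. *)
pose g' := fun k => (N%:R *: 1 : {poly R})`_k.
(* N serves order 0. At an order k > 0 each of the N powers (e i)^k is at most e N th^(k-1), whence
   N^2 / th. *)
pose B : R := N%:R ^+ 2 / th + N%:R.
have N0 : 0 < N%:R :> R by rewrite ltr0n.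
have B0 : 0 <= B by rewrite addr_ge0 ?divr_ge0 ?exprn_ge0// ltW.
have hg' k : `|g' k| <= B * th ^+ k.
  rewrite /g' coefZ coef1; case: k => [|k].
    rewrite mulr1 expr0 mulr1 ger0_norm ?ler0n// /B lerDr divr_ge0 ?exprn_ge0// ltW//.
  by rewrite mulr0 normr0 mulr_ge0// exprn_ge0// ltW.
have key e : 0 < e <= e0 -> exists a g : R^nat, [/\
    forall j, `|a j| <= 2 * A * th ^+ j,
    forall j, `|a j - a' j| <= e * (2 * A) * th ^+ j,
    forall j, `|g j| <= 2 * B * th ^+ j,
    forall j, `|g j - g' j| <= e * (2 * B) * th ^+ j &
    (exists2 L : R, L <= 0 & series (fun k => c k * convolve a a k) @ \oo --> L) /\
    (exists2 L : R, 0 <= L & series (fun k => c k * convolve (convolve a g) a k) @ \oo --> L)].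
  move=> he; have [eN [s hs]] := hA e he.
  have [e_gt0 ee0] := andP he.
  have e1 : e <= 1 by exact: le_trans e01.
  pose a k := \sum_i s i * (e * i%:R) ^+ k; pose g k := \sum_(i < N) (e * i%:R) ^+ k.
  have thk k : 0 <= th ^+ k by rewrite exprn_ge0// ltW.
  have hx (i : 'I_N) : 0 <= e * i%:R <= e * N%:R.
    by rewrite mulr_ge0 ?(ltW e_gt0)//= ler_wpM2l ?(ltW e_gt0)// ler_nat ltnW.
  have hgg j : `|g j - g' j| <= e * B * th ^+ j.
    rewrite /g' /g coefZ coef1; case: j => [|j].
      under eq_bigr do rewrite expr0.
      rewrite sumr_const card_ord mulr1 subrr normr0.
      by rewrite !mulr_ge0// ltW.
    rewrite mulr0 subr0; apply: (@le_trans _ _ (\sum_(i < N) e * (N%:R / th) * th ^+ j.+1)).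
      apply: le_trans (ler_norm_sum _ _ _) _; apply: ler_sum => i _.
      have [x0 xN] := andP (hx i).
      rewrite normrX ger0_norm// exprS.
      apply: (@le_trans _ _ (e * N%:R * th ^+ j)).
        apply: ler_pM; rewrite ?exprn_ge0//.
        by apply: lerXn2r; rewrite ?nnegrE ?(ltW th0)//; exact: le_trans eN.
      by rewrite exprS (_ : e * (N%:R / th) * (th * th ^+ j) = e * N%:R * th ^+ j)//; field; rewrite gt_eqF.
    rewrite sumr_const card_ord -[leLHS]mulr_natr /B mulrDr mulrDl; apply: ler_wpDr.
      by rewrite !mulr_ge0 ?ler0n// ltW.
    by rewrite (_ : _ * N%:R = e * (N%:R ^+ 2 / th) * th ^+ j.+1)//; ring.
  exists a, g; split.
  - move=> j; rewrite -(subrK (a' j) (a j)); apply: le_trans (ler_normD _ _) _.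
    have h1 : e * A * th ^+ j <= A * th ^+ j by rewrite ler_wpM2r// ler_piMl.
    have := hp j; have := hs j; rewrite -/(a j) -/(a' j); lra.
  - move=> j; apply: le_trans (hs j) _; rewrite ler_wpM2r//.
    by rewrite ler_wpM2l ?(ltW e_gt0)//; lra.
  - move=> j; rewrite -(subrK (g' j) (g j)); apply: le_trans (ler_normD _ _) _.
    have h1 : e * B * th ^+ j <= B * th ^+ j by rewrite ler_wpM2r// ler_piMl.
    have := hg' j; have := hgg j; lra.
  - move=> j; apply: le_trans (hgg j) _; rewrite ler_wpM2r//.
    by rewrite ler_wpM2l ?(ltW e_gt0)//; lra.
  - apply: (@ocm_rank_one R N (fun i => e * i%:R) s f c hf hc) => i.
    have [x0 xN] := andP (hx i); apply/andP; split; first by apply: lt_le_trans x0; lra.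
    by apply: le_lt_trans xN _; apply: le_lt_trans eN _; rewrite /th; lra.
have ha' j : `|a' j| <= 2 * A * th ^+ j.
  apply: le_trans (hp j) _; rewrite ler_wpM2r ?exprn_ge0 ?(ltW th0)//; lra.
have hg2' j : `|g' j| <= 2 * B * th ^+ j.
  apply: le_trans (hg' j) _; rewrite ler_wpM2r ?exprn_ge0 ?(ltW th0)//; lra.
have quarter k (x : R) : 0 <= x -> x * (2 * th) ^+ k <= x * (1 / 4) ^+ k.
  move=> x0; rewrite ler_wpM2l//; apply: lerXn2r; rewrite ?nnegrE /th; lra.
split.
- pose K := 2 * (2 * A * (2 * A) / th).
  have K0 : 0 <= K by rewrite !mulr_ge0// ltW// invr_gt0.
  apply: (@le0_of_perturb (2 * (M * K)) e0) => // e he.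
  have [a [g [h1 h2 h3 h4 [[L L0 hL] _]]]] := key e he.
  exists L => //.
  have hl : (fun n => `|series (fun k => c k * convolve a a k) n - series (fun k => c k * convolve a' a' k) n|) @ \oo -->
     `|L - moment_functional (fun k => c k.+1) (p * p)|.
    by apply: cvg_norm; apply: cvgB => //; exact: cvg_convolve_coef.
  apply: (ler_cvg_to hl (cvg_cst _)); near=> n.
  have -> : series (fun k => c k * convolve a a k) n - series (fun k => c k * convolve a' a' k) n =
      series (fun k => c k * (convolve a a k - convolve a' a' k)) n.
    by rewrite /series/= -sumrB; apply: eq_bigr => k _; rewrite mulrBr.
  rewrite (_ : e * (2 * (M * K)) = 2 * (M * (e * K))); last by ring.
  apply: series_bound => // k.
  apply: le_trans (convolve_diff_bound th0 h1 h2 ha' h2 k) _.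
  by apply: quarter; rewrite mulr_ge0//; case/andP: he => /ltW.
- have hth : 0 < 2 * th by rewrite mulr_gt0.
  pose K1 := 2 * (2 * A * (2 * B) / th).
  have K10 : 0 <= K1 by rewrite !mulr_ge0// ltW// invr_gt0.
  pose K2 := 2 * (2 * A * (2 * B) / th) + 2 * A.
  have K20 : 0 <= K2 by rewrite addr_ge0// mulr_ge0.
  pose K := 2 * (K2 * K2 / (2 * th)).
  have K0 : 0 <= K by rewrite !mulr_ge0// ltW// invr_gt0.
  have thth j : th ^+ j <= (2 * th) ^+ j by apply: lerXn2r; rewrite ?nnegrE /th; lra.
  have cE : convolve a' g' = fun k => (N%:R *: ('X * p))`_k.
    apply/funext => k; case: k => [|k].
      by rewrite /convolve big_ord0 coefZ coefXM eqxx mulr0.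
    by rewrite convolve_coef -scalerAr mulr1 !coefZ coefXM.
  (* The middle power sum tends to N at order 0, so the second derivative gives N L(x p^2) >= 0,
     negated here to reuse [le0_of_perturb]. *)
  have : - moment_functional (fun k => c k.+1) (N%:R *: ('X * p) * p) <= 0.
    apply: (@le0_of_perturb (2 * (M * K)) e0) => // e he.
    have [a [g [h1 h2 h3 h4 [_ [L L0 hL]]]]] := key e he.
    exists (- L); first by rewrite oppr_le0.
    have hl : (fun n => `|series (fun k => c k * convolve (convolve a g) a k) n - series (fun k => c k * convolve (convolve a' g') a' k) n|) @ \oo -->
       `|L - moment_functional (fun k => c k.+1) (N%:R *: ('X * p) * p)|.
      by apply: cvg_norm; apply: cvgB => //; rewrite cE; exact: cvg_convolve_coef.
    rewrite -opprD normrN; apply: (ler_cvg_to hl (cvg_cst _)); near=> n.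
    have -> : series (fun k => c k * convolve (convolve a g) a k) n - series (fun k => c k * convolve (convolve a' g') a' k) n =
        series (fun k => c k * (convolve (convolve a g) a k - convolve (convolve a' g') a' k)) n.
      by rewrite /series/= -sumrB; apply: eq_bigr => k _; rewrite mulrBr.
    rewrite (_ : e * (2 * (M * K)) = 2 * (M * (e * K))); last by ring.
    have e_ge0 : 0 <= e by case/andP: he => /ltW.
    have p2 j : 0 <= (2 * th) ^+ j by rewrite exprn_ge0// ltW.
    apply: series_bound => // k.
    have b1 j : `|convolve a g j| <= K2 * (2 * th) ^+ j.
      apply: le_trans (convolve_bound th0 h1 h3 j) _; rewrite ler_wpM2r// /K2.
      have : 0 <= 2 * A * (2 * B) / th by rewrite !mulr_ge0// ltW// invr_gt0.
      lra.
    have b2 j : `|convolve a g j - convolve a' g' j| <= e * K2 * (2 * th) ^+ j.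
      apply: le_trans (convolve_diff_bound th0 h1 h2 hg2' h4 j) _.
      by rewrite ler_wpM2r// ler_wpM2l// /K2 lerDl mulr_ge0.
    have b3 j : `|a' j| <= K2 * (2 * th) ^+ j.
      apply: le_trans (ha' j) _; apply: ler_pM => //; rewrite ?mulr_ge0 ?exprn_ge0 ?(ltW th0)//.
      by rewrite /K2 lerDr.
    have b4 j : `|a j - a' j| <= e * K2 * (2 * th) ^+ j.
      apply: le_trans (h2 j) _; apply: ler_pM => //; rewrite ?mulr_ge0 ?exprn_ge0 ?(ltW th0)//.
      by rewrite ler_wpM2l// /K2 lerDr.
    apply: le_trans (convolve_diff_bound hth b1 b2 b3 b4 k) _.
    have -> : 2 * (2 * th) = 1 / 4 :> R by rewrite /th; field.
    by [].
  rewrite -scalerAl moment_functionalZ mulrA oppr_le0 pmulr_rge0//.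
Unshelve. all: by end_near. Qed.

End HankelPositivity.

(** * From positivity on squares to Hausdorff's condition *)

Section Hausdorff.
Variable R : realType.

Lemma bernoulli_ineq (d : R) m : 0 <= d -> 1 + m%:R * d <= (1 + d) ^+ m.
Proof.
move=> d0; elim: m => [|m IH]; first by rewrite mul0r addr0 expr0.
rewrite exprS -natr1; have := ler0n R m; have := mulr_ge0 (ler0n R m) d0; nra.
Qed.

(* A log-convex sequence that increases once grows geometrically. *)
Lemma log_convex_nonincreasing (phi : R^nat) : (forall k, 0 <= phi k) ->
  (forall k a b, 0 <= a ^+ 2 * phi k + 2 * a * b * phi k.+1 + b ^+ 2 * phi k.+2) ->
  (forall r, 0 < r < 1 -> exists C, forall k, phi k * r ^+ k <= C) ->
  forall k, phi k.+1 <= phi k.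
Proof.
move=> phi0 cvx grow k; rewrite leNgt; apply/negP => lt1.
have pk : 0 < phi k.
  rewrite lt_neqAle phi0 andbT; apply/eqP => pk0.
  have p1 : 0 < phi k.+1 by rewrite pk0.
  (* If phi k were 0, the quadratic form would take the value -1 here. *)
  have := cvx k (- ((phi k.+2 + 1) / (2 * phi k.+1))) 1.
  rewrite -pk0 mulr0 add0r expr1n mul1r mulr1.
  have -> : 2 * - ((phi k.+2 + 1) / (2 * phi k.+1)) * phi k.+1 = - (phi k.+2 + 1).
    by field; rewrite gt_eqF.
  lra.
pose rho := phi k.+1 / phi k.
have rho1 : 1 < rho by rewrite /rho ltr_pdivlMr// mul1r.
have H m : 0 < phi (k + m)%N /\ rho * phi (k + m)%N <= phi (k + m).+1.
  elim: m => [|m [IH1 IH2]]; first by rewrite addn0 /rho divfK// gt_eqF.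
  have p1 : 0 < phi (k + m).+1 by apply: lt_le_trans IH2; rewrite mulr_gt0//; lra.
  rewrite addnS; split => //.
  (* With j = k + m, the form at this point is phi_j (phi_j phi_(j+2) - phi_(j+1)^2). *)
  have h := cvx (k + m)%N (phi (k + m).+1) (- phi (k + m)%N).
  have {}h : phi (k + m).+1 ^+ 2 <= phi (k + m)%N * phi (k + m).+2.
    rewrite -(ler_pM2l IH1); move: h; nra.
  rewrite -(ler_pM2l IH1); apply: le_trans h.
  by rewrite expr2 mulrA [_ * rho]mulrC ler_pM2r.
have Hm m : rho ^+ m * phi k <= phi (k + m)%N.
  elim: m => [|m IH]; first by rewrite expr0 mul1r addn0.
  rewrite exprS addnS -mulrA; apply: le_trans (H m).2.
  by rewrite ler_wpM2l//; lra.
(* Between 1 / rho and 1: [grow] applies to r, while rho r > 1 makes phi_k r^k unbounded, by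
   Bernoulli's inequality. *)
pose r := (1 + rho^-1) / 2.
have rV : rho^-1 < 1 by rewrite invf_lt1//; lra.
have rV0 : 0 < rho^-1 by rewrite invr_gt0; lra.
have r01 : 0 < r < 1 by apply/andP; split; rewrite /r; lra.
have [C hC] := grow r r01.
have [r0 r1] := andP r01.
pose d := (rho - 1) / 2.
have rr : rho * r = 1 + d by rewrite /r /d; field; rewrite gt_eqF//; lra.
have d0 : 0 < d by rewrite /d; lra.
have pr : 0 < phi k * r ^+ k by rewrite mulr_gt0// exprn_gt0.
have B m : (1 + m%:R * d) * (phi k * r ^+ k) <= C.
  apply: le_trans (hC (k + m)%N).
  apply: (@le_trans _ _ ((rho * r) ^+ m * (phi k * r ^+ k))).
    by rewrite ler_pM2r// rr bernoulli_ineq// ltW.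
  have -> : (rho * r) ^+ m * (phi k * r ^+ k) = rho ^+ m * phi k * (r ^+ k * r ^+ m).
    by rewrite exprMn; ring.
  by rewrite -exprD ler_wpM2r// exprn_ge0// ltW.
have C0 : 0 <= C by apply: le_trans (B 0%N); rewrite mul0r addr0 mul1r ltW.
pose x := C / (d * (phi k * r ^+ k)).
have x0 : 0 <= x by rewrite divr_ge0// ltW// mulr_gt0.
have := B (Num.bound x); have := archi_boundP x0.
rewrite -/x; move: (Num.bound x) => N; rewrite {}/x in x0 *.
rewrite ltr_pdivrMr; last by rewrite mulr_gt0.
move: (phi k * r ^+ k) pr => z z0; move: N%:R => y; nra.
Qed.

Lemma moment_functionalXnM (t : R^nat) k (Q : {poly R}) :
  moment_functional t ('X^k * Q) = \sum_(i < size Q) Q`_i * t (i + k)%N.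
Proof.
elim: k t => [|k IH] t.
  by rewrite expr0 mul1r; apply: eq_bigr => i _; rewrite addn0.
rewrite exprS -mulrA moment_functionalXM IH.
by apply: eq_bigr => i _; rewrite addnS.
Qed.

Variables (f : R -> R) (c : R^nat).
Hypothesis hf : operator_completely_monotone (-1) 1 f.
Hypothesis hc : forall y : R, -1 < y < 1 -> pseries c y @ \oo --> f y.
Let s k := (-1) ^+ k.+1 * c k.+1.

Let sE P : moment_functional s P = - moment_functional (fun k => c k.+1) (P \Po (- 'X)).
Proof.
rewrite comp_polyE moment_functional_sum -sumrN {1}/moment_functional.
apply: eq_bigr => i _; rewrite moment_functionalZ -mulrN; congr (_ * _).
rewrite -[- 'X]scaleN1r exprZn moment_functionalZ moment_functionalXn /s exprS.
by rewrite mulN1r mulNr.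
Qed.

(** The even part of the power of X is absorbed into the square. The two parities then come from the
    first and the second derivative, after reflecting X to - X. *)
Let s_square k p : 0 <= moment_functional s ('X^k * (p * p)).
Proof.
have base q : 0 <= moment_functional s (q * q) /\ 0 <= moment_functional s ('X * (q * q)).
  have [h1 h2] := ocm_hankel hf hc (q \Po (- 'X)).
  rewrite !sE !comp_polyM comp_polyX mulNr moment_functionalN opprK oppr_ge0.
  by split.
rewrite -(odd_double_half k) exprD -addnn exprD.
set h := (k./2); have -> : 'X^(odd k) * ('X^h * 'X^h) * (p * p) =
    'X^(odd k) * (('X^h * p) * ('X^h * p)) :> {poly R} by ring.
by case: (odd k); rewrite ?expr1 ?expr0 ?mul1r; have [] := base ('X^h * p).
Qed.

Let s_growth Q r : 0 < r < 1 ->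
  exists C, forall k, moment_functional s ('X^k * Q) * r ^+ k <= C.
Proof.
move=> /andP[r0 r1].
have r11 : -1 < r < 1 by apply/andP; split; lra.
have [M hM] := pseries_coef_bound r0 (hc r11).
exists (\sum_(i < size Q) `|Q`_i| * (M * (r^-1) ^+ i.+1)) => k.
have -> : moment_functional s ('X^k * Q) = \sum_(i < size Q) Q`_i * s (i + k)%N.
  exact: moment_functionalXnM.
rewrite mulr_suml; apply: ler_sum => i _.
apply: le_trans (ler_norm _) _.
rewrite -mulrA normrM ler_wpM2l// normrM /s normrM normrX normrN1 expr1n mul1r.
rewrite normrX (gtr0_norm r0).
apply: le_trans (ler_wpM2r (exprn_ge0 _ (ltW r0)) (hM _)) _.
rewrite -addSn exprD -!mulrA -exprMn mulVf ?gt_eqF// expr1n mulr1//.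
Qed.

(** For even m the factor (1 - X)^m is a square. For odd m one factor 1 - X is left, and positivity
    says that the moments of a fixed square decrease in k. *)
Theorem ocm_hausdorff k m : 0 <= moment_functional s ('X^k * (1 - 'X) ^+ m).
Proof.
pose q : {poly R} := (1 - 'X) ^+ m./2.
have E : (1 - 'X) ^+ m = (1 - 'X) ^+ (odd m) * (q * q) :> {poly R}.
  by rewrite -[in LHS](odd_double_half m) exprD -addnn exprD.
rewrite E; case: (odd m); last by rewrite expr0 mul1r; exact: s_square.
rewrite expr1 mulrBl mul1r mulrBr moment_functionalB subr_ge0.
have -> : ('X^k * ('X * (q * q)) = 'X^(k.+1) * (q * q) :> {poly R})%R by rewrite exprSr mulrA.
apply: (@log_convex_nonincreasing (fun k => moment_functional s ('X^k * (q * q)))).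
- by move=> j; exact: s_square.
(* The quadratic form in a and b is the value of the functional at X^j times the square of (a + b X)
   q. *)
- move=> j a b.
  have -> : a ^+ 2 * moment_functional s ('X^j * (q * q)) +
     2 * a * b * moment_functional s ('X^(j.+1) * (q * q)) +
     b ^+ 2 * moment_functional s ('X^(j.+2) * (q * q)) =
     moment_functional s ('X^j * (((a%:P + b *: 'X) * q) * ((a%:P + b *: 'X) * q))).
    rewrite -!moment_functionalZ -!moment_functionalD; congr moment_functional.
    have a2 : (a ^+ 2)%:P = a%:P * a%:P by rewrite -polyCM.
    have b2 : (b ^+ 2)%:P = b%:P * b%:P by rewrite -polyCM.
    rewrite -!mul_polyC a2 b2 !polyCM polyC_natr !exprS; ring.
  exact: s_square.
- by move=> r hr; exact: s_growth.
Qed.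

End Hausdorff.

(** * The Hausdorff moment problem *)

Section BernsteinOperator.
Variable R : realType.
Implicit Types (g h : nat -> R).

(* bernstein n g = \sum_(j <= n) g j * 'C(n, j) 'X^j (1 - 'X)^(n - j): the mean of
   [g] under the binomial distribution, here obtained by conditioning on one trial. *)
Fixpoint bernstein n g : {poly R} :=
  if n is n'.+1 then (1 - 'X) * bernstein n' g + 'X * bernstein n' (fun j => g j.+1)
  else (g 0%N)%:P.

Lemma bernstein_eq n g h : (forall j, (j <= n)%N -> g j = h j) -> bernstein n g = bernstein n h.
Proof.
elim: n g h => [|n IH] g h gh /=; first by rewrite gh.
by congr (_ * _ + _ * _); apply: IH => j jn; apply: gh => //; exact: ltnW.
Qed.

Lemma bernsteinD n g h : bernstein n (fun j => g j + h j) = bernstein n g + bernstein n h.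
Proof.
elim: n g h => [|n IH] g h /=; first by rewrite polyCD.
by rewrite !IH; ring.
Qed.

Lemma bernsteinZ n r g : bernstein n (fun j => r * g j) = r *: bernstein n g.
Proof.
elim: n g => [|n IH] g /=; first by rewrite polyCM mul_polyC.
by rewrite !IH -!mul_polyC; ring.
Qed.

Lemma bernstein_cst n r : bernstein n (fun=> r) = r%:P.
Proof. by elim: n => [//|n IH] /=; rewrite IH; ring. Qed.

Lemma bernstein_sum n N (F : nat -> nat -> R) :
  bernstein n (fun j => \sum_(i < N) F i j) = \sum_(i < N) bernstein n (F i).
Proof.
elim: N => [|N IH].
  rewrite big_ord0 -[RHS](bernstein_cst n).
  by apply: bernstein_eq => j _; rewrite big_ord0.
rewrite big_ord_recr/= -IH -bernsteinD; apply: bernstein_eq => j _.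
by rewrite big_ord_recr.
Qed.

(** The factorial moments of the binomial distribution. Unlike ordinary powers, falling factorials
    are sent to multiples of a single monomial. *)
Lemma bernstein_ffact n k :
  bernstein n (fun j => (j ^_ k)%:R) = (n ^_ k)%:R *: 'X^k.
Proof.
elim: n k => [|n IH] [|k] //=.
- by rewrite scale1r.
- by rewrite ffact0n scale0r.
- by rewrite !bernstein_cst scale1r expr0; ring.
have -> : bernstein n (fun j => (j.+1 ^_ k.+1)%:R) =
    bernstein n (fun j => (j ^_ k.+1)%:R + k.+1%:R * (j ^_ k)%:R).
  apply: bernstein_eq => j _; rewrite -natrM -natrD; congr (_%:R).
  have [jk|jk] := leqP k j.
    by rewrite ffactSS [j ^_ k.+1]ffactnSr mulnC [(k.+1 * _)%N]mulnC -mulnDr; congr muln; lia.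
  by rewrite !ffact_small//; lia.
rewrite bernsteinD bernsteinZ !IH.
have -> : (n.+1 ^_ k.+1)%:R = (n ^_ k.+1)%:R + k.+1%:R * (n ^_ k)%:R :> R.
  rewrite -natrM -natrD; congr (_%:R).
  have [jk|jk] := leqP k n.
    by rewrite ffactSS [n ^_ k.+1]ffactnSr mulnC [(k.+1 * _)%N]mulnC -mulnDr; congr muln; lia.
  by rewrite !ffact_small//; lia.
rewrite -!mul_polyC polyCD polyCM !exprS; ring.
Qed.

Lemma bernstein_ge0 (x : R) n g : 0 <= x <= 1 -> (forall j, (j <= n)%N -> 0 <= g j) ->
  0 <= (bernstein n g).[x].
Proof.
move=> /andP[x0 x1]; elim: n g => [|n IH] g g0 /=; first by rewrite hornerC g0.
rewrite !hornerE; apply: addr_ge0; apply: mulr_ge0 => //; first by rewrite subr_ge0.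
  by apply: IH => j jn; apply: g0; exact: ltnW.
by apply: IH => j jn; exact: g0.
Qed.

Lemma bernstein_functional_ge0 (s : R^nat) :
  (forall k m, 0 <= moment_functional s ('X^k * (1 - 'X) ^+ m)) ->
  forall n g, (forall j, (j <= n)%N -> 0 <= g j) -> 0 <= moment_functional s (bernstein n g).
Proof.
move=> s0 n g g0.
(* The recursion multiplies by X or 1 - X; the extra factor lets the induction hypothesis absorb
   them. *)
suff : forall k m, 0 <= moment_functional s (bernstein n g * ('X^k * (1 - 'X) ^+ m)).
  by move=> /(_ 0%N 0%N); rewrite expr0 expr0 !mulr1.
elim: n g g0 => [|n IH] g g0 k m /=.
  by rewrite mul_polyC moment_functionalZ mulr_ge0// g0.
rewrite mulrDl moment_functionalD; apply: addr_ge0.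
  have -> : (1 - 'X) * bernstein n g * ('X^k * (1 - 'X) ^+ m) =
    bernstein n g * ('X^k * (1 - 'X) ^+ m.+1) by rewrite exprS; ring.
  by apply: IH => j jn; apply: g0; exact: ltnW.
have -> : 'X * bernstein n (fun j => g j.+1) * ('X^k * (1 - 'X) ^+ m) =
  bernstein n (fun j => g j.+1) * ('X^(k.+1) * (1 - 'X) ^+ m) by rewrite exprS; ring.
by apply: IH => j jn; exact: g0.
Qed.

(** The price, uniform in j, of replacing powers by the falling factorials that the operator
    evaluates exactly. Only the rate 1 / n matters, so a crude constant is enough. *)
Lemma ffact_power_close (n j k : nat) : (j <= n)%N -> (0 < n)%N ->
  `|(j%:R / n%:R) ^+ k - (j ^_ k)%:R / n%:R ^+ k| <= (k ^ 2)%:R / n%:R :> R.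
Proof.
move=> jn n0.
have H : ((j ^_ k <= j ^ k) /\ (n * j ^ k <= n * j ^_ k + k ^ 2 * n ^ k))%N.
  elim: k => [|k [IH1 IH2]]; first by rewrite !expn0 ffactn0; lia.
  have jk : (j * j ^_ k <= j ^_ k.+1 + k * j ^_ k)%N.
    have [kj|kj] := leqP k j.
      by rewrite ffactnSr [(j * _)%N]mulnC [(k * _)%N]mulnC -mulnDr leq_mul2l; lia.
    by rewrite [(j ^_ k)%N]ffact_small// !muln0.
  have fj : (j ^_ k <= n ^ k)%N by apply: leq_trans IH1 _; case: (posnP k) => [->|k0]; rewrite ?expn0 ?leq_exp2r//.
  split; first by rewrite ffactnSr expnSr leq_mul// leq_subr.
  rewrite -!mulnn ![(_ ^ k.+1)%N]expnS in IH2 *.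
  move: jk fj IH2 {IH1}; set a := (j ^_ k)%N; set b := (j ^_ k.+1)%N.
  move: (j ^ k)%N (n ^ k)%N => p q jk fj IH2.
  have h1 : (n * (j * a) <= n * (b + k * a))%N by rewrite leq_mul2l jk orbT.
  have h2 : (j * (n * p) <= j * (n * a + k * k * q))%N by rewrite leq_mul2l IH2 orbT.
  have h3 : (n * k * a <= n * k * q)%N by rewrite leq_mul2l fj orbT.
  have h4 : (j * (k * k * q) <= n * (k * k * q))%N by rewrite leq_mul2r jn orbT.
  nia.
have [h1 h2] := H.
have nr : 0 < n%:R :> R by rewrite ltr0n.
rewrite expr_div_n -mulrBl normrM normfV (ger0_norm (exprn_ge0 _ (ltW nr))).
rewrite ler_pdivrMr ?exprn_gt0// mulrAC ler_pdivlMr//.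
rewrite ger0_norm ?subr_ge0; last by rewrite -natrX ler_nat.
by rewrite mulrBl lerBlDl -!natrX -!natrM -natrD ler_nat; lia.
Qed.

Lemma bernstein_functional_cvg (s : R^nat) k :
  (forall k m, 0 <= moment_functional s ('X^k * (1 - 'X) ^+ m)) ->
  (fun n => moment_functional s (bernstein n (fun j => (j%:R / n%:R) ^+ k))) @ \oo --> s k.
Proof.
move=> s0.
have Lle n g h : (forall j, (j <= n)%N -> g j <= h j) ->
    moment_functional s (bernstein n g) <= moment_functional s (bernstein n h).
  move=> gh; rewrite -subr_ge0.
  have := bernstein_functional_ge0 s0 (n := n) (g := fun j => h j + (-1) * g j).
  rewrite bernsteinD bernsteinZ moment_functionalD moment_functionalZ mulN1r; apply.
  by move=> j jn; rewrite mulN1r subr_ge0 gh.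
have K n : (0 < n)%N -> `|moment_functional s (bernstein n (fun j => (j%:R / n%:R) ^+ k)) - s k|
    <= (k ^ 2)%:R * (s 0%N + `|s k|) / n%:R.
  move=> n0; set u := moment_functional _ _.
  pose e : R := (k ^ 2)%:R / n%:R.
  pose v := (n ^_ k)%:R / n%:R ^+ k * s k.
  have L1 r : moment_functional s (bernstein n (fun=> r)) = r * s 0%N.
    rewrite bernstein_cst -[r%:P]mulr1 mul_polyC moment_functionalZ.
    by rewrite -(expr0 'X) moment_functionalXn.
  have vE : moment_functional s (bernstein n (fun j => (n%:R ^+ k)^-1 * (j ^_ k)%:R)) = v.
    by rewrite bernsteinZ bernstein_ffact !moment_functionalZ moment_functionalXn /v; ring.
  have uv : `|u - v| <= e * s 0%N.
    rewrite ler_norml; apply/andP; split.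
      rewrite lerBrDr -vE -mulNr -L1 -moment_functionalD -bernsteinD.
      apply: Lle => j jn; have := ffact_power_close k jn n0; rewrite ler_norml -/e.
      by move=> /andP[h _]; rewrite mulrC; move: h; lra.
    rewrite lerBlDr -vE -L1 -moment_functionalD -bernsteinD.
    apply: Lle => j jn; have := ffact_power_close k jn n0; rewrite ler_norml -/e.
    by move=> /andP[_ h]; rewrite [_^-1 * _]mulrC; move: h; lra.
  have vs : `|v - s k| <= e * `|s k|.
    rewrite /v -[X in _ - X]mul1r -mulrBl normrM ler_wpM2r//.
    have := ffact_power_close k (leqnn n) n0.
    by rewrite divff ?gt_eqF ?ltr0n// expr1n distrC.
  have -> : u - s k = (u - v) + (v - s k) by ring.
  apply: le_trans (ler_normD _ _) _; apply: le_trans (lerD uv vs) _.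
  by rewrite -mulrDr /e mulrAC.
apply/cvgrPdist_le => e e0.
set C := (k ^ 2)%:R * (s 0%N + `|s k|) in K.
have s00 : 0 <= s 0%N.
  by have := s0 0%N 0%N; rewrite !expr0 mulr1 -(expr0 'X) moment_functionalXn.
have C0 : 0 <= C by rewrite /C mulr_ge0// addr_ge0.
exists (Num.bound (C / e)).+1 => //= n /= hn; rewrite distrC.
apply: le_trans (K n (leq_trans (ltn0Sn _) hn)) _.
rewrite ler_pdivrMr ?ltr0n ?(leq_trans _ hn)// mulrC -ler_pdivrMr//.
apply: ltW; apply: lt_le_trans (archi_boundP (divr_ge0 C0 (ltW e0))) _.
by rewrite ler_nat ltnW.
Qed.

End BernsteinOperator.

(** * Integrals of step functions and Riemann sums of monotone functions *)

Section StepFunctions.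
Variable R : realType.
Implicit Types (a g : nat -> R).
Local Notation D := `[(0 : R), 1]%classic.
Local Notation leb := (@lebesgue_measure R).
Local Notation I f := (Rintegral leb D f).

Lemma count_initial (b : nat -> bool) n : (forall i j, (i <= j)%N -> b j -> b i) ->
  b n -> (\sum_(j < n) b j)%N = n.
Proof.
move=> hb bn; rewrite (eq_bigr (fun=> 1%N)); first by rewrite sum1_card card_ord.
by move=> j _; rewrite (hb j n)// ltnW.
Qed.

(** As b holds on an initial segment, the increments kept by [b j] are exactly those below the
    count, and they telescope. *)
Lemma telescope_count a (b : nat -> bool) n : (forall i j, (i <= j)%N -> b j -> b i) ->
  a (\sum_(j < n) b j)%N = a 0%N + \sum_(j < n) (a j.+1 - a j) * (b j)%:R.
Proof.
move=> hb; elim: n => [|n IH]; first by rewrite !big_ord0 addr0.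
rewrite !big_ord_recr/= addrA -IH.
case: (boolP (b n)) => [bn|_]; last by rewrite addn0 mulr0 addr0.
by rewrite count_initial// addn1 mulr1 subrKC.
Qed.

Lemma unit_integrable (f : R -> R) (M : R) : measurable_fun D f ->
  (forall u, `|f u| <= M) -> leb.-integrable D (EFin \o f).
Proof.
move=> mf fM; apply: measurable_bounded_integrable => //.
  by rewrite /= lebesgue_measure_itv/= lte_fin ltr01 -EFinB ltry.
by exists M; split; [exact: num_real|move=> x Mx u _; apply: le_trans (fM u) (ltW Mx)].
Qed.

Lemma unit_indic_integral (B : R) : 0 <= B <= 1 ->
  I (fun u => (B <= u)%R%:R) = 1 - B.
Proof.
move=> /andP[B0 B1].
have -> : (fun u : R => (B <= u)%R%:R) = \1_(`[B, +oo[%classic) :> (R -> R).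
  by apply/funext => u; rewrite indicE; congr (_%:R); rewrite mem_setE in_itv/= andbT.
rewrite /Rintegral integral_indic//= setIC.
have -> : D `&` `[B, +oo[%classic = `[B, 1]%classic.
  apply/seteqP; split=> u /=; rewrite !in_itv/= andbT.
    by move=> [/andP[_ ->] ->].
  by move=> /andP[Bu ->]; rewrite Bu (le_trans B0 Bu).
rewrite lebesgue_measure_itv/= lte_fin; case: ltP => [|B1']//=.
by apply/esym/eqP; rewrite subr_eq0 eq_le B1 B1'.
Qed.

Lemma indic_measurable (B : R) : measurable_fun D (fun u : R => (B <= u)%R%:R : R).
Proof.
apply: nondecreasing_measurable => // x y xy; rewrite ler_nat.
by case: (leP B x) => // Bx; rewrite (le_trans Bx xy).
Qed.

Lemma unit_step_integral a (B : R^nat) n : (forall i, 0 <= B i <= 1) ->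
  (forall i j, (i <= j)%N -> B i <= B j) ->
  I (fun u => a (\sum_(j < n) (B j <= u)%R)%N) =
  a 0%N + \sum_(j < n) (a j.+1 - a j) * (1 - B j).
Proof.
move=> B01 Bnd.
rewrite (_ : (fun u => _) =
    (fun u : R => a 0%N + \sum_(j < n) (a j.+1 - a j) * (B j <= u)%R%:R)); last first.
  apply/funext => u; apply: (@telescope_count a (fun j => (B j <= u)%R)) => i j ij Bj.
  exact: le_trans (Bnd _ _ ij) Bj.
have int1 j (r : R) : leb.-integrable D (EFin \o (fun u : R => r * (B j <= u)%R%:R)).
  apply: (@unit_integrable _ `|r|); first exact: measurable_funM (indic_measurable _).
  by move=> u; rewrite normrM; case: (_ <= u); rewrite ?normr1 ?mulr1// normr0 mulr0.
have intS m : leb.-integrable D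
    (EFin \o (fun u : R => a 0%N + \sum_(j < m) (a j.+1 - a j) * (B j <= u)%R%:R)).
  elim: m => [|m IH].
    apply: (@unit_integrable _ `|a 0%N|) => [|u]; last by rewrite big_ord0 addr0.
    rewrite (_ : (fun u => _) = cst (a 0%N)); first exact: measurable_cst.
    by apply/funext => u; rewrite big_ord0 addr0.
  have mD : measurable (D : set (measurableTypeR R)) by [].
  have := integrableD mD IH (int1 m (a m.+1 - a m)).
  congr integrable; apply/funext => u /=.
  by rewrite big_ord_recr/= addrA EFinD.
elim: n => [|n IH].
  rewrite big_ord0 addr0; under eq_Rintegral do rewrite big_ord0 addr0.
  by rewrite Rintegral_cst//= lebesgue_measure_itv/= lte_fin ltr01 oppr0 addr0 mulr1.
under eq_Rintegral do rewrite big_ord_recr/= addrA.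
rewrite (RintegralD _ (intS n) (int1 n _))// IH big_ord_recr/= addrA; congr (_ + _).
rewrite RintegralZl ?unit_indic_integral//.
apply: (@unit_integrable _ 1); first exact: indic_measurable.
by move=> u; case: (_ <= u); rewrite ?normr1 ?normr0.
Qed.

Definition left_sum (g : R -> R) n : R := (\sum_(j < n.+1) g (j%:R / n.+1%:R)) / n.+1%:R.

(** The minimum acts only for j > n: [unit_step_integral] asks for thresholds in [0, 1] at every
    index. *)
Let grid n (j : nat) : R := Num.min (j.+1%:R / n.+1%:R) 1.

Let grid01 n i : 0 <= grid n i <= 1.
Proof. by rewrite /grid le_min ler01 divr_ge0// ge_min lexx orbT. Qed.

Let grid_nd n i j : (i <= j)%N -> grid n i <= grid n j.
Proof.
move=> ij; rewrite /grid le_min !ge_min lexx orbT andbT; apply/orP; left.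
by rewrite ler_pM2r ?invr_gt0// ler_nat ltnS.
Qed.

Let gridE n j : (j < n.+1)%N -> grid n j = j.+1%:R / n.+1%:R.
Proof. by move=> jn; rewrite /grid min_l// ler_pdivrMr// mul1r ler_nat. Qed.

Let step_left_sum (a : nat -> R) n :
  I (fun u => a (\sum_(j < n) (grid n j <= u)%R)%N) = (\sum_(j < n.+1) a j) / n.+1%:R.
Proof.
rewrite unit_step_integral//.
  apply: (@mulIf _ n.+1%:R); first by rewrite pnatr_eq0.
  rewrite divfK ?pnatr_eq0// mulrDl mulr_suml.
  suff H m : (m <= n)%N -> a 0%N * n.+1%:R + \sum_(j < m) (a j.+1 - a j) * (1 - grid n j) * n.+1%:R
      = \sum_(j < m) a j + (n.+1 - m)%N%:R * a m.
    by rewrite H// subSnn mul1r big_ord_recr.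
  elim: m => [|m IH] mn; first by rewrite !big_ord0 add0r addr0 subn0 mulrC.
  rewrite !big_ord_recr/= addrA IH; last exact: ltnW.
  rewrite gridE; last by rewrite ltnS ltnW.
  have n0 : n.+1%:R != 0 :> R by rewrite pnatr_eq0.
  rewrite -mulrA [(1 - _) * _]mulrBl mul1r divfK// !natrB; [|by lia..].
  by rewrite -!natr1; ring.
- exact: grid_nd.
Qed.

(** The integral lies between the left and right Riemann sums, whose difference telescopes. The
    bound is the same for all such g, so it survives a limit along any filter. *)
Lemma left_sum_close (g : R -> R) n : nondecreasing_fun g -> (forall u, 0 <= g u <= 1) ->
  `|I g - left_sum g n| <= n.+1%:R^-1.
Proof.
move=> gnd g01.
pose cnt u := (\sum_(j < n) (grid n j <= u)%R)%N.
have cnt_le m (u : R) : 0 <= u -> (m <= n)%N ->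
    ((\sum_(j < m) (grid n j <= u)%R)%N%:R / n.+1%:R <= u).
  move=> u0; elim: m => [|m IH] mn; first by rewrite big_ord0 mul0r.
  rewrite big_ord_recr/=; case: (leP (grid n m) u) => [h|h]; last first.
    by rewrite addn0 IH// ltnW.
  rewrite (@count_initial (fun j => (grid n j <= u)%R)) ?addn1 -?gridE//; first exact: ltnW.
  by move=> i j ij; apply: le_trans; exact: grid_nd.
have cnt_ge m (u : R) : u <= m.+1%:R / n.+1%:R -> (m <= n)%N ->
    u <= (\sum_(j < m) (grid n j <= u)%R)%N.+1%:R / n.+1%:R.
  elim: m => [|m IH] um mn; first by rewrite big_ord0.
  rewrite big_ord_recr/=; case: (leP (grid n m) u) => [h|h]; last first.
    rewrite addn0; apply: IH; last exact: ltnW.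
    by rewrite -gridE ?ltW//; exact: ltnW.
  rewrite (@count_initial (fun j => (grid n j <= u)%R)) ?addn1//.
  by move=> i j ij; apply: le_trans; exact: grid_nd.
have int f : nondecreasing_fun f -> (forall u : R, 0 <= f u <= 1) -> leb.-integrable D (EFin \o f).
  move=> fnd f01; apply: (@unit_integrable _ 1).
    exact: nondecreasing_measurable.
  by move=> u; have /andP[f0 f1] := f01 u; rewrite ger0_norm.
have cnt_nd : {homo cnt : u v / u <= v >-> (u <= v)%N}.
  move=> u v uv; apply: leq_sum => j _.
  by case: (leP (grid n j) u) => // h; rewrite (le_trans h uv).
have mono (k : nat) : nondecreasing_fun (fun u => g ((cnt u + k)%N%:R / n.+1%:R)).
  move=> u v uv; apply: gnd; rewrite ler_pM2r ?invr_gt0// ler_nat leq_add2r.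
  exact: cnt_nd.
have lo : left_sum g n <= I g.
  rewrite /left_sum -(step_left_sum (fun j => g (j%:R / n.+1%:R))).
  apply: le_Rintegral => //.
  - by apply: int => [u v uv|u]//; have := mono 0%N u v uv; rewrite !addn0.
  - exact: int.
  - move=> u; rewrite /= in_itv/= => /andP[u0 _]; apply: gnd; exact: cnt_le.
have hi : I g <= (\sum_(j < n.+1) g (j.+1%:R / n.+1%:R)) / n.+1%:R.
  rewrite -(step_left_sum (fun j => g (j.+1%:R / n.+1%:R))).
  apply: le_Rintegral => //.
  - exact: int.
  - by apply: int => [u v uv|u]//; have := mono 1%N u v uv; rewrite !addn1.
  - move=> u; rewrite /= in_itv/= => /andP[_ u1]; apply: gnd; apply: cnt_ge => //.
    by rewrite divff ?pnatr_eq0.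
rewrite ger0_norm ?subr_ge0//; apply: le_trans (lerB hi (lexx _)) _.
rewrite /left_sum -mulrBl -sumrB.
have -> : \sum_(j < n.+1) (g (j.+1%:R / n.+1%:R) - g (j%:R / n.+1%:R)) = g 1 - g 0.
  rewrite -(big_mkord xpredT (fun j => g (j.+1%:R / n.+1%:R) - g (j%:R / n.+1%:R))).
  rewrite (telescope_sumr (fun j => g (j%:R / n.+1%:R)))//.
  by rewrite divff ?pnatr_eq0// mul0r.
rewrite ler_pdivrMr// mulVf ?pnatr_eq0//.
by have /andP[_ ?] := g01 1; have /andP[? _] := g01 0; lra.
Qed.

End StepFunctions.

Section UltrafilterLimits.
Variable R : realType.

(** Compactness gives a cluster point, and an ultrafilter converges to each of its cluster
    points. *)
Lemma ultrafilter_segment_limit (U : set_system nat) (x : R^nat) (a b : R) : UltraFilter U ->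
  (forall n, a <= x n <= b) -> exists2 p, a <= p <= b & x @ U --> p.
Proof.
move=> UU xab.
have PU : ProperFilter U by exact: ultra_proper.
have [|p [pab clp]] := @segment_compact R a b (x @ U) _.
  have xD n : `[a, b]%classic (x n) by rewrite /= in_itv/=; exact: xab.
  suff : U (x @^-1` `[a, b]%classic) by [].
  by apply: filterS (filterT : U setT) => n _; exact: xD.
exists p => //.
move=> A pA; have [//|UA] := in_ultra_setVsetC (x @^-1` A) UU.
have [y [nAy Ay]] := clp (~` A) A UA pA; by [].
Qed.

Lemma cvg_sum_filter (U : set_system nat) (FU : Filter U) n (F : nat -> R^nat) (l : R^nat) :
  (forall i, F i @ U --> l i) -> (fun m => \sum_(i < n) F i m) @ U --> (\sum_(i < n) l i : R).
Proof.
move=> Fl; elim: n => [|n IH].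
  rewrite big_ord0 (_ : (fun m => _) = (fun=> 0 : R)); first exact: cvg_cst.
  by apply/funext => m; rewrite big_ord0.
rewrite big_ord_recr/= (_ : (fun m => _) = (fun m => \sum_(i < n) F i m + F n m)).
  exact: cvgD.
by apply/funext => m; rewrite big_ord_recr.
Qed.

Lemma cvg_exp_filter (U : set_system nat) (FU : Filter U) k (x : R^nat) (l : R) :
  x @ U --> l -> (fun m => x m ^+ k) @ U --> (l ^+ k : R).
Proof.
move=> xl; elim: k => [|k IH]; first exact: cvg_cst.
rewrite exprS (_ : (fun m => _) = (fun m => x m * x m ^+ k)); first exact: cvgM.
by apply/funext => m; rewrite exprS.
Qed.

End UltrafilterLimits.

(** * Quantile functions of the Bernstein weights and their limit *)

Section Quantile.
Variables (R : realType) (s : R^nat).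
Hypothesis s_pos : forall k m, 0 <= moment_functional s ('X^k * (1 - 'X) ^+ m).
Hypothesis s01 : s 0%N = 1.
Local Notation D := `[(0 : R), 1]%classic.
Local Notation leb := (@lebesgue_measure R).
Local Notation I f := (Rintegral leb D f).

(** The mean of g under the weights obtained by applying s to the Bernstein basis, a probability on
    0, ..., n since s 0 = 1. *)
Let L n g := moment_functional s (bernstein n g).

Let L1 n : L n (fun=> 1) = 1.
Proof. by rewrite /L bernstein_cst polyC1 -(expr0 'X) moment_functionalXn. Qed.

Let LD n g h : L n (fun j => g j + h j) = L n g + L n h.
Proof. by rewrite /L bernsteinD moment_functionalD. Qed.

Let LZ n r g : L n (fun j => r * g j) = r * L n g.
Proof. by rewrite /L bernsteinZ moment_functionalZ. Qed.

Let L_ge0 n g : (forall j, 0 <= g j) -> 0 <= L n g.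
Proof. by move=> g0; apply: bernstein_functional_ge0. Qed.

Let L_le n g h : (forall j, g j <= h j) -> L n g <= L n h.
Proof.
move=> gh; rewrite -subr_ge0 -mulN1r -LZ -LD; apply: L_ge0 => j.
by rewrite mulN1r subr_ge0.
Qed.

(** The distribution function of these weights. *)
Let B n j := L n (fun i => (i <= j)%N%:R).

Let B01 n j : 0 <= B n j <= 1.
Proof. by rewrite L_ge0//= -(L1 n) L_le// => i; case: (i <= j)%N. Qed.

Let B_nd n i j : (i <= j)%N -> B n i <= B n j.
Proof. by move=> ij; apply: L_le => m; rewrite ler_nat; case: (leqP m i) => // /leq_trans->. Qed.

(** Counting the j with B j <= u gives the generalized inverse of B, here rescaled to [0, 1]. For n
    = 0 the value is 0, as the inverse of 0 is 0. *)
Let Q n (u : R) : R := (\sum_(j < n) (B n j <= u)%R)%N%:R / n%:R.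

Let Q01 n u : 0 <= Q n u <= 1.
Proof.
rewrite /Q divr_ge0//=; have [->|n0] := posnP n; first by rewrite invr0 mulr0.
rewrite ler_pdivrMr ?ltr0n// mul1r ler_nat.
apply: (@leq_trans (\sum_(j < n) 1)%N); last by rewrite sum1_card card_ord.
by apply: leq_sum => j _; case: (_ <= u).
Qed.

Let Q_nd n : nondecreasing_fun (Q n).
Proof.
move=> u v uv; rewrite ler_wpM2r ?invr_ge0// ler_nat; apply: leq_sum => j _.
by case: (leP (B n j) u) => // h; rewrite (le_trans h uv).
Qed.

(** Summation by parts: both sides are a_0 plus the sum over j of (a_(j+1) - a_j) (1 - B j). *)
Let Q_moment n k : I (fun u => Q n u ^+ k) = L n (fun j => (j%:R / n%:R) ^+ k).
Proof.
rewrite (@unit_step_integral R (fun j => (j%:R / n%:R) ^+ k) (B n))//; last exact: B_nd.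
set a := fun j : nat => _.
have -> : L n a = L n (fun i => a 0%N * 1 + \sum_(j < n) (a j.+1 - a j) * (1 + (-1) * (i <= j)%N%:R)).
  rewrite /L; congr (moment_functional s _); apply: bernstein_eq => i ni.
  have -> : a i = a (\sum_(j < n) (j < i))%N.
    congr a; elim: (n) ni => [|m IH]; first by rewrite leqn0 => /eqP->; rewrite big_ord0.
    rewrite leq_eqVlt => /predU1P[->|im]; last by rewrite big_ord_recr/= -IH//; lia.
    rewrite (eq_bigr (fun=> 1%N)) ?sum1_card ?card_ord// => j _.
    by rewrite ltn_ord.
  rewrite (@telescope_count _ a (fun j => j < i)%N) ?mulr1.
    by congr (_ + _); apply: eq_bigr => j _; rewrite ltnNge; case: (i <= j)%N => /=; ring.
  by move=> j m jm; exact: leq_ltn_trans.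
rewrite LD LZ L1 mulr1; congr (_ + _).
rewrite /L (bernstein_sum n n
  (fun j i : nat => (a j.+1 - a j) * (1 + (-1) * (i <= j)%N%:R))) moment_functional_sum; apply: eq_bigr => j _.
by rewrite -/(L n _) LZ LD L1 LZ mulN1r.
Qed.

Lemma hausdorff_quantile : exists q : R -> R,
  [/\ nondecreasing_fun q, forall u, 0 <= q u <= 1 & forall k, I (fun u => q u ^+ k) = s k].
Proof.
(* Pointwise ultralimits avoid the diagonal extraction of Helly's theorem. *)
have [U [UU subU]] := ultraFilterLemma (eventually_filter : ProperFilter \oo).
have PU : ProperFilter U by exact: ultra_proper.
have /choice[q hq] : forall u, exists p : R, 0 <= p <= 1 /\ (Q ^~ u) @ U --> p.
  move=> u; have [p p01 hp] := ultrafilter_segment_limit UU (Q01^~ u).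
  by exists p.
have q01 u : 0 <= q u <= 1 by have [] := hq u.
have qnd : nondecreasing_fun q.
  move=> u v uv; apply: (ler_cvg_to (proj2 (hq u)) (proj2 (hq v))).
  by apply: nearW => n; exact: Q_nd.
exists q; split => // k.
have Xnd (f : R -> R) : nondecreasing_fun f -> (forall u, 0 <= f u <= 1) ->
    nondecreasing_fun (fun u => f u ^+ k) /\ (forall u, 0 <= f u ^+ k <= 1).
  move=> fnd f01; split=> [u v uv|u].
    have /andP[fu0 _] := f01 u; apply: lerXn2r; rewrite ?nnegrE//; last exact: fnd.
    by have /andP[] := f01 v.
  by have /andP[fu0 fu1] := f01 u; rewrite exprn_ge0//= exprn_ile1.
(* A Riemann sum involves finitely many points, at each of which [Q n] converges along U; the error
   bound does not depend on n and passes to the limit. *)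
have H N : `|s k - left_sum (fun u => q u ^+ k) N| <= N.+1%:R^-1.
  have lQ : (fun n => left_sum (fun u => Q n u ^+ k) N) @ U --> left_sum (fun u => q u ^+ k) N.
    apply: cvgMl; apply: (@cvg_sum_filter R U _ N.+1
      (fun i n => Q n (i%:R / N.+1%:R) ^+ k) (fun i => q (i%:R / N.+1%:R) ^+ k)) => i.
    apply: cvg_exp_filter.
    exact: (proj2 (hq _)).
  have lI : (fun n => I (fun u => Q n u ^+ k)) @ U --> s k.
    have := @bernstein_functional_cvg R s k s_pos.
    rewrite (_ : (fun n => I _) = (fun n => moment_functional s (bernstein n (fun j => (j%:R / n%:R) ^+ k)))).
      by move=> h; apply: cvg_trans h => A hA; exact: subU.
    by apply/funext => n; exact: Q_moment.
  have lN : (fun n => `|I (fun u => Q n u ^+ k) - left_sum (fun u => Q n u ^+ k) N|) @ U -->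
      `|s k - left_sum (fun u => q u ^+ k) N| by apply: cvg_norm; exact: cvgB.
  have cN : (fun _ : nat => N.+1%:R^-1 : R) @ U --> (N.+1%:R^-1 : R) by exact: cvg_cst.
  apply: (ler_cvg_to lN cN).
  apply: nearW => n; have [h1 h2] := Xnd _ (@Q_nd n) (Q01 n).
  exact: left_sum_close.
apply/eqP; rewrite -subr_eq0 -normr_le0; apply/ler_addgt0Pl => e e0; rewrite addr0.
pose N := Num.bound (2 / e).
have [h1 h2] := Xnd _ qnd q01.
have e2 : 0 <= 2 / e by rewrite divr_ge0// ltW.
have hN : 2 < N%:R * e by rewrite -ltr_pdivrMr// archi_boundP.
have -> : I (fun u => q u ^+ k) - s k = (I (fun u => q u ^+ k) - left_sum (fun u => q u ^+ k) N)
   - (s k - left_sum (fun u => q u ^+ k) N) by ring.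
apply: le_trans (ler_normB _ _) _.
apply: le_trans (lerD (left_sum_close N h1 h2) (H N)) _.
have -> : N.+1%:R^-1 + N.+1%:R^-1 = 2 / N.+1%:R :> R by ring.
rewrite ler_pdivrMr//.
by rewrite -[N.+1%:R]natr1 mulrDr; move: hN; lra.
Qed.

End Quantile.

Section HausdorffMoment.
Variable R : realType.
Local Notation D := `[(0 : R), 1]%classic.
Local Notation E := `[(-1 : R), 0]%classic.

(* The image of [S] times the Lebesgue measure of [0, 1] under [- q]. *)
Lemma scaled_quantile_measure (q : R -> R) (S : R) : 0 <= S ->
  nondecreasing_fun q -> (forall u, 0 <= q u <= 1) ->
  exists nu : finite_borel_measure R, concentrated_on nu E /\
    forall k, \int[nu]_(l in E) (- l) ^+ k = S * \int[lebesgue_measure]_(u in D) q u ^+ k.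
Proof.
move=> S0 qnd q01.
pose P : {measure set (measurableTypeR R) -> \bar R} := uniform_prob (@ltr01 R).
pose phi (u : measurableTypeR R) : measurableTypeR R := - q u.
have mq : measurable_fun setT q by exact: nondecreasing_measurable.
have mphi : measurable_fun setT phi by apply: measurableT_comp.
pose SP : {measure set (measurableTypeR R) -> \bar R} := mscale (NngNum S0) P.
pose nu1 : {measure set (measurableTypeR R) -> \bar R} := pushforward SP phi.
pose nu0 := nu1 mphi.
have phiE : phi @^-1` E = setT.
  apply/seteqP; split=> // u _; rewrite /phi /= in_itv/= oppr_le0 lerN2 andbC.
  exact: q01.
have fin : fin_num_fun nu0.
  move=> A mA; rewrite ge0_fin_numE ?measure_ge0//.
  apply: (@le_lt_trans _ _ (nu0 setT)); first by rewrite le_measure ?inE.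
  by rewrite /nu0 /nu1 /= /pushforward preimage_setT /SP /mscale /= probability_setT mule1 ltry.
pose fin_mixin := Measure_isFinite.Build _ _ _ nu0 fin.
pose nu : finite_borel_measure R := HB.pack (nu0 : set _ -> \bar R) nu0 fin_mixin.
exists nu; split.
  rewrite /concentrated_on; have -> : nu (~` E) = SP (phi @^-1` (~` E)) by [].
  have -> : phi @^-1` (~` E) = set0; last exact: measure0.
  apply/seteqP; split=> // u /=; apply.
  by have : (phi @^-1` E) u by rewrite phiE.
move=> k.
have mX : measurable_fun setT (fun l : measurableTypeR R => ((- l) ^+ k)%:E).
  apply/measurable_EFinP; apply: (@measurableT_comp _ _ _ _ _ _ (fun x : R => x ^+ k)) => //.
have mqk : measurable_fun setT (fun u : measurableTypeR R => (q u ^+ k)%:E).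
  by apply/measurable_EFinP; exact: measurable_funX.
have qk0 u : (0 <= (q u ^+ k)%:E)%E by rewrite lee_fin exprn_ge0//; have /andP[] := q01 u.
have -> : \int[nu]_(l in E) (- l) ^+ k =
    fine (\int[SP]_(u in phi @^-1` E) (q u ^+ k)%:E)%E.
  congr fine.
  have := @ge0_integral_pushforward _ _ _ _ _ _ mphi SP E _ (measurable_itv _) (measurable_funTS mX).
  move=> ->; last first.
    by move=> l; rewrite inE/= in_itv/= => /andP[_ l0]; rewrite lee_fin exprn_ge0// oppr_ge0.
  by apply: eq_integral => u _; rewrite /= /phi opprK.
rewrite phiE ge0_integral_mscale// integral_uniform//= subr0 invr1 mul1e.
rewrite fineM//; apply: integrable_fin_num => //.
apply: (@unit_integrable R (fun u => q u ^+ k) 1).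
  by apply: nondecreasing_measurable => // u v uv; apply: lerXn2r (qnd _ _ uv); rewrite nnegrE; [have := q01 u|have := q01 v]; move=> /andP[].
by move=> u; have /andP[q0 q1] := q01 u; rewrite ger0_norm ?exprn_ge0// exprn_ile1.
Qed.

Theorem hausdorff_moment (s : R^nat) :
  (forall k m, 0 <= moment_functional s ('X^k * (1 - 'X) ^+ m)) ->
  exists nu : finite_borel_measure R, concentrated_on nu E /\
    forall k, \int[nu]_(l in E) (- l) ^+ k = s k.
Proof.
move=> s_pos.
have sX k : s k = moment_functional s ('X^k * (1 - 'X) ^+ 0).
  by rewrite expr0 mulr1 moment_functionalXn.
have s0 k : 0 <= s k by rewrite sX.
have sS k : s k.+1 <= s k.
  have := s_pos k 1%N; rewrite expr1 mulrBr mulr1 -exprSr moment_functionalB.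
  by rewrite !moment_functionalXn subr_ge0.
have s_le k : s k <= s 0%N by elim: k => // k; exact: le_trans.
(* The moments decrease, so mass 0 makes all of them vanish; otherwise s is normalized to mass 1. *)
have [S0|S0] := eqVneq (s 0%N) 0.
  have [|u|nu [cnu hnu]] := @scaled_quantile_measure (fun=> 0) 0 (lexx _); first by [].
    by rewrite lexx ler01.
  exists nu; split=> // k; rewrite hnu mul0r; apply/eqP.
  by rewrite eq_le s0 -S0 s_le.
have S_gt0 : 0 < s 0%N by rewrite lt_neqAle eq_sym S0 s0.
pose t k := (s 0%N)^-1 * s k.
have tE p : moment_functional t p = (s 0%N)^-1 * moment_functional s p.
  by rewrite /moment_functional mulr_sumr; apply: eq_bigr => i _; rewrite /t; ring.
have [||q [qnd q01 hq]] := @hausdorff_quantile R t.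
- by move=> k m; rewrite tE mulr_ge0// invr_ge0.
- by rewrite /t mulVf.
have [nu [cnu hnu]] := scaled_quantile_measure (ltW S_gt0) qnd q01.
by exists nu; split=> // k; rewrite hnu hq /t mulrA divff// mul1r.
Qed.

End HausdorffMoment.

(** * Measures are determined by their moments *)

Section BernsteinApproximation.
Variable R : realType.
Implicit Type (h : R -> R).

Lemma bernstein_variance n (x : R) : (0 < n)%N ->
  (bernstein n (fun j => (j%:R / n%:R - x) ^+ 2)).[x] = x * (1 - x) / n%:R.
Proof.
move=> n0; have nn : n%:R != 0 :> R by rewrite pnatr_eq0 -lt0n.
have -> : bernstein n (fun j => (j%:R / n%:R - x) ^+ 2) = bernstein n (fun j =>
    n%:R ^- 2 * (j ^_ 2)%:R + ((n%:R ^- 2 - 2 * x / n%:R) * (j ^_ 1)%:R + x ^+ 2)).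
  apply: bernstein_eq => j _; rewrite ffactn1 ffactnSr ffactn1 natrM.
  have -> : j%:R * (j - 1)%N%:R = j%:R * (j%:R - 1) :> R.
    by case: j => [|j]; rewrite ?mul0r// subn1 /= -natr1 addrK.
  by field.
rewrite !bernsteinD !bernsteinZ !bernstein_ffact bernstein_cst.
rewrite !(hornerD, hornerZ, hornerXn, hornerC) ffactn1 ffactnSr ffactn1 natrM natrB//.
by field.
Qed.

(** Chebyshev's argument: |y| <= e + y^2 / e bounds the oscillation of h by a quantity whose
    binomial mean is known from the variance. *)
Lemma bernstein_lipschitz h (K e x : R) n : 0 <= K ->
  (forall x y, `|h x - h y| <= K * `|x - y|) -> 0 <= x <= 1 -> 0 < e -> (0 < n)%N ->
  `|(bernstein n (fun j => h (j%:R / n%:R))).[x] - h x| <= K * (e + (e * n%:R)^-1).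
Proof.
move=> K0 hK x01 e0 n0; set T := fun g => (bernstein n g).[x].
have TD g g' : T (fun j => g j + g' j) = T g + T g' by rewrite /T bernsteinD hornerD.
have TZ r g : T (fun j => r * g j) = r * T g by rewrite /T bernsteinZ hornerZ.
have T1 r : T (fun=> r) = r by rewrite /T bernstein_cst hornerC.
have T_le g g' : (forall j, g j <= g' j) -> T g <= T g'.
  move=> gg'; rewrite -subr_ge0 -mulN1r -TZ -TD; apply: bernstein_ge0 => // j _.
  by rewrite mulN1r subr_ge0.
have nr : 0 < n%:R :> R by rewrite ltr0n.
pose v j := K * (e + e^-1 * (j%:R / n%:R - x) ^+ 2).
have Tv : T v <= K * (e + (e * n%:R)^-1).
  rewrite /v TZ TD T1 TZ ler_wpM2l// lerD2l invfM ler_wpM2l ?invr_ge0 ?(ltW e0)//.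
  rewrite /T bernstein_variance// ler_pdivrMr// mulVf ?gt_eqF//.
  by case/andP: x01 => *; nra.
have hv j : `|h (j%:R / n%:R) - h x| <= v j.
  apply: le_trans (hK _ _) _; rewrite ler_wpM2l// -(real_normK (num_real (_ - x))).
  set y := `|_|; have y0 : 0 <= y by exact: normr_ge0.
  rewrite -(ler_pM2l e0) mulrDr mulrA divff ?gt_eqF// mul1r; nra.
pose hn j := h (j%:R / n%:R).
have lo : h x <= T hn + T v.
  rewrite -(T1 (h x)) -TD; apply: T_le => j.
  by have := hv j; rewrite ler_norml => /andP[]; rewrite /hn; lra.
have hi : T hn <= h x + T v.
  rewrite -(T1 (h x)) -TD; apply: T_le => j.
  by have := hv j; rewrite ler_norml => /andP[]; rewrite /hn; lra.
by rewrite -/hn -/(T hn) ler_norml; apply/andP; split; lra.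
Qed.

Lemma lipschitz_continuous_segment h (K a b : R) : 0 <= K ->
  (forall x y, `|h x - h y| <= K * `|x - y|) -> continuous_on_segment a b h.
Proof.
move=> K0 hK l _; apply/cvgrPdist_le => e e0.
have K1 : 0 < K + 1 by rewrite ltr_wpDl.
exists (e / (K + 1)); first by rewrite /= divr_gt0.
move=> y /= /ltW ly; apply: le_trans (hK _ _) _.
apply: (@le_trans _ _ ((K + 1) * `|l - y|)); first by rewrite ler_wpM2r// lerDl.
by rewrite mulrC -ler_pdivlMr.
Qed.

End BernsteinApproximation.

Section MomentUniqueness.
Variables (R : realType) (mu nu : finite_borel_measure R).
Local Notation D := `[(-1 : R), 1]%classic.
Hypothesis mu_nu : forall k, \int[mu]_(l in D) l ^+ k = \int[nu]_(l in D) l ^+ k.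

Let horner_integral (p : {poly R}) : \int[mu]_(l in D) p.[l] = \int[nu]_(l in D) p.[l].
Proof.
have E (m : finite_borel_measure R) :
    \int[m]_(l in D) p.[l] = \sum_(i < size p) p`_i * \int[m]_(l in D) l ^+ i.
  rewrite (@segment_eq _ _ _ _ _ (fun l => \sum_(i < size p) p`_i * l ^+ i)); last first.
    by move=> l _; rewrite horner_coef.
  rewrite (@segment_sum _ _ _ _ _ (fun i l => p`_i * l ^+ i)); last first.
    by move=> i; apply: contM; [exact: cont_cst|apply: contX; exact: cont_id].
  by apply: eq_bigr => i _; rewrite segmentZ//; apply: contX; exact: cont_id.
by rewrite !E; apply: eq_bigr => i _; rewrite mu_nu.
Qed.

Let horner_cont (p : {poly R}) : continuous_on_segment (-1) 1 (fun l => p.[l]).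
Proof. by move=> l _; exact: continuous_horner. Qed.

Lemma lipschitz_integral_eq h (K : R) : 0 <= K ->
  (forall x y, `|h x - h y| <= K * `|x - y|) ->
  \int[mu]_(l in D) h l = \int[nu]_(l in D) h l.
Proof.
move=> K0 hK.
have ch : continuous_on_segment (-1) 1 h := lipschitz_continuous_segment K0 hK.
pose H (x : R) := h (2 * x - 1).
have HK x y : `|H x - H y| <= 2 * K * `|x - y|.
  apply: le_trans (hK _ _) _.
  have -> : 2 * x - 1 - (2 * y - 1) = 2 * (x - y) by ring.
  by rewrite normrM (ger0_norm (ler0n _ 2)) mulrA [K * 2]mulrC.
have approx (e : R) : 0 < e -> exists p : {poly R}, forall l, -1 <= l <= 1 ->
    `|p.[l] - h l| <= 4 * K * e.
  move=> e0; have e2 : 0 < e ^- 2 by rewrite invr_gt0 exprn_gt0.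
  (* With n >= e^(-2) one has (e n)^-1 <= e, so the Bernstein bound, with Lipschitz constant 2 K on
     [0, 1], becomes 2 K (e + e). *)
  have [n n0 hn] : exists2 n, (0 < n)%N & e ^- 2 <= n%:R.
    exists (Num.bound (e ^- 2)).+1 => //; apply: ltW.
    by apply: lt_le_trans (archi_boundP (ltW e2)) _; rewrite ler_nat.
  exists (bernstein n (fun j => H (j%:R / n%:R)) \Po (2^-1%:P * (1 + 'X))) => l hl.
  rewrite horner_comp !hornerE.
  have -> : h l = H (2^-1 * (1 + l)) by rewrite /H; congr h; field.
  have K2 : 0 <= 2 * K by rewrite mulr_ge0.
  have l01 : 0 <= 2^-1 * (1 + l) <= 1 by case/andP: hl => *; apply/andP; split; lra.
  apply: le_trans (bernstein_lipschitz K2 HK l01 e0 n0) _.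
  rewrite (_ : 4 * K * e = 2 * K * (e + e)); last by ring.
  rewrite ler_wpM2l// lerD2l invfM -ler_pdivlMl ?invr_gt0// invrK.
  rewrite -[e * e]expr2 -[leRHS]invrK lef_pV2 ?posrE ?ltr0n//.
pose M := fine (mu D) + fine (nu D).
have M0 : 0 <= M by rewrite addr_ge0// fine_ge0.
have B (e : R) : 0 < e -> `|\int[mu]_(l in D) h l - \int[nu]_(l in D) h l| <= 4 * K * e * M.
  move=> e0; have [p hp] := approx e e0.
  have cd : continuous_on_segment (-1) 1 (fun l => p.[l] - h l).
    by apply: contD => //; exact: contN.
  have -> : \int[mu]_(l in D) h l - \int[nu]_(l in D) h l =
      \int[nu]_(l in D) (p.[l] - h l) - \int[mu]_(l in D) (p.[l] - h l).
    by rewrite !segmentB// horner_integral; ring.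
  apply: le_trans (ler_normB _ _) _.
  rewrite /M mulrDr addrC; apply: lerD; exact: segment_abs_le.
apply/eqP; rewrite -subr_eq0 -normr_le0; apply/ler_addgt0Pl => e e0; rewrite addr0.
pose C := 4 * K * M + 1.
have C0 : 0 < C by rewrite ltr_wpDl// !mulr_ge0.
apply: le_trans (B (e / C) (divr_gt0 e0 C0)) _.
rewrite mulrAC mulrA ler_pdivrMr// mulrC ler_pM2l// /C.
by rewrite lerDl.
Qed.

End MomentUniqueness.

Section RampComparison.
Variable R : realType.
Local Notation D := `[(-1 : R), 1]%classic.

Let clamp (x : R) := Num.max 0 (Num.min 1 x).

Let clamp_lip x y : `|clamp x - clamp y| <= `|x - y|.
Proof.
have := ler_norm (x - y); have := ler_norm (y - x); rewrite distrC ler_norml.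
move: `|x - y| => z h1 h2; rewrite /clamp /Num.max /Num.min.
by case: (ltP 1 x) => hx; case: (ltP 1 y) => hy; rewrite ?ltr01;
  do 2 ?[case: ltP => ?]; apply/andP; split; lra.
Qed.

(** A ramp of slope [m.+1] lies between the indicators of the two rays; being Lipschitz, it has the
    same integral for both measures. *)
Lemma ray_le (mu nu : finite_borel_measure R) (t : R) m : concentrated_on mu D ->
  concentrated_on nu D ->
  (forall k, \int[mu]_(l in D) l ^+ k = \int[nu]_(l in D) l ^+ k) ->
  (mu `[t, +oo[%classic <= nu `[(t - m.+1%:R^-1)%R, +oo[%classic)%E.
Proof.
move=> cmu cnu munu.
have rayE (m0 : finite_borel_measure R) (r : R) : concentrated_on m0 D ->
    m0 `[r, +oo[%classic = (\int[m0]_(l in D) (\1_(`[r, +oo[%classic) l)%:E)%E.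
  move=> cm; rewrite integral_indic//=.
  have mr : measurable (`[r, +oo[%classic : set (measurableTypeR R)) by [].
  have mD : measurable (D : set (measurableTypeR R)) by [].
  rewrite -[in LHS](setIT `[r, +oo[%classic) -(setUv D) setIUr.
  rewrite measureU0//.
  - exact: measurableI.
  - by apply: measurableI => //; exact: measurableC.
  - apply: subset_measure0 cm => //; last exact: measurableC.
    by apply: measurableI => //; exact: measurableC.
pose h l := clamp (1 + m.+1%:R * (l - t)).
have hK x y : `|h x - h y| <= m.+1%:R * `|x - y|.
  apply: le_trans (clamp_lip _ _) _.
  have -> : 1 + m.+1%:R * (x - t) - (1 + m.+1%:R * (y - t)) = m.+1%:R * (x - y) by ring.
  by rewrite normrM ger0_norm.
have h0 l : 0 <= h l by rewrite /h /clamp le_max lexx.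
have hE (m0 : finite_borel_measure R) :
    (\int[m0]_(l in D) (h l)%:E)%E = (\int[m0]_(l in D) h l)%:E.
  have ch := @lipschitz_continuous_segment _ _ _ (-1) 1 (ler0n R m.+1) hK.
  by rewrite fineK//; apply: integrable_fin_num => //; exact: segment_integrable.
have mh (m0 : finite_borel_measure R) : measurable_fun D (fun l => (h l)%:E).
  have ch := @lipschitz_continuous_segment _ _ _ (-1) 1 (ler0n R m.+1) hK.
  exact: measurable_int (segment_integrable m0 ch).
have mI (r : R) : measurable_fun D (fun l : R => (\1_(`[r, +oo[%classic) l : R)%:E).
  by apply/measurable_EFinP; exact: measurable_indic.
apply: (@le_trans _ _ (\int[mu]_(l in D) (h l)%:E)%E).
  rewrite rayE//; apply: ge0_le_integral => //.
  - exact: mI.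
  - exact: mh.
  - move=> l _; rewrite lee_fin indicE mem_setE in_itv/= andbT.
    case: (leP t l) => // tl; rewrite /h /clamp le_max le_min lexx/= lerDl.
    by rewrite mulr_ge0 ?subr_ge0// orbT.
rewrite hE (lipschitz_integral_eq munu (ler0n R m.+1) hK) -hE rayE//.
apply: ge0_le_integral => //.
- by move=> l _; rewrite lee_fin.
- exact: mh.
- exact: mI.
- move=> l _; rewrite lee_fin indicE mem_setE in_itv/= andbT.
  case: (leP _ l) => tl; first by rewrite /h /clamp ge_max ler01 ge_min lexx.
  rewrite /h /clamp ge_max lexx ge_min; apply/orP; right.
  have : m.+1%:R * (l - t) <= m.+1%:R * (- m.+1%:R^-1).
    by rewrite ler_wpM2l// lerBlDl; exact: ltW.
  by rewrite mulrN divff ?pnatr_eq0// => hl; rewrite addrC -lerBrDr sub0r.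
Qed.

Theorem moments_determine_measure (mu nu : finite_borel_measure R) :
  concentrated_on mu D -> concentrated_on nu D ->
  (forall k, \int[mu]_(l in D) l ^+ k = \int[nu]_(l in D) l ^+ k) -> same_measure mu nu.
Proof.
move=> cmu cnu munu.
have le (m1 m2 : finite_borel_measure R) (t : R) :
    (forall m : nat, m1 `[t, +oo[%classic <= m2 `[(t - m.+1%:R^-1)%R, +oo[%classic)%E ->
    (m1 `[t, +oo[%classic <= m2 `[t, +oo[%classic)%E.
  move=> h.
  (* The closed ray is the decreasing intersection of the widened rays, so the loss in [ray_le]
     disappears by continuity from above. *)
  have capE : \bigcap_m `[(t - m.+1%:R^-1)%R, +oo[%classic = `[t, +oo[%classic :> set R.
    apply/seteqP; split=> l /=.
      move=> hl; rewrite in_itv/= andbT; apply/ler_addgt0Pl => e e0.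
      have [N hN] : exists N : nat, N.+1%:R^-1 <= e.
        exists (Num.bound e^-1); rewrite invf_ple ?posrE//; apply: ltW.
        apply: lt_le_trans (archi_boundP _) _; first by rewrite invr_ge0 ltW.
        by rewrite ler_nat.
      have := hl N I; rewrite /= in_itv/= andbT lerBlDr addrC => /le_trans; apply.
      by rewrite lerD2r.
    rewrite in_itv/= andbT => tl m _; rewrite /= in_itv/= andbT.
    by apply: le_trans tl; rewrite gerBl.
  have cvg : (m2 \o (fun m => `[(t - m.+1%:R^-1)%R, +oo[%classic)) @ \oo -->
      m2 (\bigcap_m `[(t - m.+1%:R^-1)%R, +oo[%classic).
    apply: nonincreasing_cvg_mu.
    - by rewrite -ge0_fin_numE// fin_num_measure.
    - by move=> i.
    - by apply: bigcapT_measurable => i.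
    - move=> i j ij; apply/subsetPset => l /=; rewrite !in_itv/= !andbT.
      apply: le_trans; rewrite lerD2l lerN2 lef_pV2 ?posrE// ler_nat ltnS//.
  rewrite -capE -(cvg_lim _ cvg)//; apply: lime_ge; first by apply/cvg_ex; exists (m2 (\bigcap_m `[(t - m.+1%:R^-1)%R, +oo[%classic)).
  by apply: nearW => m; rewrite capE; exact: h.
move=> A; apply: (@measure_unique _ R (measurableTypeR R) (@RGenCInfty.G R)
  (fun k => `[- k%:R, +oo[%classic) _ _ _ _ mu nu).
- exact: RGenCInfty.measurableE.
- move=> _ _ [x ->] [y ->]; exists (Num.max x y); apply/seteqP; split=> l /=;
    rewrite !in_itv/= !andbT ge_max; last by move=> /andP[].
  by move=> [-> ->].
- by move=> k; exists (- k%:R).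
- apply/seteqP; split=> // l _; exists (Num.bound `|l : R|) => //=.
  rewrite in_itv/= andbT; apply: lerNnormlW; apply: ltW; exact: archi_boundP.
- move=> _ [t ->]; apply/eqP; rewrite eq_le; apply/andP; split; apply: le => m.
    exact: ray_le.
  by apply: ray_le => // k; rewrite munu.
- by move=> k; rewrite -ge0_fin_numE// fin_num_measure.
Qed.

End RampComparison.

(** * Integral representations *)

Section MomentRepresentations.
Variable R : realType.
Local Notation D := `[(-1 : R), 1]%classic.
Local Notation E := `[(-1 : R), 0]%classic.
Implicit Types (mu nu : finite_borel_measure R) (f g : R -> R).

Lemma pseries_unique (c d : R^nat) f :
  (forall x : R, -1 < x < 1 -> pseries c x @ \oo --> f x) ->
  (forall x : R, -1 < x < 1 -> pseries d x @ \oo --> f x) -> c = d.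
Proof.
move=> hc hd; apply/funext => k.
have k0 : k`!%:R != 0 :> R by rewrite pnatr_eq0 -lt0n fact_gt0.
apply: (mulfI k0).
rewrite -(@pseries_derive1n0 R c 1 f ltr01) -?(@pseries_derive1n0 R d 1 f ltr01)//.
- by move=> x; rewrite ltr_norml; exact: hd.
- by move=> x; rewrite ltr_norml; exact: hc.
Qed.

Lemma pseries_cvg_eq (c d : R^nat) (x l : R) : c =1 d ->
  pseries c x @ \oo --> l -> pseries d x @ \oo --> l.
Proof. by move=> /funext ->. Qed.

Lemma pseries_cvgN (c : R^nat) (x l : R) :
  pseries c x @ \oo --> l -> pseries (fun k => - c k) x @ \oo --> - l.
Proof.
move=> h; have -> : pseries (fun k => - c k) x = (fun n => - pseries c x n).
  apply/funext => n; rewrite /pseries /series /= -sumrN; apply: eq_bigr => k _.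
  by rewrite mulNr.
exact: cvgN.
Qed.

Lemma concentrated_integral mu g : concentrated_on mu E ->
  continuous_on_segment (-1) 1 g -> \int[mu]_(l in D) g l = \int[mu]_(l in E) g l.
Proof.
move=> muE cg.
have mE : measurable (E : set (measurableTypeR R)) by [].
have mD : measurable (D : set (measurableTypeR R)) by [].
have ED : E `<=` D.
  by move=> l; rewrite /= !in_itv/= => /andP[-> /le_trans->].
have mN : measurable (D `\` E : set (measurableTypeR R)) by exact: measurableD.
have N0 : mu (D `\` E) = 0%E.
  by apply: subset_measure0 muE => //; exact: measurableC.
rewrite /Rintegral; congr fine.
rewrite (negligible_integral mN mD (segment_integrable mu cg) N0).
by rewrite setDD setIidr.
Qed.

Lemma concentrated_segment mu : concentrated_on mu E -> concentrated_on mu D.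
Proof.
move=> muE; apply: subset_measure0 muE => //; [exact: measurableC..|].
by apply: subsetC => l; rewrite /= !in_itv/= => /andP[-> /le_trans->].
Qed.

Lemma segment_power_cont (a b : R) k : continuous_on_segment a b (fun l => l ^+ k).
Proof. by apply: contX; exact: cont_id. Qed.

Lemma segment_inv_cont (a b x : R) : -1 <= a -> b <= 1 -> -1 < x < 1 ->
  continuous_on_segment a b (fun l : R => (1 - l * x)^-1).
Proof.
move=> a1 b1 /andP[x1 x2]; apply: contV.
  apply: contD; first exact: cont_cst.
  by apply: contN; apply: contM; [exact: cont_id|exact: cont_cst].
move=> l /andP[al lb]; rewrite gt_eqF// subr_gt0.
apply: le_lt_trans (ler_norm _) _; rewrite normrM.
apply: (@le_lt_trans _ _ `|x|); last by rewrite ltr_norml x1.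
by rewrite ler_piMl// ler_norml (le_trans a1 al) (le_trans lb b1).
Qed.

Lemma geometric_pseries mu f (b : R) : b <= 1 ->
  (forall x : R, -1 < x < 1 -> f x = f 0 - \int[mu]_(l in `[-1, b]) (x / (1 - l * x))) ->
  forall x : R, -1 < x < 1 ->
    pseries (fun k => if k is k'.+1 then - \int[mu]_(l in `[-1, b]) l ^+ k' else f 0) x @ \oo
      --> f x.
Proof.
move=> b1 hf x x1; rewrite (hf x x1).
have -> : \int[mu]_(l in `[-1, b]) (x / (1 - l * x)) =
    x * \int[mu]_(l in `[-1, b]) (1 / (1 - l * x)).
  rewrite -segmentZ; last first.
    by apply: contM; [exact: cont_cst|exact: segment_inv_cont].
  by apply: segment_eq => l _; rewrite mul1r.
rewrite -mulrN.
apply: (@pseries_shift _ (fun k => if k is k'.+1 then - \int[mu]_(l in `[-1, b]) l ^+ k' else f 0)).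
apply: pseries_cvg_eq (pseries_cvgN
  (@segment_geometric R mu (-1) b (fun=> 1) x (lexx _) b1 (@cont_cst _ _ _ _) x1)) => k.
by congr (- _); apply: segment_eq => l _; exact: mul1r.
Qed.

(* The moments of [w mu], realized without densities. *)
Lemma hausdorff_weighted mu (w : R -> R) : continuous_on_segment (-1) 0 w ->
  (forall l, -1 <= l <= 0 -> 0 <= w l) ->
  exists nu, concentrated_on nu E /\
    forall k, \int[nu]_(l in E) l ^+ k = \int[mu]_(l in E) (w l * l ^+ k).
Proof.
move=> cw w0.
have cN : continuous_on_segment (-1) (0 : R) (fun l => - l) by apply: contN; exact: cont_id.
pose s k := \int[mu]_(l in E) (w l * (- l) ^+ k).
have sE p : moment_functional s p = \int[mu]_(l in E) (w l * p.[- l]).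
  rewrite (@segment_eq _ _ _ _ _ (fun l => \sum_(i < size p) p`_i * (w l * (- l) ^+ i))).
    rewrite (@segment_sum _ _ _ _ _ (fun i l => p`_i * (w l * (- l) ^+ i))).
      by apply: eq_bigr => i _; rewrite segmentZ//; apply: contM => //; exact: contX.
    by move=> i; apply: contM; [exact: cont_cst|apply: contM => //; exact: contX].
  by move=> l _; rewrite horner_coef mulr_sumr; apply: eq_bigr => i _; ring.
have [|nu [nuE hnu]] := @hausdorff_moment R s.
  move=> k m; rewrite sE; apply: segment_ge0 => l hl; rewrite mulr_ge0 ?w0//.
  case/andP: hl => l1 l0; rewrite hornerM hornerXn horner_exp !hornerE.
  by rewrite mulr_ge0// exprn_ge0//; lra.
exists nu; split=> // k.
have -> : \int[nu]_(l in E) l ^+ k = (-1) ^+ k * \int[nu]_(l in E) (- l) ^+ k.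
  rewrite -segmentZ; last exact: contX.
  by apply: segment_eq => l _; rewrite -exprMn mulN1r opprK.
rewrite hnu /s -segmentZ; last by apply: contM => //; exact: contX.
by apply: segment_eq => l _; rewrite mulrCA -exprMn mulN1r opprK.
Qed.

Lemma ocm_moment_measure f : operator_completely_monotone (-1) 1 f ->
  exists nu, concentrated_on nu E /\
    forall x : R, -1 < x < 1 -> f x = f 0 - \int[nu]_(l in E) (x / (1 - l * x)).
Proof.
move=> ocm; have cm := ocm_completely_monotone ocm.
pose c k := f^`(k)%classic 0 / k`!%:R.
have hc (x : R) : -1 < x < 1 -> pseries c x @ \oo --> f x.
  exact: (completely_monotone_pseries ocm.1 cm).
have [nu [nuE hnu]] := hausdorff_moment (ocm_hausdorff ocm hc).
exists nu; split=> // x x1; apply: cvgn_unique (hc x x1) _.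
have c0 : c 0%N = f 0 by rewrite /c fact0 divr1.
rewrite -c0.
have -> : \int[nu]_(l in E) (x / (1 - l * x)) = x * \int[nu]_(l in E) (1 / (1 - l * x)).
  rewrite -segmentZ; last first.
    by apply: contM; [exact: cont_cst|apply: segment_inv_cont].
  by apply: segment_eq => l _; rewrite mul1r.
rewrite -mulrN; apply: pseries_shift.
apply: pseries_cvg_eq (pseries_cvgN
  (@segment_geometric R nu (-1) 0 (fun=> 1) x (lexx _) ler01 (@cont_cst _ _ _ _) x1)) => k.
have -> : \int[nu]_(l in E) (1 * l ^+ k) = (-1) ^+ k * \int[nu]_(l in E) (- l) ^+ k.
  rewrite -segmentZ; last by apply: contX; apply: contN; exact: cont_id.
  by apply: segment_eq => l _; rewrite -exprMn mulN1r opprK mul1r.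
by rewrite hnu [(-1) ^+ k.+1]exprS mulN1r mulNr mulrN opprK mulrA -expr2 sqrr_sign mul1r.
Qed.

(** [mu] plays the part of nu / (1 - l), and the value at x = 0 forces beta = f 0 - mu[-1, 0]. *)
Lemma integral_expression_exists f nu : concentrated_on nu E ->
  (forall x : R, -1 < x < 1 -> 0 <= f x) ->
  (forall x : R, -1 < x < 1 -> f x = f 0 - \int[nu]_(l in E) (x / (1 - l * x))) ->
  exists beta mu, integral_expression f beta mu.
Proof.
move=> nuE f0 hf.
have c1 : continuous_on_segment (-1) (0 : R) (fun l => (1 - l)^-1).
  apply: contV; first by apply: contD; [exact: cont_cst|apply: contN; exact: cont_id].
  by move=> l /andP[_ l0]; rewrite gt_eqF//; lra.
have [|mu [muE hmu]] := @hausdorff_weighted nu _ c1.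
  by move=> l /andP[_ l0]; rewrite invr_ge0; lra.
have hm k : \int[mu]_(l in E) ((1 - l) * l ^+ k) = \int[nu]_(l in E) l ^+ k.
  rewrite (@segment_eq _ _ _ _ _ (fun l => l ^+ k - l ^+ k.+1)); last first.
    by move=> l _; rewrite exprS; ring.
  rewrite segmentB ?hmu -?segmentB; try exact: segment_power_cont;
    try (by apply: contM => //; exact: segment_power_cont).
  by apply: segment_eq => l /andP[_ l0]; rewrite exprS; field; rewrite gt_eqF//; lra.
have cx x : -1 < x < 1 -> continuous_on_segment (-1) 0 (fun l : R => (1 - l * x)^-1).
  by move=> x1; apply: segment_inv_cont.
have cl : continuous_on_segment (-1) (0 : R) (fun l => 1 - l).
  by apply: contD; [exact: cont_cst|apply: contN; exact: cont_id].
have key x : -1 < x < 1 ->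
    \int[mu]_(l in E) ((1 - l) / (1 - l * x)) = \int[nu]_(l in E) (1 / (1 - l * x)).
  move=> x1.
  have h1 := @segment_geometric R mu (-1) 0 _ x (lexx _) ler01 cl x1.
  have h2 := @segment_geometric R nu (-1) 0 (fun=> 1) x (lexx _) ler01 (@cont_cst _ _ _ _) x1.
  apply: cvgn_unique h1 _; apply: pseries_cvg_eq h2 => k.
  by rewrite hm; apply: segment_eq => l _; rewrite mul1r.
pose M := fine (mu E).
have M0 : 0 <= M by rewrite fine_ge0.
have fE x : -1 < x < 1 -> f x = f 0 - M + \int[mu]_(l in E) ((1 - x) / (1 - l * x)).
  move=> x1; have /andP[x2 x3] := x1.
  have -> : \int[mu]_(l in E) ((1 - x) / (1 - l * x)) = M - x * \int[nu]_(l in E) (1 / (1 - l * x)).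
    rewrite -key// /M -segment_mass -segmentZ; last by apply: contM => //; exact: cx.
    rewrite -segmentB; [|exact: cont_cst|]; last first.
      by apply: contM; [exact: cont_cst|apply: contM => //; exact: cx].
    apply: segment_eq => l /andP[l1 l0]; field; rewrite gt_eqF//; nra.
  rewrite hf// -segmentZ; last by apply: contM; [exact: cont_cst|exact: cx].
  rewrite [X in _ - X](@segment_eq _ _ _ _ _ (fun l => x * (1 / (1 - l * x)))); first by ring.
  by move=> l _; rewrite mul1r.
exists (f 0 - M), mu; split=> //.
rewrite leNgt; apply/negP => b0.
pose b := M - f 0; have b_gt0 : 0 < b by rewrite /b; lra.
have M1 : 0 < M + 1 by lra.
(* Since 1 / (1 - l x) <= 1 for l <= 0 < x, the integral is at most (1 - x) M. This x makes it
   smaller than b, hence f x < 0; the cap 1 / 2 keeps x positive. *)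
pose x := 1 - Num.min (1 / 2) (b / (2 * (M + 1))).
have hx : 0 < x < 1 /\ (1 - x) * M < b.
  have d0 : 0 < b / (2 * (M + 1)) by rewrite divr_gt0// mulr_gt0.
  have e1 : 1 - x <= 1 / 2 by rewrite /x opprB addrC subrK ge_min lexx.
  have e2 : 1 - x <= b / (2 * (M + 1)) by rewrite /x opprB addrC subrK ge_min lexx orbT.
  have e3 : 0 < 1 - x by rewrite /x opprB addrC subrK lt_min d0 andbT; lra.
  split; first by apply/andP; split; lra.
  have : b / (2 * (M + 1)) * (2 * (M + 1)) = b by rewrite divfK// mulf_neq0// gt_eqF.
  nra.
case: hx => /andP[x0 x1] hx.
have x11 : -1 < x < 1 by apply/andP; split; lra.
have := f0 x x11; rewrite fE//.
have : \int[mu]_(l in E) ((1 - x) / (1 - l * x)) <= (1 - x) * M.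
  rewrite /M -segment_mass -segmentZ; last exact: cont_cst.
  apply: segment_le.
  - by apply: contM; [exact: cont_cst|exact: cx].
  - exact: cont_cst.
  - move=> l /andP[l1 l0]; rewrite ler_wpM2l; [by []|lra|].
    by rewrite invf_le1; nra.
by move: hx; rewrite /b; lra.
Qed.

Lemma integral_expression_unique f beta beta' mu nu : integral_expression f beta mu ->
  integral_expression f beta' nu -> same_measure nu mu.
Proof.
move=> emu enu.
have [_ muE _] := emu; have [_ nuE _] := enu.
(* Only the coefficients of positive order are compared below, since these do not involve beta and
   beta'. *)
have /funeqP cE := pseries_unique (integral_expression_pseries emu) (integral_expression_pseries enu).
(* The moments of [(1 - l) mu] and [(1 - l) nu] agree, so [d] is constant; it
   vanishes because the sums [\sum_(k < N) l ^+ k] are bounded for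
   [-1 <= l <= 0]. *)
pose d k := \int[mu]_(l in E) l ^+ k - \int[nu]_(l in E) l ^+ k.
have dS k : d k.+1 = d k.
  have := cE k.+1; move=> /oppr_inj.
  have H (m : finite_borel_measure R) :
      \int[m]_(l in E) ((1 - l) * l ^+ k) = \int[m]_(l in E) l ^+ k - \int[m]_(l in E) l ^+ k.+1.
    rewrite -segmentB; try exact: segment_power_cont.
    by apply: segment_eq => l _; rewrite exprS; ring.
  by rewrite !H /d; lra.
have d0 k : d k = d 0%N by elim: k => // k IH; rewrite dS.
have geo N (l : R) : -1 <= l <= 0 -> `|\sum_(k < N) l ^+ k| <= 1.
  move=> /andP[l1 l0].
  have : 0 <= \sum_(k < N) l ^+ k <= 1.
    elim: N => [|N /andP[h1 h2]]; first by rewrite big_ord0 lexx ler01.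
    rewrite big_ord_recl expr0.
    have -> : \sum_(i < N) l ^+ (lift ord0 i) = l * \sum_(k < N) l ^+ k.
      by rewrite mulr_sumr; apply: eq_bigr => i _; rewrite -exprS.
    by apply/andP; split; nra.
  by move=> /andP[h1 h2]; rewrite ger0_norm.
pose M := fine (mu E) + fine (nu E).
have Nd N : `|N%:R * d 0%N| <= M.
  have -> : N%:R * d 0%N = \int[mu]_(l in E) (\sum_(k < N) l ^+ k) - \int[nu]_(l in E) (\sum_(k < N) l ^+ k).
    rewrite (@segment_sum _ mu _ _ _ (fun k l => l ^+ k)); last by move=> k; exact: segment_power_cont.
    rewrite (@segment_sum _ nu _ _ _ (fun k l => l ^+ k)); last by move=> k; exact: segment_power_cont.
    rewrite -sumrB (eq_bigr (fun=> d 0%N)) => [|k _]; last by rewrite -(d0 k).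
    by rewrite sumr_const card_ord mulr_natl.
  have cs : continuous_on_segment (-1) (0 : R) (fun l => \sum_(k < N) l ^+ k).
    by apply: (@cont_sum _ _ _ _ (fun k l => l ^+ k)) => k; exact: segment_power_cont.
  apply: le_trans (ler_normB _ _) _; apply: lerD.
    by rewrite -[leRHS]mul1r; apply: segment_abs_le => // l; exact: geo.
  by rewrite -[leRHS]mul1r; apply: segment_abs_le => // l; exact: geo.
have dz : d 0%N = 0.
  apply/eqP; apply/negPn/negP => dn0.
  have dpos : 0 < `|d 0%N| by rewrite normr_gt0.
  have M0 : 0 <= M by rewrite addr_ge0// fine_ge0.
  have h : 0 <= M / `|d 0%N| by rewrite divr_ge0.
  have := Nd (Num.bound (M / `|d 0%N|)); rewrite normrM ger0_norm// leNgt.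
  by rewrite -ltr_pdivrMr// archi_boundP.
apply: moments_determine_measure; [exact: concentrated_segment..|move=> k].
rewrite !concentrated_integral//; try exact: segment_power_cont.
by apply/esym/eqP; rewrite -subr_eq0 -/(d k) d0 dz.
Qed.

(** The kernel is the difference x / (1 - l x) - a / (1 - l a), so the base point 0 gives all
    others. For uniqueness, the power series at 0 of any representation has the moments of its
    measure as coefficients. *)
Lemma represents_from_zero f nu : concentrated_on nu E ->
  (forall x : R, -1 < x < 1 -> f x = f 0 - \int[nu]_(l in E) (x / (1 - l * x))) ->
  representing_measure (fun x => - f x) nu.
Proof.
move=> nuE hf; split.
  split=> [|a x a1 x1]; first exact: concentrated_segment.
  have ci y : -1 < y < 1 -> continuous_on_segment (-1) 1 (fun l : R => (1 - l * y)^-1).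
    by move=> y1; exact: segment_inv_cont.
  have cE y : -1 < y < 1 -> continuous_on_segment (-1) 0 (fun l : R => y / (1 - l * y)).
    by move=> y1; apply: contM; [exact: cont_cst|exact: segment_inv_cont].
  rewrite concentrated_integral//; last first.
    have -> : (fun l : R => (x - a) / ((1 - l * x) * (1 - l * a))) =
        (fun l : R => (x - a) * ((1 - l * x)^-1 * (1 - l * a)^-1)).
      by apply/funext => l; rewrite invfM.
    apply: contM; first exact: cont_cst.
    by apply: contM; exact: ci.
  rewrite (@segment_eq _ _ _ _ _ (fun l => x / (1 - l * x) - a / (1 - l * a))).
    by rewrite segmentB; [rewrite (hf x)// (hf a)//; ring|exact: cE..].
  move=> l /andP[l1 l0]; case/andP: a1 => a1 a2; case/andP: x1 => x1 x2.
  by field; rewrite !gt_eqF//; nra.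
move=> nu' [nu'D h'].
have hf' x : -1 < x < 1 -> f x = f 0 - \int[nu']_(l in D) (x / (1 - l * x)).
  move=> x1; have z1 : -1 < (0 : R) < 1 by rewrite ltrN10 ltr01.
  have := h' 0 x z1 x1.
  rewrite (@segment_eq _ nu' _ _ _ (fun l => x / (1 - l * x))); first by lra.
  by move=> l _; rewrite subr0 mulr0 subr0 mulr1.
have c1 := geometric_pseries (lexx _) hf'.
have c2 := geometric_pseries ler01 hf.
have /funeqP cE := pseries_unique c1 c2.
apply: moments_determine_measure => //; first exact: concentrated_segment.
move=> k; have /oppr_inj -> := cE k.+1.
by rewrite concentrated_integral//; exact: segment_power_cont.
Qed.

Lemma representing_measure_zero f nu : represents (fun x => - f x) nu -> concentrated_on nu E ->
  forall x : R, -1 < x < 1 -> f x = f 0 - \int[nu]_(l in E) (x / (1 - l * x)).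
Proof.
move=> [_ h] nuE x x1.
have z1 : -1 < (0 : R) < 1 by rewrite ltrN10 ltr01.
have := h 0 x z1 x1.
rewrite (@segment_eq _ nu _ _ _ (fun l => x / (1 - l * x))).
  rewrite concentrated_integral//; first by lra.
  by apply: contM; [exact: cont_cst|exact: segment_inv_cont].
by move=> l _; rewrite subr0 mulr0 subr0 mulr1.
Qed.

End MomentRepresentations.

(** * Operator monotonicity *)

Section OperatorMonotone.
Variable R : realType.
Local Notation C := (R[i]).
Local Notation Re := complex.Re.
Local Notation Im := complex.Im.
Local Open Scope complex_scope.
Local Open Scope sesquilinear_scope.

Let sqr_row_sum n (w : 'rV[C]_n) : (w *m w^t*) 0 0 = creal (\sum_i (Re (w 0 i) ^+ 2 + Im (w 0 i) ^+ 2)).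
Proof.
rewrite mxE /creal rmorph_sum; apply: eq_bigr => i _; rewrite adj_mxE.
case: (w 0 i) => x y; apply/eqP; rewrite eq_complex/=.
by apply/andP; split; apply/eqP; ring.
Qed.

(** In an eigenbasis, r / N is a mean of the eigenvalues with weights that are not all zero, so the
    strict bounds persist. *)
Lemma rayleigh (a b : R) n (A : 'M[C]_n) (v : 'rV[C]_n) : hermitian_in a b A -> v != 0 ->
  exists N r : R, [/\ (v *m v^t*) 0 0 = creal N, 0 < N,
    (v *m A *m v^t*) 0 0 = creal r & a * N < r < b * N].
Proof.
move=> /spectral_decomp[U [x [UU' U'U hx -> _]]] v0.
pose w := v *m U^t*.
pose q i := Re (w 0 i) ^+ 2 + Im (w 0 i) ^+ 2.
have q0 i : 0 <= q i by rewrite addr_ge0 ?sqr_ge0.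
have w0 : w != 0.
  by apply: contra_neq v0 => w0; rewrite -[v]mulmx1 -U'U mulmxA -/w w0 mul0mx.
have wE : w^t* = U *m v^t* by rewrite /w adj_mxM adj_mxK.
have vv : v *m v^t* = w *m w^t* by rewrite wE /w mulmxA -(mulmxA v) U'U mulmx1.
have qpos : 0 < \sum_i q i.
  rewrite lt_neqAle sumr_ge0 ?andbT//; apply/eqP => /esym/eqP.
  rewrite psumr_eq0// => /allP qz; move/eqP: w0; apply; apply/rowP => i.
  have := qz i (mem_index_enum i); rewrite /q/= paddr_eq0 ?sqr_ge0// !sqrf_eq0.
  by move=> hw; rewrite [RHS]mxE; apply/eqP; rewrite eq_complex.
have strict (y : 'I_n -> R) : (forall i, 0 < y i) -> 0 < \sum_i y i * q i.
  move=> y0; rewrite lt_neqAle sumr_ge0 ?andbT; last by move=> i _; rewrite mulr_ge0// ltW.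
  apply/eqP => /esym/eqP; rewrite psumr_eq0 => [|i _]; last by rewrite mulr_ge0// ltW.
  move=> /allP qz; move: qpos; rewrite big1 ?ltxx// => i _; apply/eqP.
  by have := qz i (mem_index_enum i); rewrite /= mulf_eq0 gt_eqF.
exists (\sum_i q i), (\sum_i x i * q i); split=> //.
- by rewrite vv sqr_row_sum.
- rewrite !mulmxA -/w -mulmxA -wE mxE /creal rmorph_sum; apply: eq_bigr => i _.
  have -> : (w *m diag_mx (\row_k creal (x k))) 0 i = w 0 i * creal (x i).
    by rewrite mul_mx_diag mxE; congr (_ * _); rewrite mxE.
  rewrite adj_mxE /q; case: (w 0 i) => s t.
  apply/eqP; rewrite eq_complex/=; apply/andP; split; apply/eqP; ring.
- have h1 := strict (fun i => x i - a) _; have h2 := strict (fun i => b - x i) _.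
  apply/andP; split; rewrite -subr_gt0.
    have -> : \sum_i x i * q i - a * \sum_i q i = \sum_i (x i - a) * q i.
      by rewrite mulr_sumr -sumrB; apply: eq_bigr => i _; rewrite mulrBl.
    by apply: h1 => i; rewrite subr_gt0; have /andP[] := hx i.
  have -> : b * \sum_i q i - \sum_i x i * q i = \sum_i (b - x i) * q i.
    by rewrite mulr_sumr -sumrB; apply: eq_bigr => i _; rewrite mulrBl.
  by apply: h2 => i; rewrite subr_gt0; have /andP[] := hx i.
Qed.

(** At an eigenvector of the combination, the eigenvalue is the same convex combination of the
    Rayleigh quotients of A and B, each strictly inside the interval. *)
Lemma hermitian_in_convex (a b t : R) n (A B : 'M[C]_n) : hermitian_in a b A ->
  hermitian_in a b B -> 0 <= t <= 1 -> hermitian_in a b (A + creal t *: (B - A)).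
Proof.
move=> hA hB /andP[t0 t1]; split.
  apply: hermsymD; first exact: hA.1.
  apply: hermsymZ; rewrite -scaleN1r.
  have -> : -1 = creal (-1) :> C by apply/eqP; rewrite eq_complex/= oppr0 !eqxx.
  apply: hermsymD; first exact: hB.1.
  by apply: hermsymZ; exact: hA.1.
move=> z /eigenvalueP[v vz v0].
have [N [r [vN N0 vA /andP[ra rb]]]] := rayleigh hA v0.
have [N' [r' [vN' _ vB /andP[ra' rb']]]] := rayleigh hB v0.
have NN' : N' = N by move: vN'; rewrite vN /creal => -[].
rewrite {}NN' in ra' rb' vN'.
have zN : z * creal N = creal ((1 - t) * r + t * r').
  rewrite -vN; have -> : z * (v *m v^t*) 0 0 = (v *m (A + creal t *: (B - A)) *m v^t*) 0 0.
    by rewrite vz -scalemxAl [RHS]mxE.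
  have vBA : (v *m (B - A) *m v^t*) 0 0 = creal r' - creal r.
    by rewrite mulmxBr mulmxBl mxE vB mxE vA.
  rewrite mulmxDr mulmxDl mxE vA -scalemxAr -scalemxAl mxE vBA.
  by apply/eqP; rewrite eq_complex/=; apply/andP; split; apply/eqP; ring.
have N0' : creal N != 0 by rewrite /creal eq_complex/= gt_eqF.
have -> : z = creal (((1 - t) * r + t * r') / N).
  apply: (mulIf N0'); rewrite zN -crealM divfK// gt_eqF//.
have conv p q : 0 < p -> 0 < q -> 0 < (1 - t) * p + t * q.
  move=> p0 q0; have [t1'|t1'] := ltP t 1.
    by rewrite ltr_wpDr ?mulr_ge0 ?mulr_gt0 ?subr_gt0// ltW.
  by have -> : t = 1 by [apply/eqP; rewrite eq_le t1 t1']; rewrite subrr mul0r add0r mul1r.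
rewrite !ltcR; apply/andP; split.
  rewrite ltr_pdivlMr// -subr_gt0.
  have -> : (1 - t) * r + t * r' - a * N = (1 - t) * (r - a * N) + t * (r' - a * N) by ring.
  by apply: conv; rewrite subr_gt0.
rewrite ltr_pdivrMr// -subr_gt0.
have -> : b * N - ((1 - t) * r + t * r') = (1 - t) * (b * N - r) + t * (b * N - r') by ring.
by apply: conv; rewrite subr_gt0.
Qed.

Lemma mxfunN (f : R -> R) n (A : 'M[C]_n) : mxfun (fun x => - f x) A = - mxfun f A.
Proof.
rewrite /mxfun -mulNmx -mulmxN; congr (_ *m _ *m _).
apply/matrixP => i j; rewrite !mxE.
by case: (i == j); rewrite ?mulr1n ?mulr0n ?oppr0// rmorphN.
Qed.

Theorem ocm_operator_monotone (f : R -> R) : operator_completely_monotone (-1) 1 f ->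
  operator_monotone (-1) 1 (fun x => - f x).
Proof.
move=> ocm n A B hA hB hAB; have cm := ocm_completely_monotone ocm.
pose c k := f^`(k)%classic 0 / k`!%:R.
have hc (x : R) : -1 < x < 1 -> pseries c x @ \oo --> f x.
  exact: (completely_monotone_pseries ocm.1 cm).
have f0 x : -1 < x < 1 -> 0 <= f x.
  by move=> x1; have := cm 0%N x x1; rewrite expr0 mul1r.
have hAp := psdmx_mxfun hA f0; have hBp := psdmx_mxfun hB f0.
rewrite /loewner_le !mxfunN opprK addrC.
pose X := B - A; have hX : psdmx X by exact: hAB.
have m1 : -1 = creal (-1) :> C by apply/eqP; rewrite eq_complex/= oppr0 !eqxx.
apply/psdmxP; split.
  rewrite -scaleN1r m1; apply: hermsymD; first exact: hAp.1.
  by apply: hermsymZ; exact: hBp.1.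
move=> u; set W := u^t* *m u; rewrite mxtrace_mulB complexReB subr_ge0.
pose phi (t : R) := Re (\tr (W *m mxfun f (A + creal t *: X))).
have herm t : 0 <= t <= 1 -> hermitian_in (-1) 1 (A + creal t *: X).
  exact: hermitian_in_convex.
have shift t s : A + creal t *: X + creal s *: X = A + creal (s + t) *: X.
  rewrite -addrA -scalerDl; congr (_ + _ *: _).
  by rewrite [s + t]addrC /creal rmorphD.
have dphi t : 0 <= t <= 1 -> derivable phi t 1 /\ phi^`()%classic t <= 0.
  move=> t01; have ht := herm t t01.
  (* The hypothesis gives derivatives at 0 only: the derivative of the path at t is read at 0 on the
     pencil based at A + t X. *)
  pose F s := Re (\tr (W *m mxfun f (A + creal t *: X + creal s *: X))).
  have FE : F = (fun s => phi (s + t)) by apply/funext => s; rewrite /F shift.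
  have [dF hF] := trace_mxfun_pencil hc ht hX.1 W.
  have [_ hF'] := mxfun_pencil hc ht hX.1.
  have E := cvgn_unique (hF 1%N) (hF' W 1%N).
  have P : 0 <= - (Re (\tr (W *m derivemx 1 (fun s => mxfun f (A + creal t *: X + creal s *: X)) 0))).
    have [_ /(_ u)] := (psdmxP _).1 (ocm.2 n _ X ht hX 1%N).
    by rewrite expr1 mxtrace_mulZ m1 complexReZ mulN1r.
  have {}E : derive1 F 0 <= 0.
    have h : (1`!%:R : R)^-1 != 0 by rewrite invr_eq0 pnatr_eq0.
    by rewrite -oppr_ge0; move: (mulIf h E) P => /= <-.
  have phiE : phi = (fun s => F (s + - t)) by apply/funext => s; rewrite FE subrK.
  have d : is_derive t 1 phi (derive1 F 0).
    have h : is_derive (t - t) 1 F (derive1 F 0).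
      by rewrite subrr derive1E; apply: DeriveDef.
    have := @is_derive1_comp _ F (fun s => s + - t) t _ _ h (is_deriveD (is_derive_id t 1) (is_derive_cst (- t) t 1)).
    by rewrite addr0 mulr1 phiE.
  split; first by apply: ex_derive.
  by rewrite derive1E derive_val.
have a0 : A + creal 0 *: X = A by rewrite -[RHS]addr0 -[in RHS](scale0r X).
have a1 : A + creal 1 *: X = B by rewrite -[RHS](subrKC A) -[in RHS](scale1r (B - A)).
have p0 : phi 0 = Re (\tr (W *m mxfun f A)) := congr1 (fun M => Re (\tr (W *m mxfun f M))) a0.
have p1 : phi 1 = Re (\tr (W *m mxfun f B)) := congr1 (fun M => Re (\tr (W *m mxfun f M))) a1.
clearbody phi; suff : phi 1 <= phi 0 by rewrite p0 p1.
apply: (@ler0_derive1_nincr _ phi 0 1 _ _ _ 0 1 (lexx _) ler01 (lexx _)).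
- by move=> t; rewrite in_itv/= => /andP[t0 t1]; apply: (dphi t _).1; rewrite !ltW.
- by move=> t; rewrite in_itv/= => /andP[t0 t1]; apply: (dphi t _).2; rewrite !ltW.
- apply: continuous_in_subspaceT => t; rewrite inE/= in_itv/= => t01.
  by apply: differentiable_continuous; apply/derivable1_diffP; exact: (dphi t t01).1.
Qed.

End OperatorMonotone.

Theorem proposition4p5 (R : realType) (f : R -> R) :
  let cond_i := operator_completely_monotone (-1) 1 f in
  let cond_ii :=
    (forall x : R, -1 < x < 1 -> - f x <= 0) /\
    operator_monotone (-1) 1 (fun x : R => - f x) /\
    (exists mu : finite_borel_measure R,
        representing_measure (fun x : R => - f x) mu /\
        concentrated_on mu `[-1, 0]) in
  let cond_iii :=
    exists (beta : R) (mu : finite_borel_measure R),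
      integral_expression f beta mu /\
      (forall (beta' : R) (nu : finite_borel_measure R),
          integral_expression f beta' nu -> same_measure nu mu) in
  (cond_i <-> cond_ii) /\ (cond_ii <-> cond_iii).
Proof.
move=> cond_i cond_ii cond_iii.
have i_ii : cond_i -> cond_ii.
  move=> ocm; split; last split.
  - move=> x x1; rewrite oppr_le0.
    by have := ocm_completely_monotone ocm 0%N x1; rewrite expr0 mul1r.
  - exact: ocm_operator_monotone.
  - have [nu [nuE hnu]] := ocm_moment_measure ocm.
    by exists nu; split=> //; exact: represents_from_zero.
have ii_iii : cond_ii -> cond_iii.
  move=> [f0 [_ [nu [[hnu _] nuE]]]].
  have [|beta [mu hmu]] := integral_expression_exists nuE _ (representing_measure_zero hnu nuE).
    by move=> x x1; rewrite -oppr_le0 f0.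
  by exists beta, mu; split=> // beta' mu' hmu'; exact: integral_expression_unique hmu hmu'.
have iii_i : cond_iii -> cond_i.
  by move=> [beta [mu [hmu _]]]; exact: integral_expression_ocm hmu.
by split; split; auto.
Qed.
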